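(* Consider the online subspace ZO-SGD described in the context, run for $T$ steps on a dataset $S$ of size $n$. Assume (C-1), (C-2), that $\mathbf M_t$ is symmetric PSD with $\sigma_{\max}(\mathbf M_t)=1$ and $\mathrm{srank}(\mathbf M_t)\le s$, that the Local Intrinsic Dimension assumption holds for every per-sample loss $\mathcal{L}_i$ (with corresponding alignments $\rho_t$ and $\rho_{\max}=\max_t\rho_t$), and that $\sup_{\bm\theta,\mathbf z}|\mathcal{L}(\bm\theta;\mathbf z)|\le1$. Let $C>0$ be a fixed constant, and take step sizes $\alpha_t\le C/t$ and smoothing parameter $\mu\le\frac{1}{nL(\rho_{\max}+s\exp(-s/2))}$. Then the generalization error satisfies $$\epsilon_{\mathrm{gen}}\le\mathcal O\Big(\frac{T^{1-\frac1{1+q}}}{n}\Big),\qquad q=CL\sqrt s,$$ where the constant in $\mathcal O$ depends only on $q$, $G$ and $L$ (and not on $d$).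
   Context: Per-sample loss $\mathcal{L}(\bm\theta;\mathbf z)$, $\bm\theta\in\mathbb R^d$; data distribution $\mathcal D$; dataset $S=\{\mathbf z_1,\dots,\mathbf z_n\}$ drawn i.i.d. from $\mathcal D$; $\mathcal{L}_i(\bm\theta)=\mathcal{L}(\bm\theta;\mathbf z_i)$. (C-1): each $\mathcal{L}_i$ is $L$-smooth. (C-2): $\mathbb E[\nabla\mathcal{L}_i(\bm\theta)]=\nabla\mathcal{L}(\bm\theta)$, $\mathbb E\|\nabla\mathcal{L}(\bm\theta)-\nabla\mathcal{L}_i(\bm\theta)\|^2\le\sigma^2$, $\|\nabla\mathcal{L}(\bm\theta)\|\le G$. Online subspace ZO-SGD: at step $t$ an index $i_t$ is drawn uniformly from $[n]$, $\mathbf u_t\sim\mathcal N(\mathbf 0,\mathbf I_d)$, and $$\bm\theta_{t+1}=\bm\theta_t-\alpha_t\frac{\mathcal{L}(\bm\theta_t+\mu\mathbf M_t\mathbf u_t;\mathbf z_{i_t})-\mathcal{L}(\bm\theta_t-\mu\mathbf M_t\mathbf u_t;\mathbf z_{i_t})}{2\mu}\mathbf M_t\mathbf u_t.$$ Let $\mathcal A(S)$ denote the output after $T$ steps. Generalization error: $\epsilon_{\mathrm{gen}}=\mathbb E[R(\mathcal A(S))-R_S(\mathcal A(S))]$, with $R(\bm\theta)=\mathbb E_{\mathbf z\sim\mathcal D}\mathcal{L}(\bm\theta;\mathbf z)$ and $R_S(\bm\theta)=\frac1n\sum_i\mathcal{L}(\bm\theta;\mathbf z_i)$. $\mathrm{srank}(\mathbf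 A)=\sum_i\sigma_i(\mathbf A)^2/\sigma_{\max}(\mathbf A)^2$, $\mathrm{intdim}(\mathbf A)=\mathrm{Tr}(\mathbf A)/\|\mathbf A\|_{\mathrm{op}}$. Local Intrinsic Dimension assumption for a loss $f$ at $\bm\theta_t$ (constant $r\le d$): there is a symmetric PSD $\mathbf H(\bm\theta_t)\preceq L\mathbf I_d$ with $\nabla^2 f(\bm\theta)\preceq\mathbf H(\bm\theta_t)$ for all $\|\bm\theta-\bm\theta_t\|\le2\alpha_t sG+2\mu\sqrt d$ and $\mathrm{intdim}(\mathbf H(\bm\theta_t))\le r$. Subspace alignment $\rho_t=\mathrm{Tr}(\mathbf M_t^\top\mathbf H(\bm\theta_t)\mathbf M_t)/\lambda_{\max}(\mathbf H(\bm\theta_t))$. *)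

(* Defs.v *)
From HB Require Import structures.
From mathcomp Require Import all_boot all_order all_algebra.
From mathcomp Require Import all_classical all_reals all_analysis.
Set Implicit Arguments.
Unset Strict Implicit.
Unset Printing Implicit Defensive.
Import Order.TTheory GRing.Theory Num.Theory.
Import numFieldNormedType.Exports.
Local Open Scope classical_set_scope.
Local Open Scope ring_scope.

Section ZOSGD.
Variables (R : realType) (d : nat).

Definition enorm (x : 'rV[R]_d) : R := Num.sqrt (\sum_j x 0 j ^+ 2).

Definition ebasis (j : 'I_d) : 'rV[R]_d := delta_mx 0 j.

Definition grad (f : 'rV[R]_d -> R) (x : 'rV[R]_d) : 'rV[R]_d :=
  \row_j ('D_(ebasis j) f x).
Definition hess (f : 'rV[R]_d -> R) (x : 'rV[R]_d) : 'M[R]_d :=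
  \matrix_(i, j) ('D_(ebasis j) (fun y => 'D_(ebasis i) f y) x).

Definition twice_differentiable_at (f : 'rV[R]_d -> R) (x : 'rV[R]_d) : Prop :=
  differentiable f x /\ forall i, differentiable (fun y => 'D_(ebasis i) f y) x.

Definition Lsmooth (L : R) (f : 'rV[R]_d -> R) : Prop :=
  (forall x, differentiable f x) /\
  forall x y, enorm (grad f x - grad f y) <= L * enorm (x - y).

Definition qform (A : 'M[R]_d) (x : 'rV[R]_d) : R := (x *m A *m x^T) 0 0.
Definition psd (A : 'M[R]_d) : Prop := A^T = A /\ forall x, 0 <= qform A x.
Definition loewner_le (A B : 'M[R]_d) : Prop := forall x, qform A x <= qform B x.

Definition lambda_max (A : 'M[R]_d) : R := sup [set a : R | eigenvalue A a].
Definition sigma_max (A : 'M[R]_d) : R := Num.sqrt (lambda_max (A^T *m A)).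
Definition opnorm (A : 'M[R]_d) : R := sigma_max A.

(* stable rank: sum_i sigma_i(A)^2 / sigma_max(A)^2, using
   sum_i sigma_i(A)^2 = tr(A^T A) *)
Definition srank (A : 'M[R]_d) : R := \tr (A^T *m A) / sigma_max A ^+ 2.

Definition intdim (A : 'M[R]_d) : R := \tr A / opnorm A.

(* Local Intrinsic Dimension assumption for f at theta with constant r,
   radius rad (= 2 alpha_t s G + 2 mu sqrt d) and witness matrix H *)
Definition LID (f : 'rV[R]_d -> R) (theta : 'rV[R]_d) (L r rad : R)
    (H : 'M[R]_d) : Prop :=
  [/\ psd H, loewner_le H (L%:M),
      (forall y, enorm (y - theta) <= rad ->
         twice_differentiable_at f y /\ loewner_le (hess f y) H)
    & intdim H <= r].

Definition alignment (M H : 'M[R]_d) : R := \tr (M^T *m H *m M) / lambda_max H.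

Definition zo_step (Z : Type) (loss : 'rV[R]_d -> Z -> R) (zi : Z)
    (a mu : R) (M : 'M[R]_d) (u : 'rV[R]_d) (theta : 'rV[R]_d) : 'rV[R]_d :=
  let v := u *m M^T in (* the row vector (M u)^T *)
  theta - (a * (loss (theta + mu *: v) zi - loss (theta - mu *: v) zi)
               / (2 * mu)) *: v.

(* zo_iter ... k = theta_{k+1}: theta_1 = theta1, and step t (t >= 1)
   uses index i_t, direction u_t, step size alpha_t, matrix M_t. *)
Fixpoint zo_iter (Z : Type) (n : nat) (loss : 'rV[R]_d -> Z -> R)
    (alpha : nat -> R) (mu : R) (M : nat -> 'M[R]_d) (theta1 : 'rV[R]_d)
    (zs : 'I_n -> Z) (idx : nat -> 'I_n) (u : nat -> 'rV[R]_d) (k : nat)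
    : 'rV[R]_d :=
  match k with
  | 0 => theta1
  | k'.+1 => zo_step loss (zs (idx k)) (alpha k) mu (M k) (u k)
               (zo_iter loss alpha mu M theta1 zs idx u k')
  end.

Definition pop_risk (dZ : measure_display) (Z : measurableType dZ)
    (D : probability Z R) (loss : 'rV[R]_d -> Z -> R) (theta : 'rV[R]_d) : R :=
  fine (\int[D]_z (loss theta z)%:E)%E.

Definition emp_risk (Z : Type) (n : nat) (loss : 'rV[R]_d -> Z -> R)
    (zs : 'I_n -> Z) (theta : 'rV[R]_d) : R :=
  (\sum_i loss theta (zs i)) / n%:R.

End ZOSGD.

(* Main.v *)
Require Import Defs.
From HB Require Import structures.
From mathcomp Require Import all_boot all_order all_algebra.
From mathcomp Require Import all_classical all_reals all_analysis.
From mathcomp Require Import measurable_realfun ring lra.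
Import Order.TTheory GRing.Theory Num.Theory.
Import numFieldNormedType.Exports.
Local Open Scope classical_set_scope.
Local Open Scope ring_scope.

Set Implicit Arguments.
Unset Strict Implicit.
Unset Printing Implicit Defensive.

(** Losses bounded by 1 and [L]-smooth have gradients bounded by [sqrt (8 L)], so
    it suffices to compare the trajectory on [S] with the one on [S] with the
    i-th sample replaced by a fresh point (ghost sample), coupled through the same
    indices and Gaussian directions.  When both use the same sample, the finite
    differences combine into an odd function [D] of the Gaussian direction [u]
    whose gradient is at most [ell = L |theta - theta'|].  Rotation invariance of
    a pair of independent Gaussian vectors gives, without dimension dependence,
    [E [D u * <w, u>] <= ell |w|] and [E [D u ^ 4] <= c ell ^ 4]; hence the
    expected distance is multiplied by at most [1 + q / t + k / t^2].  Different
    samples are met with probability [1 / n] and add [O (1 / t)].  Assuming that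
    sample [i] is not drawn before time [t0], which fails with probability at
    most [t0 / n], and solving this recursion bounds the error by a constant times
    [(T / t0) ^ q / n + t0 / n]; take [t0] of order [T ^ (q / (1 + q))]. *)

(** * Euclidean norm, smooth functions, operator norm *)

Section Euclid.
Variables (R : realType) (d : nat).
Implicit Types x y w : 'rV[R]_d.

(** The exponent must be exactly [q], so no absolute constant may multiply the term of order [1 / t]
    in the contraction factor. The triangle inequality fails here: bounding the mean of
    [|D u| * |M u|] gives [c * ell * Num.sqrt s] with some [c > 1], hence an exponent [c * q]. The
    squared distance is expanded instead. Its only term of order [alpha] is the mean of [D u] times
    a linear functional of [u], whose bound has constant 1 and no factor [Num.sqrt s]. Fourth
    moments then enter only at order [alpha ^ 2], which is summable for step sizes at most [C / t].
    Gaussian integration by parts and a Poincare-type inequality would be the usual source of the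
    two bounds on [D]. Rotating an independent pair replaces both: it asks only for a second-order
    Taylor bound, and the remainder, which depends on [mu], disappears as the angle tends to 0. *)

Definition dot x y : R := \sum_j x 0 j * y 0 j.

Lemma dotC x y : dot x y = dot y x.
Proof. by apply: eq_bigr => j _; rewrite mulrC. Qed.

Lemma dotDl x y w : dot (x + y) w = dot x w + dot y w.
Proof. by rewrite -big_split; apply: eq_bigr => j _; rewrite mxE mulrDl. Qed.

Lemma dotZl a x y : dot (a *: x) y = a * dot x y.
Proof. by rewrite mulr_sumr; apply: eq_bigr => j _; rewrite mxE mulrA. Qed.

Lemma dotNl x y : dot (- x) y = - dot x y.
Proof. by rewrite -scaleN1r dotZl mulN1r. Qed.

Lemma dotBl x y w : dot (x - y) w = dot x w - dot y w.
Proof. by rewrite dotDl dotNl. Qed.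

Lemma dotDr w x y : dot w (x + y) = dot w x + dot w y.
Proof. by rewrite dotC dotDl !(dotC w). Qed.

Lemma dotZr a x y : dot x (a *: y) = a * dot x y.
Proof. by rewrite dotC dotZl dotC. Qed.

Lemma dotNr x y : dot x (- y) = - dot x y.
Proof. by rewrite dotC dotNl dotC. Qed.

Lemma dotBr w x y : dot w (x - y) = dot w x - dot w y.
Proof. by rewrite dotDr dotNr. Qed.

Lemma dot0l x : dot 0 x = 0.
Proof. by rewrite -(scale0r x) dotZl mul0r. Qed.

Lemma dot_ge0 x : 0 <= dot x x.
Proof. by apply: sumr_ge0 => j _; rewrite -expr2 sqr_ge0. Qed.

Lemma enormE x : enorm x = Num.sqrt (dot x x).
Proof. by congr Num.sqrt; apply: eq_bigr => j _; rewrite expr2. Qed.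

Lemma enorm_ge0 x : 0 <= enorm x. Proof. exact: sqrtr_ge0. Qed.

Lemma sqr_enorm x : enorm x ^+ 2 = dot x x.
Proof. by rewrite enormE sqr_sqrtr// dot_ge0. Qed.

Lemma enorm0 : enorm (0 : 'rV[R]_d) = 0.
Proof. by rewrite enormE dot0l sqrtr0. Qed.

Lemma ler_coord_enorm x j : `|x 0 j| <= enorm x.
Proof.
rewrite -sqrtr_sqr enormE ler_sqrt ?dot_ge0//.
rewrite /dot (bigD1 j)//= -expr2 lerDl sumr_ge0// => i _.
by rewrite -expr2 sqr_ge0.
Qed.

Lemma enorm_eq0 x : enorm x = 0 -> x = 0.
Proof.
move=> x0; apply/rowP => j; rewrite mxE; apply/eqP.
by rewrite -normr_le0 -x0 ler_coord_enorm.
Qed.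

Lemma enormZ a x : enorm (a *: x) = `|a| * enorm x.
Proof.
by rewrite !enormE dotZl dotZr mulrA -expr2 sqrtrM ?sqr_ge0// sqrtr_sqr.
Qed.

Lemma enormN x : enorm (- x) = enorm x.
Proof. by rewrite -scaleN1r enormZ normrN1 mul1r. Qed.

Lemma enormBC x y : enorm (x - y) = enorm (y - x).
Proof. by rewrite -enormN opprB. Qed.

Lemma dot_sqr_le x y : dot x y ^+ 2 <= dot x x * dot y y.
Proof.
have [y0|y0] := eqVneq (enorm y) 0.
  by rewrite (enorm_eq0 y0) dotC !dot0l expr0n mulr0.
have yy : 0 < dot y y by rewrite -sqr_enorm exprn_gt0// lt0r y0 enorm_ge0.
have := dot_ge0 (dot y y *: x - dot x y *: y).
rewrite !(dotBl, dotBr, dotZl, dotZr) (dotC y x).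
set a := dot x y; set b := dot y y in yy *; set c := dot x x.
by rewrite -[_ <= c * b]subr_ge0 -(pmulr_rge0 (c * b - a ^+ 2) yy); congr (_ <= _); ring.
Qed.

Lemma ler_dot x y : `|dot x y| <= enorm x * enorm y.
Proof.
rewrite -(ger0_norm (mulr_ge0 (enorm_ge0 x) (enorm_ge0 y))).
by rewrite -ler_sqr ?nnegrE// !real_normK ?num_real// exprMn !sqr_enorm dot_sqr_le.
Qed.

Lemma dot_le x y : dot x y <= enorm x * enorm y.
Proof. exact: le_trans (ler_norm _) (ler_dot x y). Qed.

Lemma ler_enormD x y : enorm (x + y) <= enorm x + enorm y.
Proof.
rewrite -ler_sqr ?nnegrE ?addr_ge0 ?enorm_ge0// sqr_enorm.
rewrite !(dotDl, dotDr) (dotC y x) sqrrD !sqr_enorm.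
by have := dot_le x y; lra.
Qed.

Lemma ler_enormB x y : enorm (x - y) <= enorm x + enorm y.
Proof. by rewrite -(enormN y) ler_enormD. Qed.

Lemma ler_dist_enorm x y : `|enorm x - enorm y| <= enorm (x - y).
Proof.
rewrite ler_norml; apply/andP; split.
  rewrite lerNl opprB lerBlDr (enormBC x) -{1}(subrK x y); exact: ler_enormD.
by rewrite lerBlDr -{1}(subrK y x); exact: ler_enormD.
Qed.

Lemma dotE x y : dot x y = (x *m y^T) 0 0.
Proof. by rewrite mxE; apply: eq_bigr => j _; rewrite mxE. Qed.

Lemma dot_mulmx x y (A : 'M[R]_d) : dot (x *m A) y = dot x (y *m A^T).
Proof. by rewrite !dotE trmx_mul trmxK mulmxA. Qed.

Lemma dot_delta x j : dot (delta_mx 0 j) x = x 0 j.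
Proof.
rewrite /dot (bigD1 j)//= big1 ?addr0 => [|i ij]; rewrite mxE eqxx.
  by rewrite eqxx mul1r.
by rewrite (negbTE ij) mul0r.
Qed.

Lemma mulmx_coordE x (A : 'M[R]_d) j : (x *m A^T) 0 j = dot x (row j A).
Proof. by rewrite mxE; apply: eq_bigr => i _; rewrite !mxE. Qed.

Lemma enorm_le_sum x : enorm x <= \sum_j `|x 0 j|.
Proof.
have -> : x = \sum_j x 0 j *: delta_mx 0 j by exact: row_sum_delta.
have bigD (s : seq 'I_d) : enorm (\sum_(j <- s) x 0 j *: delta_mx 0 j)
    <= \sum_(j <- s) `|x 0 j|.
  elim: s => [|j s IH]; first by rewrite !big_nil enorm0.
  rewrite !big_cons (le_trans (ler_enormD _ _))// lerD// enormZ.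
  rewrite -[leRHS]mulr1 ler_wpM2l// enormE dot_delta mxE !eqxx.
  by rewrite sqrtr1.
apply: le_trans (bigD _) _.
by apply: ler_sum => j _; rewrite -row_sum_delta.
Qed.

End Euclid.

(** * Continuity of real-valued functions *)

Section RealContinuity.
Variables (R : realType) (T : topologicalType).
Implicit Types f g : T -> R.

Lemma continuous_mulr f g : continuous f -> continuous g ->
  continuous (fun x => f x * g x).
Proof. by move=> cf cg x; exact: cvgM (cf x) (cg x). Qed.

Lemma continuous_addr f g : continuous f -> continuous g ->
  continuous (fun x => f x + g x).
Proof. by move=> cf cg x; exact: cvgD (cf x) (cg x). Qed.

Lemma continuous_distr (a : R) f : continuous f -> continuous (fun x => `|a - f x|).
Proof. by move=> cf x; exact: cvg_norm (cvgB (cvg_cst a) (cf x)). Qed.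

Lemma continuous_sumr n (F : 'I_n -> T -> R) :
  (forall j, continuous (F j)) -> continuous (fun y => \sum_j F j y).
Proof.
move=> cF; rewrite unlock; elim: (index_enum _) => [|j s IH] /=.
  by move=> x; exact: cvg_cst.
exact: continuous_addr.
Qed.

Lemma continuous_at_le f g x : (forall y, `|f x - f y| <= g y) ->
  continuous g -> g x = 0 -> {for x, continuous f}.
Proof.
move=> fg cg gx; apply/cvgrPdist_le => e e0.
have /cvgrPdist_le/(_ _ e0) := cg x.
apply: filterS => y; rewrite gx sub0r normrN; apply: le_trans.
exact: le_trans (fg y) (ler_norm _).
Qed.

End RealContinuity.

(** * Gradients of smooth functions *)

Section Calculus.
Variables (R : realType) (d : nat).
Implicit Types (f : 'rV[R]_d -> R) (x h : 'rV[R]_d).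

Lemma dot_grad f x h : differentiable f x -> dot (grad f x) h = 'D_h f x.
Proof.
move=> fx; rewrite deriveE// {2}(row_sum_delta h) linear_sum.
by apply: eq_bigr => j _; rewrite mxE deriveE// linearZ/= mulrC.
Qed.

Lemma is_derive_line f x h (t : R) : (forall y, differentiable f y) ->
  is_derive t 1 (fun s => f (x + s *: h)) (dot (grad f (x + t *: h)) h).
Proof.
move=> df.
have E : (fun s : R => s^-1 *: (((fun s => f (x + s *: h)) \o shift t) (s *: 1)
     - f (x + t *: h))) =
   (fun s : R => s^-1 *: ((f \o shift (x + t *: h)) (s *: h) - f (x + t *: h))).
  apply/funext => s /=; congr (_ *: (f _ - _)).
  by rewrite [s *: 1]mulr1 scalerDl addrCA.
split.
  rewrite /derivable E; exact: diff_derivable.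
by rewrite dot_grad// /derive E.
Qed.

Lemma mvt_grad f x h : (forall y, differentiable f y) ->
  exists2 t : R, 0 <= t <= 1 & f (x + h) - f x = dot (grad f (x + t *: h)) h.
Proof.
move=> df.
have H (t : R) := @is_derive_line f x h t df.
have [|t] := @MVT_segment R (fun s => f (x + s *: h))
    (fun t => dot (grad f (x + t *: h)) h) 0 1 ler01 (fun t _ => H t).
  apply: continuous_subspaceT => t.
  apply: differentiable_continuous; apply/derivable1_diffP.
  by case: (H t).
rewrite in_itv/= => t01; rewrite scale1r scale0r addr0 subr0 mulr1 => ->.
by exists t.
Qed.

Lemma continuous_lip f (K : R) :
  (forall x y, `|f x - f y| <= K * enorm (x - y)) -> continuous f.
Proof.
move=> fK x.
apply: (@continuous_at_le _ _ _ (fun y : 'rV[R]_d => `|K| * \sum_j `|x 0 j - y 0 j|)).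
- move=> y; apply: le_trans (fK x y) _.
  apply: (@le_trans _ _ (`|K| * enorm (x - y))).
    by rewrite ler_wpM2r ?enorm_ge0 ?ler_norm.
  rewrite ler_wpM2l//; apply: le_trans (enorm_le_sum _) _.
  by apply: ler_sum => j _; rewrite !mxE.
- apply: continuous_mulr; first exact: cst_continuous.
  by apply: continuous_sumr => j; apply: continuous_distr => y; exact: coord_continuous.
- by rewrite big1 ?mulr0// => j _; rewrite subrr normr0.
Qed.

Lemma Lsmooth_continuous (L : R) f : Lsmooth L f -> continuous f.
Proof. by case=> df _ x; exact: differentiable_continuous. Qed.

Lemma Lsmooth_gt0 (L : R) f : (0 < d)%N -> Lsmooth L f -> 0 <= L.
Proof.
case: d f => // k f _ [_ /(_ 0 (delta_mx 0 ord0))].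
rewrite sub0r enormN (enormE (delta_mx _ _)) dot_delta mxE eqxx sqrtr1 mulr1.
exact: le_trans (enorm_ge0 _).
Qed.

(** The mean value theorem compares two gradients at distance at most [enorm h]. Integrating along
    the segment would give [L / 2]; the factor 2 only affects constants. *)
Lemma Lsmooth_taylor (L : R) f x h : 0 <= L -> Lsmooth L f ->
  `|f (x + h) - f x - dot (grad f x) h| <= L * enorm h ^+ 2.
Proof.
move=> L0 [df Lf]; have [t /andP[t0 t1] ->] := mvt_grad x h df.
rewrite -dotBl; apply: le_trans (ler_dot _ _) _.
rewrite expr2 mulrA ler_wpM2r ?enorm_ge0//; apply: le_trans (Lf _ _) _.
rewrite addrAC subrr add0r enormZ ger0_norm// ler_wpM2l// ler_piMl//.
exact: enorm_ge0.
Qed.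

(** A gradient step of size [1 / (2 L)] lowers [f] by at least [enorm g ^+ 2 / (4 L)], and a
    function with values in [[-1, 1]] cannot drop by more than 2. *)
Lemma Lsmooth_grad_bound (L : R) f x : 0 < L -> Lsmooth L f ->
  (forall y, `|f y| <= 1) -> enorm (grad f x) <= Num.sqrt (8 * L).
Proof.
move=> L0 Lf f1; set g := grad f x.
have := Lsmooth_taylor x (- (2 * L)^-1 *: g) (ltW L0) Lf.
rewrite -/g enormZ exprMn dotZr -sqr_enorm normrN.
rewrite (ger0_norm (_ : 0 <= (2 * L)^-1)); last by rewrite invr_ge0; lra.
have -> : L * ((2 * L)^-1 ^+ 2 * enorm g ^+ 2) = enorm g ^+ 2 / (4 * L).
  by field; rewrite gt_eqF.
have -> : - (2 * L)^-1 * enorm g ^+ 2 = - (2 * (enorm g ^+ 2 / (4 * L))).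
  by field; rewrite gt_eqF.
set e := _ / _ => H.
have {H} e2 : e <= 2.
  move: H (f1 (x + - (2 * L)^-1 *: g)) (f1 x).
  rewrite !ler_norml => /andP[H1 H2] /andP[H3 H4] /andP[H5 H6]; lra.
rewrite -(ger0_norm (enorm_ge0 g)) -sqrtr_sqr ler_sqrt; last lra.
move: e2; rewrite /e ler_pdivrMr; lra.
Qed.

Lemma Lsmooth_lip (L : R) f x y : 0 < L -> Lsmooth L f ->
  (forall y, `|f y| <= 1) -> `|f x - f y| <= Num.sqrt (8 * L) * enorm (x - y).
Proof.
move=> L0 Lf f1; have [t _] := mvt_grad y (x - y) Lf.1.
rewrite [y + _]addrC subrK => ->; apply: le_trans (ler_dot _ _) _.
by rewrite ler_wpM2r ?enorm_ge0// Lsmooth_grad_bound.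
Qed.

End Calculus.

(** * Quadratic forms and the largest singular value *)

Section OpNorm.
Variables (R : realType) (d : nat).
Implicit Types (x y : 'rV[R]_d) (M C : 'M[R]_d).

Lemma quad_ge0_eq0 (a b : R) : (forall t, 0 <= 2 * t * a + t ^+ 2 * b) -> a = 0.
Proof.
move=> H; apply/eqP; have [//|a0] := eqVneq a 0.
have b0 : 0 <= b by have := H 1; have := H (-1); lra.
(* Almost the minimizer [- a / b]; the shifted denominator also covers [b = 0]. *)
have := H (- a / (b + 1)); have b1 : b + 1 != 0 by lra.
have -> : 2 * (- a / (b + 1)) * a + (- a / (b + 1)) ^+ 2 * b =
  - (a ^+ 2 * (b + 2)) / (b + 1) ^+ 2 by field.
rewrite pmulr_lge0 ?invr_gt0 ?exprn_gt0//; last lra.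
rewrite oppr_ge0 leNgt => /negP[]; apply: mulr_gt0; last lra.
by rewrite exprn_even_gt0.
Qed.

(** A zero of a nonnegative form is a minimum, so along every line [x + t *: y] the linear
    coefficient vanishes. *)
Lemma psd_kernel C x : C^T = C -> (forall y, 0 <= dot (y *m C) y) ->
  dot (x *m C) x = 0 -> x *m C = 0.
Proof.
move=> CT C0 xC.
have H y : dot (x *m C) y = 0.
  apply: (@quad_ge0_eq0 _ (dot (y *m C) y)) => t.
  have := C0 (x + t *: y).
  rewrite mulmxDl -scalemxAl !(dotDl, dotDr, dotZl, dotZr) xC.
  rewrite (dot_mulmx _ y) CT (dotC _ y).
  rewrite (dotC _ x); by congr (_ <= _); ring.
apply: enorm_eq0; apply/eqP; rewrite -sqrf_eq0 sqr_enorm; exact/eqP/H.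
Qed.

Lemma continuous_mulmx_coord C j : continuous (fun x : 'rV[R]_d => (x *m C) 0 j).
Proof.
rewrite (_ : (fun x : 'rV[R]_d => _) = fun x : 'rV[R]_d =>
   \sum_i x 0 i * C i j); last by apply/funext => y; rewrite mxE.
apply: continuous_sumr => i; apply: continuous_mulr; last exact: cst_continuous.
move=> y; exact: coord_continuous.
Qed.

Lemma continuous_dot_mulmx C : continuous (fun x : 'rV[R]_d => dot (x *m C) x).
Proof.
apply: continuous_sumr => i; apply: continuous_mulr => y.
  exact: continuous_mulmx_coord.
exact: coord_continuous.
Qed.

Lemma compact_sphere : compact [set x : 'rV[R]_d | enorm x = 1].
Proof.
apply: bounded_closed_compact.
  exists 1; split; first exact: num_real.
  move=> e e1 x /= x1.
  rewrite /Num.norm/= mx_normrE; apply/bigmax_leP; split; first by apply/ltW; lra.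
  move=> [i j] _ /=; rewrite ord1; apply: le_trans (ler_coord_enorm _ _) _.
  by rewrite x1 ltW.
have ce : continuous (@enorm R d).
  apply: (@continuous_lip _ _ _ 1) => x y; rewrite mul1r; exact: ler_dist_enorm.
have -> : [set x : 'rV[R]_d | enorm x = 1] = @enorm R d @^-1` [set 1] by [].
apply: closed_comp => [x _|]; [exact: ce|exact: closed_eq].
Qed.

(* A maximizer of the quadratic form on the unit sphere is an eigenvector. *)
Lemma rayleigh C m : C^T = C -> (forall a, eigenvalue C a -> a <= m) ->
  forall x, dot (x *m C) x <= m * dot x x.
Proof.
move=> CT Cm x.
have [x0|x0] := eqVneq (enorm x) 0.
  by rewrite (enorm_eq0 x0) mul0mx !dot0l mulr0.
have scal (c : R) (y : 'rV[R]_d) : dot (c *: y *m C) (c *: y) = c ^+ 2 * dot (y *m C) y.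
  by rewrite -scalemxAl dotZl dotZr mulrA -expr2.
have unit1 (y : 'rV[R]_d) : enorm y != 0 -> enorm ((enorm y)^-1 *: y) = 1.
  by move=> y0; rewrite enormZ ger0_norm ?invr_ge0 ?enorm_ge0// mulVf.
have [||v v1 vmax] := @EVT_max_rV R d (fun x => dot (x *m C) x)
    [set x : 'rV[R]_d | enorm x = 1] _ compact_sphere.
- by exists ((enorm x)^-1 *: x) => /=; rewrite unit1.
- exact/continuous_subspaceT/continuous_dot_mulmx.
rewrite inE/= in v1; set a := dot (v *m C) v in vmax.
have max y : dot (y *m C) y <= a * dot y y.
  have [y0|y0] := eqVneq (enorm y) 0.
    by rewrite (enorm_eq0 y0) mul0mx !dot0l mulr0.
  have := vmax ((enorm y)^-1 *: y); rewrite inE/= unit1// => /(_ erefl).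
  rewrite scal exprVn sqr_enorm ler_pdivrMl; first by rewrite mulrC.
  by rewrite -sqr_enorm exprn_gt0// lt0r y0 enorm_ge0.
apply: le_trans (max x) _; rewrite ler_wpM2r ?dot_ge0//; apply: Cm.
apply/eigenvalueP; exists v; last first.
  apply: contra_eq_neq v1 => ->; rewrite enorm0; apply/eqP; lra.
have : v *m (a%:M - C) = 0.
  apply: psd_kernel => [|y|].
  - by rewrite linearB/= CT tr_scalar_mx.
  - by rewrite mulmxBr dotBl mul_mx_scalar dotZl subr_ge0.
  - rewrite mulmxBr dotBl mul_mx_scalar dotZl -sqr_enorm v1 -/a; ring.
by rewrite mulmxBr mul_mx_scalar => /eqP; rewrite subr_eq0 => /eqP ->.
Qed.

(** [sup] is 0 on a set without supremum and [Num.sqrt] is 0 on negative numbers; the value 1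
    excludes both defaults, so the supremum is a genuine one. *)
Lemma sigma_max1_eigen M a : sigma_max M = 1 -> eigenvalue (M^T *m M) a -> a <= 1.
Proof.
rewrite /sigma_max /lambda_max => s1 ea.
have s1' : sup [set a | eigenvalue (M^T *m M) a] = 1.
  have s0 : 0 <= sup [set a | eigenvalue (M^T *m M) a].
    rewrite leNgt; apply/negP => s0; move: s1; rewrite ltr0_sqrtr//; lra.
  by rewrite -[LHS](sqr_sqrtr s0) s1 expr1n.
have [hs|hs] := pselect (has_sup [set a | eigenvalue (M^T *m M) a]).
  by rewrite -s1'; apply: ub_le_sup => //; case: hs.
by move: s1'; rewrite sup_out// => /eqP; rewrite eq_sym oner_eq0.
Qed.

Lemma sigma_max1_enorm M x : sigma_max M = 1 -> enorm (x *m M^T) <= enorm x.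
Proof.
move=> M1; rewrite -ler_sqr ?nnegrE ?enorm_ge0// !sqr_enorm.
rewrite dot_mulmx trmxK dotC -mulmxA -[leRHS]mul1r; apply: rayleigh.
  by rewrite trmx_mul trmxK.
by move=> a; exact: sigma_max1_eigen.
Qed.

Lemma tr_sum_row M : \tr (M^T *m M) = \sum_k dot (row k M) (row k M).
Proof.
rewrite /mxtrace; under eq_bigr do rewrite mxE.
rewrite exchange_big; apply: eq_bigr => k _; apply: eq_bigr => j _.
by rewrite !mxE.
Qed.

Lemma enorm_mulmx_tr M x : dot (x *m M^T) (x *m M^T) <= \tr (M^T *m M) * dot x x.
Proof.
rewrite tr_sum_row mulr_suml; apply: ler_sum => k _.
by rewrite mulmx_coordE -expr2 mulrC dot_sqr_le.
Qed.

(** By [enorm_mulmx_tr] the trace dominates every eigenvalue of the Gram matrix. Together with the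
    stable rank bound this gives [1 <= s], and it rules out [d = 0]. *)
Lemma sigma_max1_tr M : sigma_max M = 1 -> 1 <= \tr (M^T *m M).
Proof.
rewrite /sigma_max /lambda_max => s1.
have tr0 : 0 <= \tr (M^T *m M) by rewrite tr_sum_row sumr_ge0// => k _; exact: dot_ge0.
rewrite -(@ler_sqrt _ 1)// sqrtr1.
have [hs|hs] := pselect (has_sup [set a | eigenvalue (M^T *m M) a]); last first.
  by move: s1; rewrite sup_out// sqrtr0 => /eqP; rewrite eq_sym oner_eq0.
rewrite -[leLHS]s1 ler_wsqrtr//; apply: ge_sup; first by case: hs.
move=> a /= /eigenvalueP[v va v0].
have vv : 0 < dot v v.
  rewrite -sqr_enorm exprn_gt0// lt0r enorm_ge0 andbT.
  by apply: contra_neq v0; exact: enorm_eq0.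
rewrite -(ler_pM2r vv) -dotZl -va mulmxA dot_mulmx.
exact: enorm_mulmx_tr.
Qed.

End OpNorm.

(** * Joint measurability and equality in law *)

Section Caratheodory.
Variables (R : realType) (d : nat).
Variables (dW dZ : measure_display) (W : measurableType dW) (Z : measurableType dZ).

Lemma measurable_floor_eq (g : W -> R) (m : int) : measurable_fun setT g ->
  measurable [set w | Num.floor (g w) = m].
Proof.
move=> mg.
rewrite (_ : [set _ | _] = setT `&` g @^-1` `[m%:~R, (m + 1)%:~R[%classic).
  exact: mg.
apply/seteqP; split => w /=; rewrite in_itv/=.
  by move=> <-; split => //; exact: floor_itv.
by move=> -[_ /floor_def].
Qed.

(** The mesh is [1 / k.+1], nonzero also for [k = 0]; there are countably many grid points. *)
Definition grid (k : nat) (v : {ffun 'I_d -> int}) : 'rV[R]_d :=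
  \row_j ((v j)%:~R / k.+1%:R).

Definition grid_floor (k : nat) (x : 'rV[R]_d) : {ffun 'I_d -> int} :=
  [ffun j => Num.floor (x 0 j * k.+1%:R)].

Lemma cvg_grid x : grid k (grid_floor k x) @[k --> \oo] --> x.
Proof.
apply/cvgrPdist_le => e e0.
near=> k.
rewrite /Num.norm/= mx_normrE; apply/bigmax_leP; split; first exact: ltW.
move=> [i j] _ /=; rewrite ord1 !mxE ffunE.
have k0 : 0 < k.+1%:R :> R by rewrite ltr0n.
have /andP[f1 f2] := floor_itv (x 0 j * k.+1%:R).
set m := Num.floor _ in f1 f2 *.
have -> : x 0 j - m%:~R / k.+1%:R = (x 0 j * k.+1%:R - m%:~R) / k.+1%:R.
  by rewrite mulrBl mulfK// gt_eqF.
rewrite ger0_norm; last by rewrite divr_ge0 ?subr_ge0// ltW.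
rewrite ler_pdivrMr//.
apply: (@le_trans _ _ 1).
  by rewrite lerBlDl ltW// -[X in _ + X]/(1%:~R) -intrD.
rewrite -ler_pdivrMl// mulr1.
near: k; apply: filterS (near_infty_natSinv_lt (PosNum e0)) => k /= /ltW.
by move=> H; rewrite -[leRHS]invrK lef_pV2 ?posrE ?invr_gt0.
Unshelve. all: by end_near. Qed.

(** Rounding [X] to a grid leaves a function that is measurable on each of countably many measurable
    cells, and continuity in the first argument makes the rounded functions converge pointwise. The
    loss is of this kind: continuous in the parameter, measurable in the sample. *)
Lemma measurable_caratheodory (f : 'rV[R]_d -> Z -> R) (X : W -> 'rV[R]_d)
    (Y : W -> Z) :
  (forall z, continuous (f ^~ z)) -> (forall x, measurable_fun setT (f x)) ->
  (forall j, measurable_fun setT (fun w => X w 0 j)) -> measurable_fun setT Y ->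
  measurable_fun setT (fun w => f (X w) (Y w)).
Proof.
move=> cf mf mX mY.
apply: (@measurable_fun_cvg _ _ _ _
    (fun k w => f (grid k (grid_floor k (X w))) (Y w))); last first.
  move=> w _; have := cvg_comp _ _ (@cvg_grid (X w)) (cf (Y w) (X w)).
  exact.
move=> k _ B mB; rewrite setTI.
rewrite (_ : _ @^-1` _ = \bigcup_(v : {ffun 'I_d -> int})
   ([set w | grid_floor k (X w) = v] `&` [set w | B (f (grid k v) (Y w))])).
  apply: countable_bigcupT_measurable; first exact: countableP.
  move=> v; apply: measurableI.
    rewrite (_ : [set _ | _] = \big[setI/setT]_(j < d)
        [set w | Num.floor (X w 0 j * k.+1%:R) = v j]).
      apply: bigsetI_measurable => j _; apply: measurable_floor_eq.
      by apply: measurable_funM => //; exact: measurable_cst.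
    rewrite -bigcap_seq.
    apply/seteqP; split => w /= => [<- j _ /=|H]; first by rewrite ffunE.
    by apply/ffunP => j; rewrite ffunE; apply: H; rewrite /= mem_index_enum.
  have := measurableT_comp (mf (grid k v)) mY.
  by move=> /(_ measurableT B mB); rewrite setTI.
apply/seteqP; split => w /=; last by move=> [v _ [/= <-]].
by move=> H; exists (grid_floor k (X w)).
Qed.

End Caratheodory.

Section Law.
Variables (R : realType) (T : pointedType) (G : set (set T)).
Hypotheses (GI : setI_closed G) (GT : G setT).
Notation GT_ := (g_sigma_algebraType G).
Variables (d1 d2 : measure_display) (O1 : measurableType d1) (O2 : measurableType d2).
Variables (P1 : probability O1 R) (P2 : probability O2 R).
Variables (X1 : O1 -> T) (X2 : O2 -> T).
Hypotheses (mX1 : forall A, G A -> measurable (X1 @^-1` A))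
  (mX2 : forall A, G A -> measurable (X2 @^-1` A))
  (X12 : forall A, G A -> P1 (X1 @^-1` A) = P2 (X2 @^-1` A)).

Lemma measurable_gsigma d0 (O0 : measurableType d0) (X : O0 -> T) :
  (forall A, G A -> measurable (X @^-1` A)) ->
  @measurable_fun _ _ O0 GT_ setT X.
Proof.
move=> mX; apply: (@measurability _ _ O0 GT_ setT X G) => // _ [A GA <-].
by rewrite setTI; exact: mX.
Qed.

(** The two image measures agree on the pi-system [G], hence on the sigma-algebra that it
    generates. *)
Lemma ge0_integral_law (F : T -> \bar R) :
  measurable_fun setT (F : GT_ -> \bar R) -> (forall t, 0 <= F t)%E ->
  (\int[P1]_w F (X1 w) = \int[P2]_w F (X2 w))%E.
Proof.
move=> mF F0.
have m1 := measurable_gsigma mX1; have m2 := measurable_gsigma mX2.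
have := @ge0_integral_pushforward _ _ _ _ R _ m1 P1 setT F measurableT mF (fun t _ => F0 t).
rewrite preimage_setT => <-.
have := @ge0_integral_pushforward _ _ _ _ R _ m2 P2 setT F measurableT mF (fun t _ => F0 t).
rewrite preimage_setT => <-.
apply: eq_measure_integral => A mA _.
pose mp1 := isMeasurableFun.Build _ _ _ _ _ m1.
pose f1 : {mfun O1 >-> GT_} := HB.pack (X1 : O1 -> GT_) mp1.
pose mp2 := isMeasurableFun.Build _ _ _ _ _ m2.
pose f2 : {mfun O2 >-> GT_} := HB.pack (X2 : O2 -> GT_) mp2.
apply: (@measure_unique _ R GT_ G (fun=> setT) erefl GI (fun=> GT) _
   (pushforward P1 f1) (pushforward P2 f2)) => //.
- by rewrite bigcup_const.
- by move=> k; rewrite /= /pushforward preimage_setT probability_setT ltry.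
Qed.

(** Integrability is not assumed: the integrals of the positive and of the negative part agree
    separately. *)
Lemma integral_law (F : T -> \bar R) :
  measurable_fun setT (F : GT_ -> \bar R) ->
  (\int[P1]_w F (X1 w) = \int[P2]_w F (X2 w))%E.
Proof.
move=> mF; rewrite integralE [RHS]integralE; congr (_ - _)%E.
- rewrite -[fun x => F (X1 x)]/(F \o X1) -[fun x => F (X2 x)]/(F \o X2).
  rewrite (funepos_comp F X1) (funepos_comp F X2).
  exact: (ge0_integral_law (measurable_funepos mF) (fun t => funepos_ge0 F t)).
- rewrite -[fun x => F (X1 x)]/(F \o X1) -[fun x => F (X2 x)]/(F \o X2).
  rewrite (funeneg_comp F X1) (funeneg_comp F X2).
  exact: (ge0_integral_law (measurable_funeneg mF) (fun t => funeneg_ge0 F t)).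
Qed.

End Law.

(** * The standard Gaussian measure on the line *)

Section RealMeasures.
Variable R : realType.

(* [lebesgue_measure] and [normal_prob] live on the alias [measurableTypeR R];
   transporting them along the identity to [R] keeps canonical-structure
   inference on products of copies of [R] workable. *)
Definition idTR : measurableTypeR R -> R := idfun.

HB.instance Definition _ :=
  @isMeasurableFun.Build _ _ _ _ idTR (@measurable_id _ _ setT).

Definition leb (A : set R) : \bar R := @lebesgue_measure R A.

Let leb0 : leb set0 = 0%E. Proof. exact: measure0. Qed.

Let leb_ge0 (A : set R) : (0 <= leb A)%E. Proof. exact: measure_ge0. Qed.

Let leb_sigma_additive : semi_sigma_additive leb.
Proof. exact: (@measure_semi_sigma_additive _ _ _ (@lebesgue_measure R)). Qed.

HB.instance Definition _ := isMeasure.Build _ _ _ leb leb0 leb_ge0 leb_sigma_additive.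

Lemma leb_sigma_finite : sigma_finite setT leb.
Proof. exact: (@sigma_finiteT _ _ _ (@lebesgue_measure R)). Qed.

HB.instance Definition _ := @Measure_isSigmaFinite.Build _ _ _ leb leb_sigma_finite.

Definition gam : probability R R := distribution (normal_prob 0 1) idTR.

End RealMeasures.

Section GaussianLine.
Variable R : realType.
Local Notation mu := (@leb R).
Local Notation gam := (@gam R).
Local Notation phi := (@normal_pdf R 0 1).

Import HBNNSimple.

Lemma measurable_phi : measurable_fun setT (fun x : R => (phi x)%:E).
Proof. by apply/measurable_EFinP; exact: measurable_normal_pdf. Qed.

Lemma phi_ge0 (x : R) : (0 <= (phi x)%:E)%E.
Proof. by rewrite lee_fin normal_pdf_ge0. Qed.

Lemma gam_leb (A : set R) : measurable A ->
  gam A = (\int[mu]_(x in A) (phi x)%:E)%E.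
Proof.
move=> mA.
rewrite -[gam A]/(\int[@lebesgue_measure R]_(x in A) (phi x)%:E)%E.
have H := @ge0_integral_pushforward _ _ (measurableTypeR R) R R (@idTR R)
  (@measurable_id _ _ setT) (@lebesgue_measure R)
  A (fun x => (phi x)%:E) mA (measurable_funTS measurable_phi) (fun t _ => phi_ge0 t).
etransitivity; first exact/esym/H.
by apply: eq_measure_integral.
Qed.

(** The density formula holds for simple functions by [gam_leb], and passes to the limit by monotone
    convergence on both sides. *)
Lemma ge0_integral_gam (f : R -> \bar R) : measurable_fun setT f ->
  (forall x, 0 <= f x)%E ->
  (\int[gam]_x f x = \int[mu]_x (f x * (phi x)%:E))%E.
Proof.
move=> mf f0.
have mphi := measurable_phi.
have phi0 := phi_ge0.
pose g := nnsfun_approx measurableT mf.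
have gE n : (\int[gam]_x (g n x)%:E = \int[mu]_x ((g n x)%:E * (phi x)%:E))%E.
  rewrite integral_nnsfun//.
  transitivity (\int[mu]_x (\sum_(r \in range (g n))
      ((r * \1_(g n @^-1` [set r]) x)%:E * (phi x)%:E)))%E; last first.
    apply: eq_integral => x _; rewrite fimfunE -fsumEFin//.
    by rewrite ge0_mule_fsuml// => r; exact: nnfun_muleindic_ge0.
  rewrite ge0_integral_fsum//=; last 2 first.
  - move=> r; apply: emeasurable_funM => //.
    exact/measurable_EFinP/measurable_funM.
  - by move=> r x _; rewrite mule_ge0// nnfun_muleindic_ge0.
  rewrite patch_setT sintegralE; apply: eq_fsbigr => r; rewrite inE => -[x _ <-].
  under eq_integral do rewrite EFinM -muleA.
  rewrite ge0_integralZl//=; last 3 first.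
  - apply: emeasurable_funM => //; exact/measurable_EFinP/measurable_indic.
  - by move=> y _; rewrite mule_ge0// lee_fin.
  - by rewrite lee_fin.
  congr (_ * _)%E.
  rewrite -[normal_prob _ _ _]/(gam (g n @^-1` [set g n x])) gam_leb//.
  rewrite integral_mkcond; apply: eq_integral => y _.
  rewrite /patch/= indicE; case: ifPn => _; rewrite ?mul1e ?mul0e//.
transitivity (limn (fun n => \int[gam]_x (g n x)%:E)%E).
  rewrite -monotone_convergence//.
  - apply: eq_integral => x _; apply/esym/cvg_lim => //.
    by apply: cvg_nnsfun_approx.
  - by move=> n; exact/measurable_EFinP/measurable_funP.
  - by move=> n x _; rewrite lee_fin.
  - by move=> x _ m n mn; rewrite lee_fin; exact/lefP/nd_nnsfun_approx.
rewrite (_ : (fun n => _) = fun n => (\int[mu]_x ((g n x)%:E * (phi x)%:E))%E); last first.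
  by apply/funext => n; exact: gE.
rewrite -monotone_convergence//.
- apply: eq_integral => x _; apply/cvg_lim => //.
  apply: cvgeZr => //.
  by apply: cvg_nnsfun_approx.
- by move=> n; apply: emeasurable_funM => //; exact/measurable_EFinP/measurable_funP.
- by move=> n x _; rewrite mule_ge0// lee_fin.
- move=> x _ m n mn; rewrite lee_wpmul2r// lee_fin; exact/lefP/nd_nnsfun_approx.
Qed.

Lemma lebesgue_translate (a : R) (A : set R) : measurable A ->
  pushforward mu (fun x => x + a) A = mu A.
Proof.
move=> mA.
have ma : measurable_fun setT ((fun x => x + a) : measurableTypeR R -> measurableTypeR R).
  have ma : measurable_fun setT (fun x : R => x + a).
    by apply: measurable_funD => //; exact: measurable_cst.
  exact: ma.
pose mp := isMeasurableFun.Build _ _ _ _ _ ma.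
pose f : {mfun measurableTypeR R >-> measurableTypeR R} :=
  HB.pack ((fun x => x + a) : measurableTypeR R -> measurableTypeR R) mp.
apply/esym/(@lebesgue_measure_unique R (pushforward (@lebesgue_measure R) f)) => //.
move=> _ [[b c]] _ <- /=.
rewrite /pushforward (_ : _ @^-1` _ = `]b - a, c - a]%classic); last first.
  by apply/seteqP; split => x /=; rewrite !in_itv/= ltrBlDr lerBrDr.
rewrite !lebesgue_measure_itv/= !lte_fin ltrD2r -!EFinB; case: ifPn => // _.
by congr EFin; ring.
Qed.

Lemma ge0_integral_translate (a : R) (f : R -> \bar R) : measurable_fun setT f ->
  (forall x, 0 <= f x)%E -> (\int[mu]_x f (x + a)%R = \int[mu]_x f x)%E.
Proof.
move=> mf f0.
have ma : measurable_fun setT (fun x : R => x + a).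
  by apply: measurable_funD => //; exact: measurable_cst.
have := @ge0_integral_pushforward _ _ _ _ R _ ma mu setT f measurableT mf (fun t _ => f0 t).
rewrite preimage_setT => <-.
apply: eq_measure_integral => A mA _; exact: lebesgue_translate.
Qed.

(** With the sheared coordinate integrated first (Tonelli), the shear is a translation for each
    value of the other coordinate. *)
Lemma integral_shear1 (a : R) (H : R * R -> \bar R) : measurable_fun setT H ->
  (forall p, 0 <= H p)%E ->
  (\int[mu]_x \int[mu]_y H (x + a * y, y)%R = \int[mu]_x \int[mu]_y H (x, y))%E.
Proof.
move=> mH H0.
have mp : measurable_fun setT (fun p : R * R => (p.1 + a * p.2, p.2)).
  apply/measurable_fun_pairP; split => /=; last exact: measurable_snd.
  apply: measurable_funD => //=; apply: measurable_funM => //=; exact: measurable_cst.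
have mHp := measurableT_comp mH mp.
etransitivity; first exact: (@fubini_tonelli _ _ _ _ R mu mu _ mHp (fun p => H0 _)).
etransitivity; last exact/esym/(@fubini_tonelli _ _ _ _ R mu mu _ mH H0).
apply: eq_integral => y _.
apply: (@ge0_integral_translate (a * y) (fun x => H (x, y))) => //.
exact: measurableT_comp mH (measurable_pair2 y).
Qed.

Lemma integral_shear2 (a : R) (H : R * R -> \bar R) : measurable_fun setT H ->
  (forall p, 0 <= H p)%E ->
  (\int[mu]_x \int[mu]_y H (x, y + a * x)%R = \int[mu]_x \int[mu]_y H (x, y))%E.
Proof.
move=> mH H0; apply: eq_integral => x _.
apply: (@ge0_integral_translate (a * x) (fun y => H (x, y))) => //.
exact: measurableT_comp mH (measurable_pair1 x).
Qed.

(* A rotation is a product of three shears, each preserving Lebesgue measure. *)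
Lemma integral_rot (c s : R) (H : R * R -> \bar R) : c ^+ 2 + s ^+ 2 = 1 ->
  1 + c != 0 -> measurable_fun setT H -> (forall p, 0 <= H p)%E ->
  (\int[mu]_x \int[mu]_y H (c * x + s * y, - s * x + c * y)%R
   = \int[mu]_x \int[mu]_y H (x, y))%E.
Proof.
(* The tangent of half the rotation angle; [1 + c != 0] excludes the half-turn. *)
move=> cs c1 mH H0; pose t := s / (1 + c).
have ts : t * s = 1 - c.
  by rewrite /t mulrAC -expr2 (_ : s ^+ 2 = (1 - c) * (1 + c)) ?mulfK//;
    rewrite (_ : s ^+ 2 = 1 - c ^+ 2); [ring|rewrite -cs; ring].
have tc : t * (1 + c) = s by rewrite /t mulfVK.
have m1 (b : R) : measurable_fun setT (fun p : R * R => (p.1 + b * p.2, p.2)).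
  apply/measurable_fun_pairP; split => /=; last exact: measurable_snd.
  apply: measurable_funD => //=; apply: measurable_funM => //=; exact: measurable_cst.
have m2 (b : R) : measurable_fun setT (fun p : R * R => (p.1, p.2 + b * p.1)).
  apply/measurable_fun_pairP; split => /=; first exact: measurable_fst.
  apply: measurable_funD => //=; apply: measurable_funM => //=; exact: measurable_cst.
pose G p := H (p.1 + t * p.2, p.2).
have mG : measurable_fun setT G by exact: measurableT_comp mH (m1 t).
pose K p := G (p.1, p.2 + - s * p.1).
have mK : measurable_fun setT K by exact: measurableT_comp mG (m2 (- s)).
transitivity (\int[mu]_x \int[mu]_y K (x + t * y, y)%R)%E.
  apply: eq_integral => x _; apply: eq_integral => y _; rewrite /K /G/=.
  congr (H (_, _)).
    rewrite (_ : x + t * y + t * (y + - s * (x + t * y)) =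
       x * (1 - t * s) + y * (t * (2 - t * s))); last by ring.
    rewrite ts (_ : t * (2 - (1 - c)) = t * (1 + c)); last by ring.
    by rewrite tc; ring.
  rewrite (_ : y + - s * (x + t * y) = - s * x + y * (1 - t * s)); last by ring.
  by rewrite ts; ring.
etransitivity; first exact: (@integral_shear1 t K mK (fun p => H0 _)).
etransitivity; first exact: (@integral_shear2 (- s) G mG (fun p => H0 _)).
exact: (@integral_shear1 t H).
Qed.

Lemma phiE (x : R) : phi x = normal_peak 1 * expR (- x ^+ 2 / 2).
Proof.
rewrite normal_pdfE// /normal_fun subr0 expr1n; congr (_ * expR (_ / _)).
Qed.

Lemma ge0_integral_gam2 (F : R * R -> \bar R) : measurable_fun setT F ->
  (forall p, 0 <= F p)%E ->
  (\int[gam]_x \int[gam]_y F (x, y) =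
   \int[mu]_x \int[mu]_y (F (x, y) * ((phi x)%:E * (phi y)%:E)))%E.
Proof.
move=> mF F0.
have phi0 := phi_ge0.
rewrite ge0_integral_gam//; last first.
- by move=> x; exact: integral_ge0.
- exact: (@measurable_fun_fubini_tonelli_F _ _ _ _ _ gam F).
apply: eq_integral => x _.
have mFx : measurable_fun setT (fun y => F (x, y)).
  exact: measurableT_comp mF (measurable_pair1 x).
rewrite ge0_integral_gam// -ge0_integralZr//=.
- by apply: eq_integral => y _; rewrite -muleA [((phi y)%:E * _)%E]muleC.
- by apply: emeasurable_funM => //; exact: measurable_phi.
- by move=> y _; rewrite mule_ge0.
Qed.

(** The product density is a function of [x ^+ 2 + y ^+ 2], which the rotation preserves, so the
    invariance of Lebesgue measure carries over. *)
Lemma integral_gam2_rot (c s : R) (F : R * R -> \bar R) : c ^+ 2 + s ^+ 2 = 1 ->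
  1 + c != 0 -> measurable_fun setT F -> (forall p, 0 <= F p)%E ->
  (\int[gam]_x \int[gam]_y F (c * x + s * y, - s * x + c * y)%R
   = \int[gam]_x \int[gam]_y F (x, y))%E.
Proof.
move=> cs c1 mF F0.
have phi0 := phi_ge0.
have mr : measurable_fun setT (fun p : R * R => (c * p.1 + s * p.2, - s * p.1 + c * p.2)).
  apply/measurable_fun_pairP; split => /=; apply: measurable_funD => //=;
    apply: measurable_funM => //=; exact: measurable_cst.
rewrite (@ge0_integral_gam2 (fun p : R * R =>
  F (c * p.1 + s * p.2, - s * p.1 + c * p.2)))//; last first.
  exact: measurableT_comp mF mr.
rewrite (ge0_integral_gam2 mF F0).
have := @integral_rot c s (fun p : R * R => F p * ((phi p.1)%:E * (phi p.2)%:E))%E.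
move=> /(_ cs c1) /= <-.
- apply: eq_integral => x _; apply: eq_integral => y _ /=.
  congr (_ * _)%E; rewrite -!EFinM; congr EFin; rewrite !phiE.
  rewrite mulrACA [RHS]mulrACA; congr (_ * _); rewrite -!expRD; congr expR.
  have -> : - (c * x + s * y) ^+ 2 / 2 + - (- s * x + c * y) ^+ 2 / 2 =
    - (c ^+ 2 + s ^+ 2) * (x ^+ 2 + y ^+ 2) / 2 by field.
  by rewrite cs; field.
- apply: emeasurable_funM => //; apply: emeasurable_funM.
    exact: measurableT_comp measurable_phi measurable_fst.
  exact: measurableT_comp measurable_phi measurable_snd.
- by move=> p; rewrite !mule_ge0.
Qed.

Lemma gam_setT : gam setT = 1%E.
Proof. exact: probability_setT. Qed.

(** Completing the square turns the tilted density into a multiple of the density translated by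
    [a]. *)
Lemma integral_gam_expR (a : R) :
  (\int[gam]_x (expR (a * x))%:E = (expR (a ^+ 2 / 2))%:E)%E.
Proof.
have me (b : R) : measurable_fun setT (fun x : R => (expR (b * x))%:E).
  apply/measurable_EFinP; exact: measurableT_comp.
rewrite ge0_integral_gam//.
transitivity (\int[mu]_x ((expR (a ^+ 2 / 2))%:E * (phi (x - a))%:E))%E.
  apply: eq_integral => x _; rewrite -!EFinM; congr EFin; rewrite !phiE.
  rewrite mulrCA [RHS]mulrCA; congr (_ * _); rewrite -!expRD; congr expR; by field.
rewrite ge0_integralZl//=.
- rewrite (@ge0_integral_translate (- a) (fun x => (phi x)%:E)).
  + by rewrite -(gam_leb measurableT) gam_setT mule1.
  + exact: measurable_phi.
  + by move=> x; rewrite lee_fin normal_pdf_ge0.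
- apply: (measurableT_comp measurable_phi).
  by apply: measurable_funD => //; exact: measurable_cst.
- by move=> x _; rewrite lee_fin normal_pdf_ge0.
Qed.

End GaussianLine.

(** * Gaussian vectors *)

Section Iid.
Variables (R : realType) (I : finType) (dX : measure_display) (X : measurableType dX).
Variables (C : set (set X)) (nu : probability X R).
Hypotheses (CI : setI_closed C) (CT : C setT)
  (Cgen : (measurable : set (set X)) = <<s C >>).
Implicit Types (v : I -> X) (B : I -> set X).

Definition rect B : set (I -> X) := [set v | forall i, B i (v i)].

Definition rects : set (set (I -> X)) :=
  [set A | exists2 B, (forall i, C (B i)) & A = rect B].

Notation T_ := (g_sigma_algebraType rects).

(** The product formula is asked only for sides in a generating pi-system [C]. This already
    determines the joint law, and for pairs of reals [C] can be the measurable rectangles. *)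
Definition iid (dO : measure_display) (O : measurableType dO) (P : probability O R)
    (V : O -> I -> X) : Prop :=
  (forall i, measurable_fun setT (V ^~ i)) /\
  forall B, (forall i, C (B i)) ->
    P [set w | forall i, B i (V w i)] = (\prod_i nu (B i))%E.

Definition upd v (j : I) (x : X) : I -> X := fun i => if i == j then x else v i.

Lemma C_measurable (A : set X) : C A -> measurable A.
Proof. by move=> CA; rewrite Cgen; exact: sub_sigma_algebra. Qed.

Lemma rects_setI : setI_closed rects.
Proof.
move=> _ _ [A CA ->] [B CB ->]; exists (fun i => A i `&` B i).
  by move=> i; exact: CI.
apply/seteqP; split => v /=; first by move=> [hA hB] i; split.
by move=> h; split => i; case: (h i).
Qed.

Lemma rects_setT : rects setT.
Proof. by exists (fun=> setT) => //; apply/esym/seteqP; split. Qed.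

Lemma measurable_forall (dO : measure_display) (O : measurableType dO)
    (A : I -> set O) : (forall i, measurable (A i)) ->
  measurable [set w | forall i, A i w].
Proof.
move=> mA; rewrite (_ : [set _ | _] = \big[setI/setT]_i A i).
  exact: bigsetI_measurable.
rewrite -bigcap_seq; apply/seteqP; split => w /= h; first by move=> i _; exact: h.
by move=> i; apply: h; rewrite /= mem_index_enum.
Qed.

Lemma measurable_family (dO : measure_display) (O : measurableType dO)
    (Y : O -> I -> X) : (forall i, measurable_fun setT (Y ^~ i)) ->
  forall A, rects A -> measurable (Y @^-1` A).
Proof.
move=> mY _ [B CB ->]; apply: measurable_forall => i.
by rewrite -[X in measurable X]setTI; apply: mY => //; exact: C_measurable.
Qed.

Lemma measurable_coord (i : I) : measurable_fun setT (fun v : T_ => v i).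
Proof.
apply: (@measurability _ _ T_ X setT _ C) => // _ [A CA <-]; rewrite setTI.
apply: sub_sigma_algebra; exists (fun k => if k == i then A else setT).
  by move=> k; case: ifP.
apply/seteqP; split => v /= h; last by have := h i; rewrite eqxx.
by move=> k; case: eqP => [->|].
Qed.

Lemma measurable_upd (dO : measure_display) (O : measurableType dO)
    (Y : O -> I -> X) (x : O -> X) j :
  (forall i, measurable_fun setT (Y ^~ i)) -> measurable_fun setT x ->
  forall i, measurable_fun setT (fun w => upd (Y w) j (x w) i).
Proof. by move=> mY mx i; rewrite /upd; case: eqP. Qed.

Section Space.
Variables (dO : measure_display) (O : measurableType dO) (P : probability O R).
Variable (V : O -> I -> X).
Hypothesis VP : iid P V.

Lemma iid_upd j : iid (P \x nu)%E (fun p => upd (V p.1) j p.2).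
Proof.
have [mV PV] := VP; split.
  apply: measurable_upd; last exact: measurable_snd.
  by move=> i; exact: measurableT_comp (mV i) measurable_fst.
move=> B CB.
pose B' i := if i == j then setT else B i.
have CB' i : C (B' i) by rewrite /B'; case: ifP.
rewrite (_ : [set _ | _] = [set w | forall i, B' i (V w i)] `*` B j); last first.
  apply/seteqP; split => -[w x] /= h.
    split; last by have := h j; rewrite /upd eqxx.
    by move=> i; have := h i; rewrite /upd /B'; case: eqP.
  by move: h => [h hj] i; have := h i; rewrite /upd /B'; case: eqP => // ->.
have mB' := measurable_family mV (ex_intro2 _ _ B' CB' erefl).
rewrite /= product_measure1E//; last exact: C_measurable.
transitivity ((\prod_i nu (B' i)) * nu (B j))%E.
  by congr (_ * _)%E; exact: PV.
rewrite (bigD1 j)//= [RHS](bigD1 j)//= {1}/B' eqxx probability_setT mul1e muleC.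
by congr (_ * _)%E; apply: eq_bigr => i /negbTE ij; rewrite /B' ij.
Qed.

Variable F : (I -> X) -> \bar R.
Hypotheses (mF : measurable_fun setT (F : T_ -> \bar R)) (F0 : forall v, (0 <= F v)%E).

Lemma measurable_comp_family (dQ : measure_display) (Q : measurableType dQ)
    (Y : Q -> I -> X) : (forall i, measurable_fun setT (Y ^~ i)) ->
  measurable_fun setT (fun w => F (Y w)).
Proof.
move=> mY; apply: (measurableT_comp (f := F : T_ -> _) mF (g := Y : Q -> T_)).
exact/measurable_gsigma/measurable_family.
Qed.

(** Replacing coordinate [j] by an independent copy does not change the joint law; Tonelli then
    isolates the copy. This allows coordinates to be integrated one by one. *)
Lemma resample j : (\int[P]_w F (V w) = \int[P]_w \int[nu]_x F (upd (V w) j x))%E.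
Proof.
have [mV PV] := VP; have [mV' PV'] := iid_upd j.
rewrite (@ge0_integral_law R _ rects rects_setI rects_setT _ _ _ _ P (P \x nu)%E V
   (fun p => upd (V p.1) j p.2))//.
- apply: (@fubini_tonelli1 _ _ _ _ R P nu (fun p => F (upd (V p.1) j p.2))) => //.
  exact: measurable_comp_family.
- exact: measurable_family.
- exact: measurable_family.
- move=> _ [B CB ->].
  have -> : V @^-1` rect B = [set w | forall i, B i (V w i)] by [].
  by rewrite PV//; exact/esym/PV'.
Qed.

End Space.

Lemma iid_law (dO dQ : measure_display) (O : measurableType dO) (Q : measurableType dQ)
    (P : probability O R) (P' : probability Q R) (V : O -> I -> X) (W : Q -> I -> X)
    (F : (I -> X) -> \bar R) :
  iid P V -> iid P' W -> measurable_fun setT (F : T_ -> \bar R) ->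
  (\int[P]_w F (V w) = \int[P']_w F (W w))%E.
Proof.
move=> [mV PV] [mW PW] mF.
apply: (@integral_law R _ rects rects_setI rects_setT _ _ _ _ P P' V W) => //.
- exact: measurable_family.
- exact: measurable_family.
- move=> _ [B CB ->].
  have -> : V @^-1` rect B = [set w | forall i, B i (V w i)] by [].
  by rewrite PV//; exact/esym/PW.
Qed.

(** Induction on the set of coordinates already transformed: once coordinate [j] is resampled, the
    invariance of [nu] absorbs [rho] there while all others are frozen. *)
Lemma integral_map_coords (dO : measure_display) (O : measurableType dO)
    (P : probability O R) (V : O -> I -> X) (rho : X -> X) (F : (I -> X) -> \bar R) :
  iid P V -> measurable_fun setT rho ->
  (forall f : X -> \bar R, measurable_fun setT f -> (forall x, 0 <= f x)%E ->
    \int[nu]_x f (rho x) = \int[nu]_x f x)%E ->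
  measurable_fun setT (F : T_ -> \bar R) -> (forall v, 0 <= F v)%E ->
  (\int[P]_w F (fun i => rho (V w i)) = \int[P]_w F (V w))%E.
Proof.
move=> VP mrho nurho mF F0.
pose rs (s : seq I) v : I -> X := fun i => if i \in s then rho (v i) else v i.
have mrs s : measurable_fun setT (rs s : T_ -> T_).
  apply/measurable_gsigma/measurable_family => i; rewrite /rs.
  case: (i \in s); last exact: measurable_coord.
  exact: measurableT_comp mrho (measurable_coord i).
have mFs s : measurable_fun setT ((fun v => F (rs s v)) : T_ -> \bar R).
  exact: (measurableT_comp (f := F : T_ -> _) mF (mrs s)).
suff H s : uniq s -> (\int[P]_w F (rs s (V w)) = \int[P]_w F (V w))%E.
  rewrite -(H (enum I) (enum_uniq I)); apply: eq_integral => w _; congr F.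
  by apply/funext => i; rewrite /rs mem_enum.
elim: s => [_|j s IH /= /andP[js us]].
  by apply: eq_integral => w _; congr F; apply/funext => i.
rewrite -(IH us) (resample VP (mFs (j :: s)) (fun=> F0 _) j).
rewrite (resample VP (mFs s) (fun=> F0 _) j).
have E1 w x : rs (j :: s) (upd (V w) j x) = upd (rs s (V w)) j (rho x).
  apply/funext => i; rewrite /rs /upd inE; case: eqP => // ->.
have E2 w x : rs s (upd (V w) j x) = upd (rs s (V w)) j x.
  by apply/funext => i; rewrite /rs /upd; case: eqP => // ->; rewrite (negbTE js).
apply: eq_integral => w _.
under eq_integral do rewrite E1.
under [RHS]eq_integral do rewrite E2.
apply: (nurho (fun x => F (upd (rs s (V w)) j x))) => //.
apply: measurable_comp_family => //.
by apply: measurable_upd => // i; exact: measurable_cst.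
Qed.

End Iid.

(** * Elementary real inequalities *)

Section RealInequalities.
Variable R : realType.

Lemma le_of_small (c r G K : R) : 0 < c ->
  (forall t, 0 < t -> t <= c -> r <= G + t * K) -> r <= G.
Proof.
move=> c0 H; rewrite leNgt; apply/negP => Gr.
have K0 : 0 < K.
  by have := H c c0 (lexx _); rewrite -lerBlDl => h; rewrite -(pmulr_rgt0 _ c0); lra.
(* Small enough for [t * K] to fill at most half of the supposed gap [r - G]. *)
pose t := Num.min c ((r - G) / (2 * K)).
have t0 : 0 < t by rewrite lt_min c0 divr_gt0// ?mulr_gt0// subr_gt0.
have tc : t <= c by rewrite ge_min lexx.
have := H t t0 tc.
have : t * K <= (r - G) / (2 * K) * K by rewrite ler_wpM2r ?(ltW K0)// /t ge_min lexx orbT.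
rewrite (_ : (r - G) / (2 * K) * K = (r - G) / 2); last by field; rewrite gt_eqF.
lra.
Qed.

Lemma expR_sub_ge (y : R) : 0 <= y -> 2 * y <= expR y - expR (- y).
Proof.
move=> y0.
have D (t : R) : is_derive t 1 (fun s : R => expR s - expR (- s)) (expR t + expR (- t)).
  have D1 : is_derive t 1 (expR \o (-%R : R -> R)) (expR (- t) * -1).
    by apply: is_derive1_comp.
  have D2 := is_deriveB (is_derive_expR t) D1.
  by apply: (is_derive_eq D2); rewrite mulrN1 opprK.
have [|c _] := @MVT_segment R (fun s => expR s - expR (- s))
    (fun t => expR t + expR (- t)) 0 y y0 (fun t _ => D t).
  apply: continuous_subspaceT => t; apply: differentiable_continuous.
  by apply/derivable1_diffP; case: (D t).
move=> E; have {}E : expR y - expR (- y) = (expR c + expR (- c)) * y.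
  rewrite (_ : _ * y = (expR c + expR (- c)) * (y - 0)); last by rewrite subr0.
  by rewrite -E oppr0; ring.
rewrite E; apply: ler_wpM2r => //.
have e0 := expR_gt0 c; have e1 := expR_gt0 (- c); have ee := expRxMexpNx_1 c.
rewrite -ler_sqr ?nnegrE; [|lra|lra].
have := sqr_ge0 (expR c - expR (- c)); rewrite sqrrB sqrrD ee; lra.
Qed.

(** The right side minus 2 is the square of [expR (x / 2) - expR (- (x / 2))], which is at least [x]
    for nonnegative [x]. *)
Lemma expR_sum_ge (x : R) : x ^+ 2 + 2 <= expR x + expR (- x).
Proof.
wlog x0 : x / 0 <= x.
  move=> H; have [/H//|/ltW x0] := leP 0 x.
  have := H (- x); rewrite oppr_ge0 sqrrN opprK => /(_ x0); rewrite addrC.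
  by rewrite [leRHS]addrC addrC.
have h0 : 0 <= x / 2 by lra.
have := expR_sub_ge h0.
set a := expR (x / 2); set b := expR (- (x / 2)) => ab.
have ab1 : a * b = 1 by rewrite expRxMexpNx_1.
have -> : expR x = a ^+ 2 by rewrite expr2 -expRD; congr expR; field.
have -> : expR (- x) = b ^+ 2 by rewrite expr2 -expRD; congr expR; field.
have : (2 * (x / 2)) ^+ 2 <= (a - b) ^+ 2 by rewrite ler_sqr ?nnegrE//; lra.
nra.
Qed.

Lemma expr_le_expR (k : nat) (x : R) :
  `|x| ^+ k <= k`!%:R * (expR x + expR (- x)).
Proof.
have f1 : 1 <= k`!%:R :> R by rewrite ler1n fact_gt0.
have le1 (y : R) : 0 <= y -> y ^+ k <= k`!%:R * expR y.
  move=> y0; case: k f1 => [|k] f1.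
    by rewrite expr0 fact0 mul1r; have := expR_ge1Dx y; lra.
  have := expR_ge1Dxn k y0; rewrite -ler_pdivrMl; last lra.
  by rewrite mulrC; lra.
have k0 : 0 <= k`!%:R :> R by lra.
have [x0|/ltW x0] := leP 0 x.
  rewrite ger0_norm//; apply: le_trans (le1 _ x0) _.
  by rewrite ler_wpM2l// lerDl expR_ge0.
have x0' : 0 <= - x by lra.
rewrite ler0_norm//; apply: le_trans (le1 _ x0') _.
by rewrite ler_wpM2l// lerDr expR_ge0.
Qed.

Lemma pow4_addr (x y : R) : (x + y) ^+ 4 <= 8 * x ^+ 4 + 8 * y ^+ 4.
Proof.
have sq (a b : R) : (a + b) ^+ 2 <= 2 * (a ^+ 2 + b ^+ 2).
  by have := sqr_ge0 (a - b); rewrite sqrrB sqrrD; lra.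
rewrite -[4%N]/(2 * 2)%N !exprM.
apply: (@le_trans _ _ ((2 * (x ^+ 2 + y ^+ 2)) ^+ 2)).
  by rewrite lerXn2r ?nnegrE ?sqr_ge0// mulr_ge0// addr_ge0// sqr_ge0.
by have := sq (x ^+ 2) (y ^+ 2); rewrite exprMn; lra.
Qed.

Lemma le_of_pow16 (r G K : R) : (forall m, r <= G + K / 16 ^+ m) -> r <= G.
Proof.
move=> H; rewrite leNgt; apply/negP => Gr.
have K0 : 0 < K by have := H 0%N; rewrite expr0 divr1; lra.
have := archi_boundP (ltW (_ : 0 < K / (r - G))).
rewrite divr_gt0 ?subr_gt0// => /(_ isT).
set m := Num.bound _ => mK.
have m16 : m%:R <= 16 ^+ m :> R.
  by rewrite -natrX ler_nat ltnW// ltn_expl.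
have p0 : 0 < 16 ^+ m :> R by rewrite exprn_gt0.
have := H m; rewrite -lerBlDl ler_pdivlMr//.
move: mK; rewrite ltr_pdivrMr ?subr_gt0// => mK.
have : m%:R * (r - G) <= 16 ^+ m * (r - G) by rewrite ler_wpM2r// subr_ge0 ltW.
lra.
Qed.

Lemma sin_le_id (x : R) : 0 <= x -> sin x <= x.
Proof.
move=> x0.
have [|c _] := @MVT_segment R sin cos 0 x x0 (fun t _ => is_derive_sin t).
  exact/continuous_subspaceT/continuous_sin.
rewrite sin0 !subr0 => ->; rewrite ler_piMl//; exact: cos_le1.
Qed.

End RealInequalities.

Lemma integral_prob_cst (R : realType) (dO : measure_display) (O : measurableType dO)
  (P : probability O R) (r : \bar R) : (\int[P]_w r = r)%E.
Proof.
transitivity (r * 1)%E; last by rewrite mule1.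
by rewrite integral_cst//; congr (_ * _)%E; exact: probability_setT.
Qed.

Lemma prob_integral_indic (R : realType) (dO : measure_display) (O : measurableType dO)
  (P : probability O R) (A : set O) : measurable A -> (P A = \int[P]_w (\1_A w)%:E)%E.
Proof. by move=> mA; rewrite integral_indic// setIT. Qed.

(** * Moments of linear functionals of a Gaussian vector *)

Section GaussianVector.
Variables (R : realType) (d : nat).
Local Notation gam := (@gam R).
Local Notation Rmeas := (@measurable _ R).

Definition gaussian (dO : measure_display) (O : measurableType dO)
    (P : probability O R) (U : O -> 'rV[R]_d) : Prop :=
  iid Rmeas gam P (fun w j => U w 0 j).

Definition rowf (v : 'I_d -> R) : 'rV[R]_d := \row_j v j.

Lemma rowfE (x : 'rV[R]_d) : rowf (fun j => x 0 j) = x.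
Proof. by apply/rowP => j; rewrite mxE. Qed.

Let RI : setI_closed Rmeas. Proof. by move=> A B; exact: measurableI. Qed.
Let RT : Rmeas setT. Proof. exact: measurableT. Qed.
Let Rgen : (measurable : set (set R)) = <<s Rmeas >>.
Proof. by rewrite sigma_algebra_id//; exact: sigma_algebra_measurable. Qed.

(** Random vectors are handled through their coordinates; no sigma-algebra is placed on row
    vectors. *)
Definition cmeas (dW : measure_display) (W : measurableType dW) (Y : W -> 'rV[R]_d) :=
  forall j, measurable_fun setT (fun w => Y w 0 j).

Lemma measurable_continuous_comp (dW : measure_display) (W : measurableType dW)
    (f : 'rV[R]_d -> R) (Y : W -> 'rV[R]_d) :
  continuous f -> cmeas Y -> measurable_fun setT (fun w => f (Y w)).
Proof.
move=> cf mY.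
apply: (@measurable_caratheodory R d _ _ W unit (fun x _ => f x) Y (fun=> tt)) => //.
Qed.

Lemma measurable_dot (dW : measure_display) (W : measurableType dW)
    (X Y : W -> 'rV[R]_d) : cmeas X -> cmeas Y ->
  measurable_fun setT (fun w => dot (X w) (Y w)).
Proof. by move=> mX mY; apply: measurable_sum => j; exact: measurable_funM. Qed.

Lemma cmeas_lin (dW : measure_display) (W : measurableType dW)
    (X Y : W -> 'rV[R]_d) (a b : R) : cmeas X -> cmeas Y ->
  cmeas (fun w => a *: X w + b *: Y w).
Proof.
move=> mX mY j.
rewrite (_ : (fun w => _) = fun w => a * X w 0 j + b * Y w 0 j).
  by apply: measurable_funD; apply: measurable_funM => //; exact: measurable_cst.
by apply/funext => w; rewrite !mxE.
Qed.

Section Single.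
Variables (dO : measure_display) (O : measurableType dO) (P : probability O R).
Variable (U : O -> 'rV[R]_d).
Hypothesis gU : gaussian P U.

Lemma gaussian_cmeas : cmeas U. Proof. by case: gU. Qed.

(** The exponential factorizes over coordinates; each induction step resamples one coordinate and
    integrates it out with [integral_gam_expR]. *)
Lemma integral_expR_dot (g : 'rV[R]_d) :
  (\int[P]_w (expR (dot g (U w)))%:E = (expR (dot g g / 2))%:E)%E.
Proof.
suff H (s : seq 'I_d) : uniq s ->
    (\int[P]_w (expR (\sum_(j <- s) g 0 j * U w 0 j))%:E =
      (expR ((\sum_(j <- s) g 0 j * g 0 j) / 2))%:E)%E.
  exact: (H (index_enum _) (index_enum_uniq _)).
elim: s => [_|j s IH /= /andP[js us]].
  under eq_integral do rewrite big_nil expR0.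
  by rewrite integral_prob_cst big_nil mul0r expR0.
pose F (v : 'I_d -> R) := (expR (\sum_(i <- j :: s) g 0 i * v i))%:E.
have mF : measurable_fun setT (F : g_sigma_algebraType (rects Rmeas) -> \bar R).
  apply/measurable_EFinP; apply: measurableT_comp => //.
  apply: measurable_sum => i; apply: measurable_funM; first exact: measurable_cst.
  exact: measurable_coord.
have F0 v : (0 <= F v)%E by rewrite lee_fin expR_ge0.
etransitivity; first exact: (resample RI RT Rgen gU mF F0 j).
transitivity (\int[P]_w ((expR (\sum_(i <- s) g 0 i * U w 0 i))%:E *
    (expR (g 0 j ^+ 2 / 2))%:E))%E.
  apply: eq_integral => w _; rewrite -integral_gam_expR -ge0_integralZl//=.
  - apply: eq_integral => x _; rewrite /F big_cons /upd eqxx expRD EFinM muleC.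
    congr (_%:E * _)%E; congr expR; rewrite big_seq [RHS]big_seq.
    by apply: eq_bigr => i ins; case: eqP => // ij; rewrite -ij ins in js.
  - by apply/measurable_EFinP; apply: measurableT_comp.
rewrite ge0_integralZr//=.
- rewrite IH// -EFinM -expRD; congr (expR _)%:E.
  by rewrite big_cons -expr2 -mulrDl addrC.
- apply/measurable_EFinP; apply: measurableT_comp => //.
  apply: measurable_sum => i; apply: measurable_funM; first exact: measurable_cst.
  exact: gaussian_cmeas.
Qed.

Lemma measurable_dotU (g : 'rV[R]_d) : measurable_fun setT (fun w => dot g (U w)).
Proof.
apply: measurable_sum => j; apply: measurable_funM; first exact: measurable_cst.
exact: gaussian_cmeas.
Qed.

(** Compare the coefficients of [l ^+ 2] as [l] tends to 0 in the mean of [expR_sum_ge] at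
    [l * dot g U]. The sharp constant 1 is essential: through [stein_odd] it becomes the exponent
    [q]. *)
Lemma moment2_dot (g : 'rV[R]_d) :
  (\int[P]_w (dot g (U w) ^+ 2)%:E <= (dot g g)%:E)%E.
Proof.
set G := dot g g; have G0 : 0 <= G by exact: dot_ge0.
have key (l : R) : (((l ^+ 2)%:E * \int[P]_w (dot g (U w) ^+ 2)%:E) + 2%:E <=
    (2 * expR (l ^+ 2 * G / 2))%:E)%E.
  have me (a : R) : measurable_fun setT (fun w => (expR (dot (a *: g) (U w)))%:E).
    apply/measurable_EFinP; apply: measurableT_comp => //; exact: measurable_dotU.
  have m2 : measurable_fun setT (fun w => (dot g (U w) ^+ 2)%:E).
    by apply/measurable_EFinP/measurable_funX/measurable_dotU.
  rewrite -ge0_integralZl//=; last 2 first.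
  - by move=> w _; rewrite lee_fin sqr_ge0.
  - by rewrite lee_fin sqr_ge0.
  rewrite -(integral_prob_cst P 2%:E) -ge0_integralD//=; last 2 first.
  - by move=> w _; rewrite mule_ge0// lee_fin sqr_ge0.
  - exact: emeasurable_funM.
  apply: (@le_trans _ _ (\int[P]_w ((expR (dot (l *: g) (U w)))%:E +
      (expR (dot ((- l) *: g) (U w)))%:E)))%E.
    apply: ge0_le_integral => //=.
    - by move=> w _; rewrite adde_ge0// mule_ge0// lee_fin sqr_ge0.
    - by apply: emeasurable_funD => //; exact: emeasurable_funM.
    - exact: emeasurable_funD.
    - move=> w _; rewrite -EFinM -!EFinD lee_fin !dotZl mulNr -exprMn.
      exact: expR_sum_ge.
  rewrite ge0_integralD//=.
  rewrite !integral_expR_dot// -EFinD lee_fin !dotZl !dotZr -/G.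
  rewrite (_ : l * (l * G) = l ^+ 2 * G); last by ring.
  rewrite (_ : - l * (- l * G) = l ^+ 2 * G); last by ring.
  by rewrite mulr_natl mulr2n.
set m := (\int[P]_w _)%E in key *.
have m0 : (0 <= m)%E by apply: integral_ge0 => w _; rewrite lee_fin sqr_ge0.
move: m m0 key => [r||]// r0 key; last first.
  by have := key 1; rewrite expr1n mul1e/= leye_eq.
rewrite lee_fin in r0 *; apply: (@le_of_small _ (1 / (G + 1)) _ _ (r * G)).
  by apply: divr_gt0 => //; lra.
move=> t t0; rewrite ler_pdivlMr ?mul1r; last lra.
move=> tG; have tG1 : 1 - t * G > 0 by lra.
(* With [l ^+ 2 = 2 * t], [key] reads [t * r + 1 <= expR (t * G)]. Since
   [expR (t * G) <= 1 / (1 - t * G)], this gives [r <= G + t * (r * G)]. *)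
have := key (Num.sqrt (2 * t)); rewrite sqr_sqrtr; last lra.
rewrite -EFinM -EFinD lee_fin (_ : 2 * t * G / 2 = t * G); last by field.
move=> H; have : expR (t * G) * (1 - t * G) <= 1.
  rewrite -[leRHS](expRxMexpNx_1 (t * G)) ler_wpM2l ?expR_ge0//.
  exact: expR_ge1Dx.
rewrite -ler_pdivlMr// => H2.
have : t * r <= t * G / (1 - t * G).
  have -> : t * G / (1 - t * G) = 1 / (1 - t * G) - 1 by field; rewrite gt_eqF.
  lra.
rewrite -mulrA ler_pM2l// ler_pdivlMr//; lra.
Qed.

(* From [x ^ 4 <= 4! * (expR x + expR (- x))] and [E [expR <g, U>] = expR (|g|^2 / 2)]. *)
Definition kappa : R := 48 * expR (1 / 2).

Lemma kappa_ge0 : 0 <= kappa. Proof. by rewrite mulr_ge0// expR_ge0. Qed.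

Lemma moment4_dot (g : 'rV[R]_d) :
  (\int[P]_w (dot g (U w) ^+ 4)%:E <= (kappa * dot g g ^+ 2)%:E)%E.
Proof.
have [g0|g0] := eqVneq (enorm g) 0.
  rewrite (enorm_eq0 g0) dot0l expr0n mulr0.
  under eq_integral do rewrite dot0l expr0n.
  by rewrite integral_prob_cst.
have G0 : 0 < enorm g by rewrite lt0r g0 enorm_ge0.
set a := (enorm g)^-1; have a0 : 0 < a by rewrite invr_gt0.
have ag : dot (a *: g) (a *: g) = 1.
  by rewrite dotZl dotZr -sqr_enorm mulrA -expr2 exprVn mulVf// sqrf_eq0.
have me (b : R) : measurable_fun setT (fun w => (expR (dot (b *: g) (U w)))%:E).
  apply/measurable_EFinP; apply: measurableT_comp => //; exact: measurable_dotU.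
have m4 : measurable_fun setT (fun w => (dot g (U w) ^+ 4)%:E).
  by apply/measurable_EFinP/measurable_funX/measurable_dotU.
apply: (@le_trans _ _ (\int[P]_w ((24 * enorm g ^+ 4)%:E * ((expR (dot (a *: g) (U w)))%:E +
      (expR (dot ((- a) *: g) (U w)))%:E))))%E.
  apply: ge0_le_integral => //=.
  - by move=> w _; rewrite lee_fin exprn_even_ge0.
  - by apply: emeasurable_funM => //; exact: emeasurable_funD.
  - move=> w _; rewrite -EFinD -EFinM lee_fin !dotZl mulNr.
    have -> : dot g (U w) ^+ 4 = enorm g ^+ 4 * (a * dot g (U w)) ^+ 4.
      by rewrite exprMn mulrA /a exprVn divff ?mul1r// expf_eq0 (negbTE g0).
    have := @expr_le_expR _ 4 (a * dot g (U w)).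
    rewrite -normrX ger0_norm ?exprn_even_ge0// => H.
    apply: le_trans (ler_wpM2l (exprn_ge0 4 (ltW G0)) H) _.
    by rewrite mulrA [_ * 4`!%:R]mulrC.
rewrite ge0_integralZl//=; last 3 first.
- exact: emeasurable_funD.
- by move=> w _; rewrite adde_ge0// lee_fin expR_ge0.
- by rewrite lee_fin mulr_ge0// exprn_ge0// enorm_ge0.
rewrite ge0_integralD//=.
rewrite !integral_expR_dot// (_ : dot (- a *: g) (- a *: g) = 1); last first.
  by rewrite scaleNr dotNl dotNr opprK.
rewrite ag -EFinD -EFinM lee_fin /kappa -sqr_enorm -exprM.
by rewrite le_eqVlt; apply/orP; left; apply/eqP; ring.
Qed.

End Single.
End GaussianVector.

(** * Random variables with finite absolute moments of every order *)

Section AllMoments.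
Variables (R : realType) (dO : measure_display) (O : measurableType dO).
Variable (P : probability O R).
Implicit Types f g : O -> R.

(** Unlike integrability, this is closed under products. The expectations below involve polynomials
    in norms and Gaussian coordinates, so integrability follows from closure properties. *)
Definition all_moments f : Prop := measurable_fun setT f /\
  forall k, (\int[P]_w (`|f w| ^+ k)%:E < +oo)%E.

Lemma measurable_powr f k : measurable_fun setT f ->
  measurable_fun setT (fun w => (`|f w| ^+ k)%:E).
Proof.
move=> mf; apply/measurable_EFinP; apply: measurable_funX.
exact: measurableT_comp.
Qed.

Lemma all_moments_cst (r : R) : all_moments (fun=> r).
Proof.
split; first exact: measurable_cst.
by move=> k; rewrite integral_prob_cst ltry.
Qed.

(** A single domination principle: [p k = k] serves sums, and [p k = 2 k] serves products through
    [a * b <= a ^+ 2 + b ^+ 2]. *)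
Lemma all_moments_le2 (h f g : O -> R) (K : nat -> R) (p : nat -> nat) :
  measurable_fun setT h -> (forall k, 0 <= K k) ->
  (forall k w, `|h w| ^+ k <= K k * (`|f w| ^+ p k + `|g w| ^+ p k)) ->
  all_moments f -> all_moments g -> all_moments h.
Proof.
move=> mh K0 hle [mf f_] [mg g_]; split => // k.
apply: (@le_lt_trans _ _ (\int[P]_w ((K k)%:E * ((`|f w| ^+ p k)%:E + (`|g w| ^+ p k)%:E)))%E).
  apply: ge0_le_integral => //=.
  - exact: measurable_powr.
  - by apply: emeasurable_funM => //; apply: emeasurable_funD; exact: measurable_powr.
  - by move=> w _; rewrite -EFinD -EFinM lee_fin.
rewrite ge0_integralZl//=; last 3 first.
- by apply: emeasurable_funD; exact: measurable_powr.
- by move=> w _; rewrite adde_ge0// lee_fin exprn_ge0.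
- by rewrite lee_fin.
rewrite ge0_integralD//=; [|exact: measurable_powr|exact: measurable_powr].
have fin_f (u : O -> R) m : (\int[P]_w (`|u w| ^+ m)%:E < +oo)%E ->
    (\int[P]_w (`|u w| ^+ m)%:E)%E \is a fin_num.
  move=> H; rewrite ge0_fin_numE//; apply: integral_ge0 => w _.
  by rewrite lee_fin exprn_ge0.
by rewrite -(fineK (fin_f _ _ (f_ (p k)))) -(fineK (fin_f _ _ (g_ (p k)))) ltry.
Qed.

Lemma all_moments_le f g : measurable_fun setT f -> (forall w, `|f w| <= `|g w|) ->
  all_moments g -> all_moments f.
Proof.
move=> mf fg ag.
apply: (@all_moments_le2 f g g (fun=> 1) id) => // k w.
rewrite mul1r (@le_trans _ _ (`|g w| ^+ k))//; first by rewrite lerXn2r ?nnegrE.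
by rewrite lerDl exprn_ge0.
Qed.

Lemma all_momentsD f g : all_moments f -> all_moments g ->
  all_moments (fun w => f w + g w).
Proof.
move=> af ag; apply: (@all_moments_le2 _ f g (fun k => 2 ^+ k) id) => //.
  by apply: measurable_funD; [case: af|case: ag].
move=> k w; pose m := Num.max `|f w| `|g w|.
apply: (@le_trans _ _ ((2 * m) ^+ k)).
  rewrite lerXn2r ?nnegrE// ?mulr_ge0// ?le_max ?normr_ge0//.
  apply: le_trans (ler_normD _ _) _; rewrite mulr_natl mulr2n.
  by apply: lerD; rewrite le_max lexx ?orbT.
rewrite exprMn ler_wpM2l ?exprn_ge0// /m maxEle.
by case: ifP => _; rewrite ?lerDr ?lerDl exprn_ge0.
Qed.

Lemma all_momentsM f g : all_moments f -> all_moments g ->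
  all_moments (fun w => f w * g w).
Proof.
move=> af ag; apply: (@all_moments_le2 _ f g (fun k => 1) (fun k => k * 2)%N) => //.
  by apply: measurable_funM; [case: af|case: ag].
move=> k w; rewrite mul1r normrM exprMn !exprM.
set a := `|f w| ^+ k; set b := `|g w| ^+ k.
have := sqr_ge0 (a - b); rewrite sqrrB.
have : 0 <= a ^+ 2 + b ^+ 2 by rewrite addr_ge0// sqr_ge0.
lra.
Qed.

Lemma all_momentsZ (r : R) f : all_moments f -> all_moments (fun w => r * f w).
Proof. by move=> af; apply: all_momentsM => //; exact: all_moments_cst. Qed.

Lemma all_momentsN f : all_moments f -> all_moments (fun w => - f w).
Proof.
move=> af; apply: all_moments_le (af) => [|w]; last by rewrite normrN.
by apply: measurableT_comp => //; case: af.
Qed.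

Lemma all_moments_norm f : all_moments f -> all_moments (fun w => `|f w|).
Proof.
move=> af; apply: all_moments_le (af) => [|w]; last by rewrite normr_id.
by apply: measurableT_comp => //; case: af.
Qed.

Lemma all_momentsX f k : all_moments f -> all_moments (fun w => f w ^+ k).
Proof.
move=> af; elim: k => [|k IH]; first exact: all_moments_cst.
under eq_fun do rewrite exprS.
exact: all_momentsM.
Qed.

Lemma all_moments_sum (I : Type) (s : seq I) (F : I -> O -> R) :
  (forall i, all_moments (F i)) -> all_moments (fun w => \sum_(i <- s) F i w).
Proof.
move=> aF; elim: s => [|i s IH].
  under eq_fun do rewrite big_nil; exact: all_moments_cst.
under eq_fun do rewrite big_cons; exact: all_momentsD.
Qed.

Lemma all_moments_integrable f : all_moments f -> P.-integrable setT (EFin \o f).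
Proof.
move=> [mf f_]; apply/integrableP; split; first exact/measurable_EFinP.
by have := f_ 1%N; under eq_integral do rewrite expr1.
Qed.

Lemma all_moments_fin f : all_moments f ->
  (\int[P]_w (f w)%:E = (\int[P]_w f w)%R%:E)%E.
Proof.
move=> af; rewrite /Rintegral fineK//.
exact: integrable_fin_num (all_moments_integrable af).
Qed.

Lemma expect_le f g : all_moments f -> all_moments g ->
  (forall w, f w <= g w) -> (\int[P]_w f w <= \int[P]_w g w).
Proof. by move=> af ag fg; apply: le_Rintegral => //; exact: all_moments_integrable. Qed.

Lemma expectD f g : all_moments f -> all_moments g ->
  (\int[P]_w (f w + g w) = \int[P]_w f w + \int[P]_w g w).
Proof. by move=> af ag; rewrite RintegralD//; exact: all_moments_integrable. Qed.

Lemma expectZ (r : R) f : all_moments f ->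
  (\int[P]_w (r * f w) = r * \int[P]_w f w).
Proof. by move=> af; rewrite RintegralZl//; exact: all_moments_integrable. Qed.

Lemma expect_sum (I : Type) (s : seq I) (F : I -> O -> R) :
  (forall i, all_moments (F i)) ->
  (\int[P]_w (\sum_(i <- s) F i w) = \sum_(i <- s) \int[P]_w F i w).
Proof.
move=> aF; elim: s => [|i s IH].
  under eq_Rintegral do rewrite big_nil.
  by rewrite big_nil /Rintegral integral0.
under eq_Rintegral do rewrite big_cons.
by rewrite big_cons -IH; apply: expectD => //; exact: all_moments_sum.
Qed.

End AllMoments.

(** * Rotation invariance of an independent Gaussian pair *)

Section GaussianPair.
Variables (R : realType) (d : nat).
Variables (dO : measure_display) (O : measurableType dO) (P : probability O R).
Variable (U : O -> 'rV[R]_d).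
Hypothesis gU : gaussian P U.
Local Notation gam := (@gam R).
Local Notation Q := (P \x P)%E.
Local Notation U1 := (fun p : O * O => U p.1).
Local Notation U2 := (fun p : O * O => U p.2).

Lemma all_moments_coord j : all_moments P (fun w => U w 0 j).
Proof.
split; first exact: gaussian_cmeas gU j.
move=> k.
have me (a : R) : measurable_fun setT (fun w => (expR (dot (a *: delta_mx 0 j) (U w)))%:E).
  apply/measurable_EFinP; apply: measurableT_comp => //; exact: measurable_dotU gU _.
apply: (@le_lt_trans _ _ (\int[P]_w ((k`!%:R)%:E * ((expR (dot (1 *: delta_mx 0 j) (U w)))%:E +
  (expR (dot ((- 1) *: delta_mx 0 j) (U w)))%:E))))%E.
  apply: ge0_le_integral => //=.
  - exact/measurable_powr/(gaussian_cmeas gU).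
  - by apply: emeasurable_funM => //; exact: emeasurable_funD.
  - move=> w _; rewrite -EFinD -EFinM lee_fin !dotZl mulN1r mul1r dot_delta.
    exact: expr_le_expR.
rewrite ge0_integralZl//=; last 2 first.
- exact: emeasurable_funD.
- by move=> w _; rewrite adde_ge0// lee_fin expR_ge0.
by rewrite ge0_integralD//= !integral_expR_dot// -EFinD ltry.
Qed.

Lemma all_moments_fst f : all_moments P f -> all_moments Q (fun p => f p.1).
Proof.
move=> [mf f_]; split; first exact: measurableT_comp mf measurable_fst.
move=> k; rewrite (@fubini_tonelli1 _ _ _ _ R P P (fun p : O * O => (`|f p.1| ^+ k)%:E))//.
- apply: le_lt_trans (f_ k); rewrite le_eqVlt; apply/orP; left; apply/eqP.
  by apply: eq_integral => x _; rewrite /fubini_F/= integral_prob_cst.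
- exact: measurable_powr (measurableT_comp mf measurable_fst).
Qed.

Lemma all_moments_snd f : all_moments P f -> all_moments Q (fun p => f p.2).
Proof.
move=> [mf f_]; split; first exact: measurableT_comp mf measurable_snd.
move=> k; rewrite (@fubini_tonelli1 _ _ _ _ R P P (fun p : O * O => (`|f p.2| ^+ k)%:E))//.
- by rewrite /fubini_F/= integral_prob_cst.
- exact: measurable_powr (measurableT_comp mf measurable_snd).
Qed.

(* Quantifying over all measurable probes avoids a product sigma-algebra on row
   vectors. *)
Definition borel2 (H : 'rV[R]_d -> 'rV[R]_d -> R) : Prop :=
  forall (dW : measure_display) (W : measurableType dW) (X Y : W -> 'rV[R]_d),
    cmeas X -> cmeas Y -> measurable_fun setT (fun w => H (X w) (Y w)).

Let C2 : set (set (R * R)) := [set A `*` B | A in measurable & B in measurable].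

Let C2I : setI_closed C2.
Proof.
move=> _ _ [A mA [B mB <-]] [A' mA' [B' mB' <-]].
exists (A `&` A'); first exact: measurableI.
exists (B `&` B'); first exact: measurableI.
by rewrite setXI.
Qed.

Let C2T : C2 setT.
Proof. by exists setT => //; exists setT => //; rewrite setXTT. Qed.

Let C2gen : (measurable : set (set (R * R))) = <<s C2 >>.
Proof. exact: measurable_prod_measurableType. Qed.

Let pairU (p : O * O) (j : 'I_d) : R * R := (U p.1 0 j, U p.2 0 j).

Let iid_pair : iid C2 (gam \x gam)%E Q pairU.
Proof.
have [mU PU] := gU; split.
  move=> j; apply/measurable_fun_pairP; split.
    exact: measurableT_comp (mU j) measurable_fst.
  exact: measurableT_comp (mU j) measurable_snd.
move=> B CB.
have /choice[AB ABP] : forall j, exists AB : set R * set R,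
    [/\ measurable AB.1, measurable AB.2 & AB.1 `*` AB.2 = B j].
  by move=> j; have [A mA [A' mA' E]] := CB j; exists (A, A').
rewrite (_ : [set _ | _] = [set w | forall j, (AB j).1 (U w 0 j)] `*`
    [set w | forall j, (AB j).2 (U w 0 j)]); last first.
  apply/seteqP; split => -[w w'] /=.
    by move=> h; split => j; have := h j; have [_ _ <-] := ABP j; case.
  by move=> [h h'] j; have [_ _ <-] := ABP j; split => /=.
have mS (A : 'I_d -> set R) : (forall j, measurable (A j)) ->
    measurable [set w | forall j, A j (U w 0 j)].
  move=> mA; apply: measurable_forall => j.
  by rewrite -[X in measurable X]setTI; apply: mU.
have m1 j : measurable (AB j).1 by case: (ABP j).
have m2 j : measurable (AB j).2 by case: (ABP j).
rewrite /= product_measure1E; [|exact: (mS _ m1)|exact: (mS (fun j => (AB j).2) m2)].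
transitivity ((\prod_j gam (AB j).1) * (\prod_j gam (AB j).2))%E.
  by congr (_ * _)%E; exact: PU.
rewrite -big_split/=; apply: eq_bigr => j _.
by have [_ _ <-] := ABP j; rewrite /= product_measure1E.
Qed.

Variables (c s : R).
Hypotheses (cs : c ^+ 2 + s ^+ 2 = 1) (c1 : 1 + c != 0).
Local Notation V1 := (fun p : O * O => c *: U p.1 + s *: U p.2).
Local Notation V2 := (fun p : O * O => - s *: U p.1 + c *: U p.2).

Let rho (x : R * R) : R * R := (c * x.1 + s * x.2, - s * x.1 + c * x.2).

Let mrho : measurable_fun setT rho.
Proof.
apply/measurable_fun_pairP; split => /=; apply: measurable_funD => //=;
  apply: measurable_funM => //=; exact: measurable_cst.
Qed.

Let integral_rho (f : R * R -> \bar R) : measurable_fun setT f ->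
  (forall x, 0 <= f x)%E ->
  (\int[gam \x gam]_x f (rho x) = \int[gam \x gam]_x f x)%E.
Proof.
move=> mf f0.
etransitivity.
  exact: (@fubini_tonelli1 _ _ _ _ R gam gam (fun x => f (rho x))
    (measurableT_comp mf mrho) (fun x => f0 _)).
etransitivity; last exact/esym/(@fubini_tonelli1 _ _ _ _ R gam gam f mf f0).
exact: (@integral_gam2_rot R c s f cs c1 mf f0).
Qed.

(** The two vectors are read as [d] independent points of the plane with law [gam \x gam]. The
    rotation acts on each point separately, which reduces the claim to the plane. *)
Lemma integral_rot_pair (H : 'rV[R]_d -> 'rV[R]_d -> R) : borel2 H ->
  (\int[Q]_p (H (V1 p) (V2 p))%:E = \int[Q]_p (H (U1 p) (U2 p))%:E)%E.
Proof.
move=> bH.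
pose F (v : 'I_d -> R * R) := (H (rowf (fun j => (v j).1)) (rowf (fun j => (v j).2)))%:E.
have mF : measurable_fun setT (F : g_sigma_algebraType (rects C2) -> \bar R).
  apply/measurable_EFinP; apply: bH => j.
    rewrite (_ : (fun _ => _) = fun v : g_sigma_algebraType (rects C2) => (v j).1).
      exact: measurableT_comp measurable_fst (measurable_coord C2T C2gen j).
    by apply/funext => v; rewrite mxE.
  rewrite (_ : (fun _ => _) = fun v : g_sigma_algebraType (rects C2) => (v j).2).
    exact: measurableT_comp measurable_snd (measurable_coord C2T C2gen j).
  by apply/funext => v; rewrite mxE.
(* [integral_map_coords] treats nonnegative functions only. Applied to indicators of rectangles, it
   shows that the rotated family has the same law, and [iid_law] then covers [H] of any sign. *)
have iid_rho : iid C2 (gam \x gam)%E Q (fun p j => rho (pairU p j)).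
  have [mP PP] := iid_pair; split.
    by move=> j; exact: measurableT_comp mrho (mP j).
  move=> B CB; rewrite -PP//.
  have mB : measurable (rect B : set (g_sigma_algebraType (rects C2))).
    by apply: sub_sigma_algebra; exists B.
  have := @integral_map_coords R _ _ _ C2 (gam \x gam)%E C2I C2T C2gen _ _ Q pairU rho
    (fun v => (\1_(rect B) v)%:E) iid_pair mrho integral_rho.
  have m1 : measurable_fun setT
      ((fun v => (\1_(rect B) v)%:E) : g_sigma_algebraType (rects C2) -> \bar R).
    by apply/measurable_EFinP; exact: measurable_indic.
  have i0 v : (0 <= (\1_(rect B) v)%:E :> \bar R)%E by rewrite lee_fin.
  move=> /(_ m1 i0) H1.
  have ind (Y : O * O -> 'I_d -> R * R) :
      (forall j, measurable_fun setT (Y ^~ j)) ->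
      Q (Y @^-1` rect B) = (\int[Q]_p (\1_(rect B) (Y p))%:E)%E.
    move=> mY; rewrite prob_integral_indic//.
    by apply: (measurable_family C2gen mY); exists B.
  rewrite -[LHS]/(Q ((fun p j => rho (pairU p j)) @^-1` rect B)) ind; last first.
    by move=> j; exact: measurableT_comp mrho (mP j).
  by rewrite -[RHS]/(Q (pairU @^-1` rect B)) ind.
transitivity (\int[Q]_p F (fun j => rho (pairU p j)))%E.
  apply: eq_integral => p _; rewrite /F; congr (H _ _)%:E;
    by apply/rowP => j; rewrite !mxE.
rewrite (iid_law C2I C2T C2gen iid_rho iid_pair mF).
by apply: eq_integral => p _; rewrite /F/= !rowfE.
Qed.

End GaussianPair.

(** * Odd functions of a Gaussian vector *)

Section OddField.
Variables (R : realType) (d : nat).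
Variables (dO : measure_display) (O : measurableType dO) (P : probability O R).
Variable (U : O -> 'rV[R]_d).
Hypothesis gU : gaussian P U.
Local Notation Q := (P \x P)%E.
Local Notation U1 := (fun p : O * O => U p.1).
Local Notation U2 := (fun p : O * O => U p.2).

(** [g] stands for the gradient of [D], known only through the bound [taylor]. The constant [c0]
    stays inside remainders of higher order in the angle, so the final bounds contain [ell]
    alone. *)
Variables (D : 'rV[R]_d -> R) (g : 'rV[R]_d -> 'rV[R]_d) (ell c0 : R).
Hypotheses (cD : continuous D) (cg : forall j, continuous (fun x => g x 0 j)).
Hypotheses (ell0 : 0 < ell) (c00 : 0 <= c0) (gl : forall x, enorm (g x) <= ell).
Hypothesis taylor : forall x h, `|D (x + h) - D x - dot (g x) h| <= c0 * enorm h ^+ 2.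
Hypothesis odd : forall x, D (- x) = - D x.

Let cmU : cmeas U. Proof. exact: gaussian_cmeas gU. Qed.
Let cmU1 : cmeas U1.
Proof. by move=> j; exact: measurableT_comp (cmU j) measurable_fst. Qed.
Let cmU2 : cmeas U2.
Proof. by move=> j; exact: measurableT_comp (cmU j) measurable_snd. Qed.

Lemma continuous_enorm : continuous (@enorm R d).
Proof.
apply: (@continuous_lip _ _ _ 1) => x y; rewrite mul1r; exact: ler_dist_enorm.
Qed.

Lemma all_moments_enorm : all_moments P (fun w => enorm (U w)).
Proof.
apply: (@all_moments_le _ _ _ _ _ (fun w => \sum_j `|U w 0 j|)).
- exact: measurable_continuous_comp continuous_enorm cmU.
- move=> w; rewrite !ger0_norm ?enorm_ge0 ?sumr_ge0//; exact: enorm_le_sum.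
- by apply: all_moments_sum => j; apply/all_moments_norm/(all_moments_coord gU).
Qed.

Let N (p : O * O) := enorm (U p.1) + enorm (U p.2).

Let amN : all_moments Q N.
Proof.
exact: (all_momentsD (all_moments_fst all_moments_enorm) (all_moments_snd all_moments_enorm)).
Qed.

Let D0 : D 0 = 0.
Proof. by have := odd 0; rewrite oppr0 => D0; lra. Qed.

Let D_le x : `|D x| <= ell * enorm x + c0 * enorm x ^+ 2.
Proof.
have := taylor 0 x; rewrite add0r D0 subr0 => H.
have := ler_normD (D x - dot (g 0) x) (dot (g 0) x); rewrite subrK => H2.
have H3 : `|dot (g 0) x| <= ell * enorm x.
  by apply: le_trans (ler_dot _ _) _; rewrite ler_wpM2r ?enorm_ge0.
lra.
Qed.

Let mD (dW : measure_display) (W : measurableType dW) (Y : W -> 'rV[R]_d) :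
  cmeas Y -> measurable_fun setT (fun w => D (Y w)).
Proof. exact: measurable_continuous_comp. Qed.

Lemma all_moments_odd : all_moments P (fun w => D (U w)).
Proof.
have aE := all_moments_enorm.
apply: (@all_moments_le _ _ _ _ _
    (fun w => ell * enorm (U w) + c0 * enorm (U w) ^+ 2)).
- exact: mD.
- by move=> w; apply: le_trans (D_le _) _; exact: ler_norm.
- apply: all_momentsD; first exact: all_momentsZ.
  by apply: all_momentsZ; exact: all_momentsX.
Qed.

Lemma all_moments_dot (v : 'rV[R]_d) : all_moments P (fun w => dot v (U w)).
Proof.
by apply: all_moments_sum => j; apply/all_momentsZ/(all_moments_coord gU).
Qed.

Lemma expect_fst f : all_moments P f ->
  (\int[Q]_p f p.1 = \int[P]_w f w).
Proof.
move=> af; rewrite /Rintegral; congr fine.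
have := all_moments_integrable (all_moments_fst af) => iQ.
rewrite -[LHS](integral12_prod_meas1 iQ).
by apply: eq_integral => x _; rewrite /fubini_F/= integral_prob_cst.
Qed.

(** A quarter turn sends the pair [(U1, U2)] to [(U2, - U1)]; its two components show that
    [dot v (- U)] and [dot v U] have equal means. *)
Lemma expect_dot0 (v : 'rV[R]_d) : \int[P]_w dot v (U w) = 0.
Proof.
have rot := @integral_rot_pair _ _ _ _ _ _ gU 0 1.
have b1 : borel2 (fun x _ => dot v x).
  by move=> dW W X Y mX mY; apply: measurable_dot => // j; exact: measurable_cst.
have b2 : borel2 (fun _ y => dot v y).
  by move=> dW W X Y mX mY; apply: measurable_dot => // j; exact: measurable_cst.
have r0 : (0 : R) ^+ 2 + 1 ^+ 2 = 1 by rewrite expr0n expr1n add0r.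
have r1 : 1 + (0 : R) != 0 by rewrite addr0 oner_neq0.
have := rot r0 r1 _ b1; have := rot r0 r1 _ b2.
under eq_integral do rewrite scale0r addr0 scaleN1r.
move=> H2.
under eq_integral do rewrite scale0r add0r scale1r.
move=> H1.
have aF := all_moments_fst (all_moments_dot v).
have : \int[Q]_p dot v (- U p.1) = \int[Q]_p dot v (U p.1).
  by rewrite /Rintegral; congr fine; rewrite H2 H1.
under eq_Rintegral do rewrite -scaleN1r dotZr.
rewrite (expectZ (-1) aF) (expect_fst (all_moments_dot v)).
lra.
Qed.

Lemma expect_cross (v : 'rV[R]_d) : \int[Q]_p (D (U p.1) * dot v (U p.2)) = 0.
Proof.
have aZ : all_moments Q (fun p => D (U p.1) * dot v (U p.2)).
  exact: (all_momentsM (all_moments_fst all_moments_odd) (all_moments_snd (all_moments_dot v))).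
rewrite /Rintegral -(integral12_prod_meas1 (all_moments_integrable aZ)).
rewrite (eq_integral (fun=> 0%E)) ?integral0// => x _ /=.
rewrite /fubini_F/=.
have a1 := all_momentsZ (D (U x)) (all_moments_dot v).
by rewrite (all_moments_fin a1) expectZ ?expect_dot0 ?mulr0//; exact: all_moments_dot.
Qed.

Let W v (p : O * O) := dot (g (U p.1)) (U p.2) * dot v (U p.2).

Let mg (j : 'I_d) : measurable_fun setT (fun p : O * O => g (U p.1) 0 j).
Proof. exact: (@measurable_continuous_comp _ _ _ _ (fun x => g x 0 j)). Qed.

Let mgU : measurable_fun setT (fun p : O * O => dot (g (U p.1)) (U p.2)).
Proof. exact: measurable_dot. Qed.

Let amgU : all_moments Q (fun p => dot (g (U p.1)) (U p.2)).
Proof.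
apply: (@all_moments_le _ _ _ _ _ (fun p => ell * N p)) => //.
- move=> p; apply: le_trans (ler_dot _ _) _; apply: le_trans (ler_norm _).
  apply: ler_pM => //; rewrite ?enorm_ge0// /N lerDr enorm_ge0//.
- exact: (all_momentsZ ell amN).
Qed.

(** Once the first vector is fixed, [g (U p.1)] is a constant vector of norm at most [ell], and the
    moment bound for linear functionals applies to the second. It is used with exponents 2 and 4. *)
Lemma expect_gradX k (K : R) : 0 <= K ->
  (forall x : 'rV[R]_d, (\int[P]_w (dot x (U w) ^+ k.*2)%:E <= (K * dot x x ^+ k)%:E)%E) ->
  (\int[Q]_p (dot (g (U p.1)) (U p.2) ^+ k.*2)%:E <= (K * ell ^+ k.*2)%:E)%E.
Proof.
move=> K0 H.
have pow0 (x : R) : 0 <= x ^+ k.*2 by rewrite exprn_even_ge0// odd_double.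
have mp : measurable_fun setT (fun p : O * O => (dot (g (U p.1)) (U p.2) ^+ k.*2)%:E).
  exact/measurable_EFinP/measurable_funX.
rewrite (@fubini_tonelli1 _ _ _ _ R P P _ mp) => [|p]; last by rewrite lee_fin.
apply: (@le_trans _ _ (\int[P]_w (K * ell ^+ k.*2)%:E)%E); last by rewrite integral_prob_cst.
apply: ge0_le_integral => //=.
- by move=> x _; apply: integral_ge0 => y _; rewrite lee_fin.
- apply: (@measurable_fun_fubini_tonelli_F _ _ _ _ R P _ mp) => p.
  by rewrite lee_fin.
- move=> x _; rewrite /fubini_F/=; apply: le_trans (H _) _; rewrite lee_fin ler_wpM2l//.
  rewrite -muln2 mulnC exprM lerXn2r ?nnegrE ?dot_ge0 ?sqr_ge0//.
  by rewrite -sqr_enorm lerXn2r ?nnegrE ?enorm_ge0// ltW.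
Qed.

Lemma expect_grad2 v : \int[Q]_p W v p <= ell * enorm v.
Proof.
have amv : all_moments Q (fun p => dot v (U p.2)).
  exact: (all_moments_snd (all_moments_dot v)).
have aW : all_moments Q (W v) by exact: (all_momentsM amgU amv).
have [v0|v0] := eqVneq (enorm v) 0.
  rewrite v0 mulr0 (_ : W v = fun=> 0); first by rewrite /Rintegral integral0.
  by apply/funext => p; rewrite /W (enorm_eq0 v0) dot0l mulr0.
have v0' : 0 < enorm v by rewrite lt0r v0 enorm_ge0.
pose A p := dot (g (U p.1)) (U p.2) ^+ 2.
pose B (p : O * O) := dot v (U p.2) ^+ 2.
have aA : all_moments Q A by exact: all_momentsX.
have aB : all_moments Q B by exact: all_momentsX.
(* This weight balances the two squares: each contributes [ell * enorm v / 2], as in the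
   Cauchy-Schwarz inequality. *)
pose eta := enorm v / ell; have eta0 : 0 < eta by apply: divr_gt0.
apply: (@le_trans _ _ (\int[Q]_p (eta / 2 * A p + (eta^-1 / 2) * B p))).
  apply: expect_le => //; first by apply: all_momentsD; exact: all_momentsZ.
  move=> p; rewrite /W /A /B; set a := dot _ _; set b := dot _ _.
  have := sqr_ge0 (eta * a - b).
  rewrite -(pmulr_rge0 _ (_ : 0 < eta^-1 / 2)); last by rewrite divr_gt0// invr_gt0.
  have -> : eta^-1 / 2 * (eta * a - b) ^+ 2 =
    eta / 2 * a ^+ 2 + eta^-1 / 2 * b ^+ 2 - a * b by field; rewrite gt_eqF.
  by rewrite subr_ge0.
rewrite expectD ?expectZ//; try exact: all_momentsZ.
have EA : \int[Q]_p A p <= ell ^+ 2.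
  rewrite -lee_fin -(all_moments_fin aA).
  have := @expect_gradX 1 1 ler01; rewrite !mul1r; apply.
  by move=> x; rewrite mul1r expr1; exact: moment2_dot.
have EB : \int[Q]_p B p <= enorm v ^+ 2.
  have aB' := all_momentsX 2 (all_moments_dot v).
  have a2 : \int[Q]_p B p = \int[P]_w dot v (U w) ^+ 2.
    rewrite /Rintegral; congr fine.
    rewrite -(integral12_prod_meas1 (all_moments_integrable aB)).
    rewrite -[LHS]/(\int[P]_(x in setT) \int[P]_(y in setT) (dot v (U y) ^+ 2)%:E)%E.
    by rewrite integral_prob_cst.
  by rewrite a2 -lee_fin -(all_moments_fin aB') sqr_enorm; exact: moment2_dot.
have : eta / 2 * \int[Q]_p A p <= eta / 2 * ell ^+ 2 by rewrite ler_wpM2l// ltW// divr_gt0.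
have : eta^-1 / 2 * \int[Q]_p B p <= eta^-1 / 2 * enorm v ^+ 2.
  by rewrite ler_wpM2l// ltW// divr_gt0// invr_gt0.
have -> : eta / 2 * ell ^+ 2 = ell * enorm v / 2 by rewrite /eta; field; rewrite gt_eqF.
have -> : eta^-1 / 2 * enorm v ^+ 2 = ell * enorm v / 2.
  by rewrite /eta; field; rewrite !gt_eqF.
lra.
Qed.

Section Rotation.
Variables (c s : R).
Hypotheses (cs : c ^+ 2 + s ^+ 2 = 1) (c_ge0 : 0 <= c) (s_ge0 : 0 <= s).
Let V1 (p : O * O) := c *: U p.1 + s *: U p.2.
Let V2 (p : O * O) := - s *: U p.1 + c *: U p.2.

Let c_le1 : c <= 1. Proof. by rewrite -(@expr_le1 _ 2)// -cs lerDl sqr_ge0. Qed.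

Let s_le1 : s <= 1. Proof. by rewrite -(@expr_le1 _ 2)// -cs lerDr sqr_ge0. Qed.

Let onem_c : 1 - c <= s ^+ 2.
Proof.
have c2 : c ^+ 2 <= c by rewrite expr2 ler_piMl.
by rewrite -cs lerBlDr addrC lerD2l.
Qed.

Let c1 : 1 + c != 0. Proof. by rewrite gt_eqF// ltr_wpDr. Qed.

Let V1B p : V1 p = U p.1 + ((c - 1) *: U p.1 + s *: U p.2).
Proof. by rewrite /V1 addrA scalerBl scale1r [U p.1 + _]addrC subrK. Qed.

Let V1B_norm p : enorm ((c - 1) *: U p.1 + s *: U p.2) <= s * N p.
Proof.
apply: le_trans (ler_enormD _ _) _; rewrite !enormZ mulrDr.
rewrite (ger0_norm s_ge0) lerD2r ler_wpM2r ?enorm_ge0// ler0_norm ?subr_le0//.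
rewrite opprB; apply: le_trans onem_c _; rewrite expr2 ler_piMl//.
Qed.

Let rem_le p : `|D (V1 p) - D (U p.1) - dot (g (U p.1)) ((c - 1) *: U p.1 + s *: U p.2)|
  <= s ^+ 2 * (c0 * N p ^+ 2).
Proof.
rewrite V1B; apply: le_trans (taylor _ _) _.
rewrite [leRHS]mulrCA ler_wpM2l// -exprMn lerXn2r ?nnegrE ?enorm_ge0 ?mulr_ge0//.
by rewrite addr_ge0 ?enorm_ge0.
Qed.

Let N_ge0 p : 0 <= N p. Proof. by rewrite addr_ge0 ?enorm_ge0. Qed.

Let dot_le1 p (x : 'rV[R]_d) : `|dot x (U p.1)| <= enorm x * N p.
Proof.
apply: le_trans (ler_dot _ _) _; rewrite ler_wpM2l ?enorm_ge0//.
by rewrite lerDl enorm_ge0.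
Qed.

Let dot_le2 p (x : 'rV[R]_d) : `|dot x (U p.2)| <= enorm x * N p.
Proof.
apply: le_trans (ler_dot _ _) _; rewrite ler_wpM2l ?enorm_ge0//.
by rewrite lerDr enorm_ge0.
Qed.

Let gN p : enorm (g (U p.1)) * N p <= ell * N p.
Proof. by rewrite ler_wpM2r. Qed.

(** Expanding [Y = D V1 * dot v V2] to first order in [s] gives [- s * X + c * Z + s * c * W] up to
    [s ^+ 2]. By independence [Z] has mean 0, and by rotation invariance so does [Y], which leaves a
    bound on the mean of [X]. *)
Lemma expect_odd_rot v :
  s * (\int[P]_w (D (U w) * dot v (U w))) <=
  s * c * (ell * enorm v) +
  s ^+ 2 * \int[Q]_p (enorm v * N p * (3 * ell * N p + 2 * c0 * N p ^+ 2)).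
Proof.
pose X (p : O * O) := D (U p.1) * dot v (U p.1).
pose Y p := D (V1 p) * dot v (V2 p).
pose Z (p : O * O) := D (U p.1) * dot v (U p.2).
pose B p := enorm v * N p * (3 * ell * N p + 2 * c0 * N p ^+ 2).
have aD := all_moments_odd; have av := all_moments_dot v.
have aX0 := all_momentsM aD av.
have aX : all_moments Q X := all_moments_fst aX0.
have aZ : all_moments Q Z := all_momentsM (all_moments_fst aD) (all_moments_snd av).
have aW : all_moments Q (W v) := all_momentsM amgU (all_moments_snd av).
have aB : all_moments Q B.
  apply: (all_momentsM (all_momentsZ (enorm v) amN)).
  exact: (all_momentsD (all_momentsZ (3 * ell) amN) (all_momentsZ (2 * c0) (all_momentsX 2 amN))).
have pw p : s * X p <= (-1) * Y p + (c * Z p + (s * c * W v p + s ^+ 2 * B p)).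
  rewrite /X /Y /Z /W /B [V2 p]/V2 dotDr !dotZr.
  have := rem_le p; rewrite dotDr !dotZr.
  set r := D (V1 p) - _ - _ => rle.
  have -> : D (V1 p) = D (U p.1) +
      ((c - 1) * dot (g (U p.1)) (U p.1) + s * dot (g (U p.1)) (U p.2)) + r.
    by rewrite /r; ring.
  have ge := le_trans (dot_le1 p (g (U p.1))) (gN p).
  have gf := le_trans (dot_le2 p (g (U p.1))) (gN p).
  have ve := dot_le1 p v; have vf := dot_le2 p v.
  move: ge gf ve vf rle (N_ge0 p) (enorm_ge0 v).
  set a := dot (g _) (U p.1); set b := dot (g _) (U p.2).
  set e := dot v (U p.1); set f := dot v (U p.2).
  set n := N p; set ev := enorm v => ae be ee fe re n0 ev0.
  have nn : 0 <= ev * n by rewrite mulr_ge0.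
  have ln : 0 <= ell * n by rewrite mulr_ge0// ltW.
  have T1 : `|((c - 1) * a + r) * (- s * e + c * f)| <=
      (s ^+ 2 * (ell * n) + s ^+ 2 * (c0 * n ^+ 2)) * (2 * (ev * n)).
    rewrite normrM; apply: ler_pM => //.
      apply: le_trans (ler_normD _ _) _; apply: lerD => //.
      by rewrite normrM; apply: ler_pM => //; rewrite [`|c - 1|]ler0_norm ?subr_le0// opprB.
    apply: le_trans (ler_normD _ _) _; rewrite !normrM normrN.
    rewrite (ger0_norm s_ge0) (ger0_norm c_ge0) mulr_natl mulr2n; apply: lerD.
      by rewrite -[leRHS]mul1r; apply: ler_pM.
    by rewrite -[leRHS]mul1r; apply: ler_pM.
  have T2 : `|s ^+ 2 * (b * e)| <= s ^+ 2 * ((ell * n) * (ev * n)).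
    rewrite normrM (ger0_norm (sqr_ge0 s)) ler_wpM2l ?sqr_ge0// normrM.
    exact: ler_pM.
  have := le_trans (ler_norm _) T1.
  have /andP[T2l _] : - (s ^+ 2 * ((ell * n) * (ev * n))) <= s ^+ 2 * (b * e)
    <= s ^+ 2 * ((ell * n) * (ev * n)) by rewrite -ler_norml.
  move: T2l; set E := D (U p.1); lra.
have aY : all_moments Q Y.
  have aB' : all_moments Q (fun p => (ell * N p + c0 * N p ^+ 2) * (enorm v * N p)).
    exact: (all_momentsM (all_momentsD (all_momentsZ ell amN)
      (all_momentsZ c0 (all_momentsX 2 amN))) (all_momentsZ (enorm v) amN)).
  apply: all_moments_le aB' => [|p].
    apply: measurable_funM; first exact: (mD (cmeas_lin _ _ cmU1 cmU2)).
    apply: measurable_dot; last exact: cmeas_lin.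
    by move=> j; exact: measurable_cst.
  apply: le_trans (ler_norm _); rewrite normrM; apply: ler_pM => //.
    apply: le_trans (D_le _) _.
    have VN : enorm (V1 p) <= N p.
      apply: le_trans (ler_enormD _ _) _; rewrite !enormZ !ger0_norm//.
      by apply: lerD; rewrite ler_piMl ?enorm_ge0.
    apply: lerD; first by rewrite ler_wpM2l// ltW.
    by rewrite ler_wpM2l// lerXn2r ?nnegrE ?enorm_ge0.
  apply: le_trans (ler_dot _ _) _; rewrite ler_wpM2l ?enorm_ge0//.
  apply: le_trans (ler_enormD _ _) _; rewrite !enormZ normrN !ger0_norm//.
  by apply: lerD; rewrite ler_piMl ?enorm_ge0.
have EX : \int[Q]_p X p = \int[P]_w (D (U w) * dot v (U w)) by exact: (expect_fst aX0).
have EZ : \int[Q]_p Z p = 0 by exact: expect_cross.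
have EY : \int[Q]_p Y p = 0.
  rewrite -EZ /Rintegral; congr fine.
  apply: (integral_rot_pair gU cs c1 (H := fun x y => D x * dot v y)).
  move=> dW T X' Y' mX mY; apply: measurable_funM; first exact: mD.
  by apply: measurable_dot => // j; exact: measurable_cst.
have aR1 := all_momentsD (all_momentsZ (s * c) aW) (all_momentsZ (s ^+ 2) aB).
have aR2 := all_momentsD (all_momentsZ c aZ) aR1.
have := expect_le (all_momentsZ s aX) (all_momentsD (all_momentsZ (-1) aY) aR2) pw.
rewrite (expectZ s aX) (expectD (all_momentsZ (-1) aY) aR2) (expectZ (-1) aY).
rewrite (expectD (all_momentsZ c aZ) aR1) (expectZ c aZ).
rewrite (expectD (all_momentsZ (s * c) aW) (all_momentsZ (s ^+ 2) aB)).
rewrite (expectZ (s * c) aW) (expectZ (s ^+ 2) aB) EX EY EZ !mulr0 !add0r.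
move=> H; apply: le_trans H _; rewrite lerD2r ler_wpM2l ?mulr_ge0//.
exact: expect_grad2.
Qed.

(** The increment is [s * dot (g U1) U2] up to a remainder of order [s ^+ 2]; [pow4_addr] separates
    them and contributes the factors 8. The coefficient of [s ^+ 4] is free of [c0]. *)
Lemma increment_rot4 :
  (\int[Q]_p ((D (V1 p) - D (U p.1)) ^+ 4)%:E <=
   (s ^+ 4 * (8 * kappa R * ell ^+ 4) +
    s ^+ 8 * (8 * \int[Q]_p ((ell * N p + c0 * N p ^+ 2) ^+ 4))%R)%:E)%E.
Proof.
pose A p := dot (g (U p.1)) (U p.2) ^+ 4.
pose B p := (ell * N p + c0 * N p ^+ 2) ^+ 4.
have aA : all_moments Q A by exact: all_momentsX.
have aB : all_moments Q B.
  apply: all_momentsX.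
  exact: (all_momentsD (all_momentsZ ell amN) (all_momentsZ c0 (all_momentsX 2 amN))).
have aAB := all_momentsD (all_momentsZ (8 * s ^+ 4) aA) (all_momentsZ (8 * s ^+ 8) aB).
have pw p : (D (V1 p) - D (U p.1)) ^+ 4 <= 8 * s ^+ 4 * A p + 8 * s ^+ 8 * B p.
  have := rem_le p; rewrite dotDr !dotZr.
  have ge := le_trans (dot_le1 p (g (U p.1))) (gN p).
  rewrite /A /B; move: ge (N_ge0 p).
  set a := dot (g _) (U p.1); set b := dot (g _) (U p.2); set n := N p => ae n0.
  set x := D (V1 p) - D (U p.1) => re.
  have xle : `|x - s * b| <= s ^+ 2 * (ell * n + c0 * n ^+ 2).
    have -> : x - s * b = (x - ((c - 1) * a + s * b)) + (c - 1) * a by ring.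
    apply: le_trans (ler_normD _ _) _; rewrite mulrDr addrC; apply: lerD => //.
    by rewrite normrM; apply: ler_pM => //; rewrite [`|c - 1|]ler0_norm ?subr_le0// opprB.
  have x4 : (x - s * b) ^+ 4 <= (s ^+ 2 * (ell * n + c0 * n ^+ 2)) ^+ 4.
    rewrite -[leLHS]ger0_norm ?exprn_even_ge0// normrX lerXn2r ?nnegrE//.
    exact: le_trans (normr_ge0 _) xle.
  have := pow4_addr (s * b) (x - s * b); rewrite addrC subrK => H.
  apply: le_trans H _.
  rewrite (_ : 8 * s ^+ 4 * b ^+ 4 = 8 * (s * b) ^+ 4); last by ring.
  rewrite (_ : 8 * s ^+ 8 * _ = 8 * (s ^+ 2 * (ell * n + c0 * n ^+ 2)) ^+ 4); last by ring.
  lra.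
apply: (@le_trans _ _ (\int[Q]_p (8 * s ^+ 4 * A p + 8 * s ^+ 8 * B p)%:E)%E).
  apply: ge0_le_integral => //=.
  - by move=> p _; rewrite lee_fin exprn_even_ge0.
  - apply/measurable_EFinP/measurable_funX/measurable_funB; last exact: mD.
    exact: (mD (cmeas_lin _ _ cmU1 cmU2)).
  - by apply/measurable_EFinP; case: aAB.
  - by move=> p _; rewrite lee_fin.
rewrite (all_moments_fin aAB) lee_fin.
rewrite (expectD (all_momentsZ (8 * s ^+ 4) aA) (all_momentsZ (8 * s ^+ 8) aB)).
rewrite (expectZ _ aA) (expectZ _ aB).
rewrite -/(\int[Q]_p B p).
have EA : \int[Q]_p A p <= kappa R * ell ^+ 4.
  rewrite -lee_fin -(all_moments_fin aA).
  apply: (@expect_gradX 2); first exact: kappa_ge0.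
  exact: moment4_dot.
have s4 : 0 <= s ^+ 4 by rewrite exprn_ge0.
have := ler_wpM2l s4 EA; lra.
Qed.

Lemma integral_rot_increment (c' s' : R) :
  (\int[Q]_p ((D (c' *: V1 p + s' *: V2 p) - D (V1 p)) ^+ 4)%:E =
   \int[Q]_p ((D (c' *: U p.1 + s' *: U p.2) - D (U p.1)) ^+ 4)%:E)%E.
Proof.
apply: (integral_rot_pair gU cs c1
  (H := fun x y => (D (c' *: x + s' *: y) - D x) ^+ 4)).
move=> dW T X' Y' mX mY; apply/measurable_funX/measurable_funB; last exact: mD.
exact: (mD (cmeas_lin _ _ mX mY)).
Qed.

(** Rotating twice, the increment splits at [V1] into two increments of equal law, by rotation
    invariance. [pow4_addr] weighs each by 8, hence 16. *)
Lemma rot_double4 :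
  (\int[Q]_p ((D ((c ^+ 2 - s ^+ 2) *: U p.1 + (2 * s * c) *: U p.2) - D (U p.1)) ^+ 4)%:E
   <= 16%:E * \int[Q]_p ((D (c *: U p.1 + s *: U p.2) - D (U p.1)) ^+ 4)%:E)%E.
Proof.
have mI (c' s' : R) (X Y : O * O -> 'rV[R]_d) : cmeas X -> cmeas Y ->
    measurable_fun setT (fun p => ((D (c' *: X p + s' *: Y p) - D (X p)) ^+ 4)%:E).
  move=> mX mY; apply/measurable_EFinP/measurable_funX/measurable_funB; last exact: mD.
  exact: (mD (cmeas_lin _ _ mX mY)).
have I0 (x : R) : (0 <= (x ^+ 4)%:E)%E by rewrite lee_fin exprn_even_ge0.
have mV1 : cmeas V1 by exact: cmeas_lin.
have mV2 : cmeas V2 by exact: cmeas_lin.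
have -> : (16%:E = 8%:E + 8%:E :> \bar R)%E by rewrite -EFinD; congr EFin; ring.
rewrite ge0_muleDl ?lee_fin//.
rewrite -{2}(integral_rot_increment c s).
rewrite -!ge0_integralZl//=; last 2 first.
- exact: (mI c s _ _ mV1 mV2).
- exact: (mI c s _ _ cmU1 cmU2).
rewrite -ge0_integralD//=; last 4 first.
- by move=> p _; rewrite mule_ge0.
- by apply: emeasurable_funM => //; exact: (mI c s _ _ cmU1 cmU2).
- by move=> p _; rewrite mule_ge0.
- by apply: emeasurable_funM => //; exact: (mI c s _ _ mV1 mV2).
apply: ge0_le_integral => //=.
- exact: (mI _ _ _ _ cmU1 cmU2).
- by apply: emeasurable_funD; apply: emeasurable_funM => //;
    [exact: (mI c s _ _ cmU1 cmU2)|exact: (mI c s _ _ mV1 mV2)].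
move=> p _; rewrite -!EFinM -EFinD lee_fin.
have -> : (c ^+ 2 - s ^+ 2) *: U p.1 + (2 * s * c) *: U p.2 = c *: V1 p + s *: V2 p.
  apply/rowP => j; rewrite !mxE; ring.
rewrite -/(V1 p); set x := D (c *: V1 p + s *: V2 p).
have := pow4_addr (D (V1 p) - D (U p.1)) (x - D (V1 p)).
by rewrite addrCA addrAC subrr add0r [x + _]addrC addrC.
Qed.

End Rotation.

(* Rotate the independent pair [(U, U')] by a small angle of sine [t]: as
   [E [D U * <v, U'>] = 0], the first-order term in [t] of the rotated
   expectation is [E [<g U, U'> <v, U'>] - E [D U * <v, U>]], up to [O (t ^ 2)]. *)
Lemma stein_odd v :
  \int[P]_w (D (U w) * dot v (U w)) <= ell * enorm v.
Proof.
apply: (@le_of_small _ 1 _ _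
  (\int[Q]_p (enorm v * N p * (3 * ell * N p + 2 * c0 * N p ^+ 2)))) => // t t0 t1.
have t2 : t ^+ 2 <= 1 by rewrite expr_le1// ltW.
pose c := Num.sqrt (1 - t ^+ 2).
have cs : c ^+ 2 + t ^+ 2 = 1 by rewrite sqr_sqrtr ?subr_ge0// subrK.
have c_ge0 : 0 <= c by exact: sqrtr_ge0.
have c1 : c <= 1 by rewrite -(@expr_le1 _ 2)// -cs lerDl sqr_ge0.
have := expect_odd_rot cs c_ge0 (ltW t0) v.
set S := \int[P]_w _; set B := \int[Q]_p _ => H.
have v0 : 0 <= ell * enorm v by rewrite mulr_ge0 ?enorm_ge0// ltW.
rewrite -(ler_pM2l t0); apply: le_trans H _.
rewrite (_ : t * (_ + t * B) = t * (ell * enorm v) + t ^+ 2 * B); last by ring.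
by rewrite lerD2r -mulrA ler_pM2l// ler_piMl.
Qed.

(* With [V_t] the rotation of the pair by the angle [t], let
   [a t = E [(D V_t - D U) ^ 4]].  Then [a (2 t) <= 16 a t] and, [D] being odd,
   [a pi = 16 E [D U ^ 4]]; halving [pi] repeatedly leaves the fourth-order
   coefficient of [a] at [0]. *)
Lemma moment4_odd :
  (\int[P]_w (D (U w) ^+ 4)%:E <= (kappa R * pi ^+ 4 / 2 * ell ^+ 4)%:E)%E.
Proof.
pose a (t : R) := (\int[Q]_p ((D (cos t *: U p.1 + sin t *: U p.2) - D (U p.1)) ^+ 4)%:E)%E.
(* The exponent [m.+1] keeps the angle at most [pi / 2], where sine and cosine are nonnegative. *)
pose dl (m : nat) : R := pi / 2 ^+ m.+1.
have dl0 m : 0 <= dl m by rewrite divr_ge0 ?pi_ge0// exprn_ge0.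
have dl2 m : dl m <= pi / 2.
  rewrite ler_wpM2l ?pi_ge0// lef_pV2 ?posrE ?exprn_gt0//.
  by rewrite exprS ler_peMr// exprn_ege1// ler1n.
have cos0 m : 0 <= cos (dl m).
  by apply: cos_ge0_pihalf; rewrite dl2 andbT (le_trans _ (dl0 m))// oppr_le0 divr_ge0 ?pi_ge0.
have sin0 m : 0 <= sin (dl m).
  apply: sin_ge0_pi; rewrite dl0/=; apply: le_trans (dl2 m) _.
  by have := pi_ge0 R; lra.
have dbl m : (a (2 * dl m)%R <= 16%:E * a (dl m))%E.
  have := rot_double4 (cos2Dsin2 (dl m)) (cos0 m).
  rewrite /a (_ : 2 * dl m = dl m + dl m); last by ring.
  rewrite cosD sinD -!expr2.
  by rewrite (_ : sin (dl m) * cos (dl m) + cos (dl m) * sin (dl m) =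
    2 * sin (dl m) * cos (dl m)) //; ring.
have iter m : (a pi <= (16 ^+ m.+1)%R%:E * a (dl m))%E.
  elim: m => [|m IH].
    have := dbl 0%N; rewrite expr1 (_ : 2 * dl 0%N = pi)//.
    by rewrite /dl expr1; field.
  apply: le_trans IH _; rewrite [16 ^+ m.+2]exprSr EFinM -muleA.
  rewrite lee_wpmul2l ?lee_fin ?exprn_ge0//.
  apply: le_trans (dbl m.+1); rewrite (_ : 2 * dl m.+1 = dl m)//.
  by rewrite /dl [2 ^+ m.+2]exprS; field; rewrite expf_eq0/= pnatr_eq0.
have apiE : (a pi = 16%:E * \int[P]_w (D (U w) ^+ 4)%:E)%E.
  have a4 := all_momentsZ 16 (all_momentsX 4 all_moments_odd).
  rewrite (all_moments_fin (all_momentsX 4 all_moments_odd)) -EFinM.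
  rewrite -(expectZ 16 (all_momentsX 4 all_moments_odd)) -(expect_fst a4).
  rewrite -(all_moments_fin (all_moments_fst a4)); apply: eq_integral => p _.
  rewrite cospi sinpi scale0r addr0 scaleN1r odd; congr EFin; ring.
set K := 8 * \int[Q]_p ((ell * N p + c0 * N p ^+ 2) ^+ 4).
have K0 : 0 <= K.
  by rewrite mulr_ge0//; apply: Rintegral_ge0 => p _; rewrite exprn_even_ge0.
have bnd m : (a (dl m) <= (dl m ^+ 4 * (8 * kappa R * ell ^+ 4) + dl m ^+ 8 * K)%:E)%E.
  apply: le_trans (increment_rot4 (cos2Dsin2 (dl m)) (cos0 m) (sin0 m)) _.
  have kp : 0 <= 8 * kappa R * ell ^+ 4.
    by rewrite mulr_ge0 ?exprn_even_ge0// mulr_ge0 ?kappa_ge0.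
  have sd : sin (dl m) <= dl m by exact: sin_le_id.
  by rewrite lee_fin; apply: lerD; rewrite ler_wpM2r// lerXn2r ?nnegrE.
have aP := all_moments_fin (all_momentsX 4 all_moments_odd).
(* After division by 16, the fourth-order term is [8 * kappa R * pi ^+ 4 / 16] times [ell ^+ 4] for
   every [m], and the remainder [16 ^+ m * dl m ^+ 8 * K] equals [pi ^+ 8 * K / 256 / 16 ^+ m]. *)
rewrite aP lee_fin; apply: (@le_of_pow16 _ _ _ (pi ^+ 8 * K / 256)) => m.
have := le_trans (iter m) (lee_wpmul2l _ (bnd m)).
rewrite apiE aP lee_fin exprn_ge0// => /(_ isT); rewrite -!EFinM lee_fin.
have p2 : 2 ^+ m != 0 :> R by rewrite expf_eq0 pnatr_eq0 andbF.
have e16 : 16 ^+ m = (2 ^+ m) ^+ 4 :> R.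
  by rewrite -exprM mulnC exprM; congr (_ ^+ m); ring.
rewrite /dl exprS [2 ^+ m.+1]exprS e16 -(ler_pM2l (_ : 0 < 16^-1 :> R)) ?invr_gt0//.
rewrite mulKf; last by rewrite pnatr_eq0.
move=> H; apply: le_trans H _; rewrite le_eqVlt; apply/orP; left; apply/eqP.
field; by [].
Qed.

End OddField.

(** * Moving by an odd multiple of a projected Gaussian direction *)

Section Step.
Variables (R : realType) (d : nat).
Variables (dO : measure_display) (O : measurableType dO) (P : probability O R).
Variable (U : O -> 'rV[R]_d).
Hypothesis gU : gaussian P U.
Variables (M : 'M[R]_d) (s : R).
Hypotheses (MT : M^T = M) (M1 : sigma_max M = 1) (Ms : \tr (M^T *m M) <= s).
Local Notation kap := (kappa R).
Local Notation v := (fun w => U w *m M^T).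

Let s1 : 1 <= s. Proof. exact: le_trans (sigma_max1_tr M1) Ms. Qed.

Let amv : all_moments P (fun w => enorm (v w)).
Proof.
apply: (all_moments_le _ _ (all_moments_enorm gU)) => [|w]; last first.
  by rewrite !ger0_norm ?enorm_ge0// sigma_max1_enorm.
apply: (measurable_continuous_comp (@continuous_enorm R d)) => j.
under eq_fun do rewrite mulmx_coordE.
by apply: measurable_dot => [|i]; [exact: gaussian_cmeas gU|exact: measurable_cst].
Qed.

(** Cauchy-Schwarz with the row norms [a k] as weights: the squares of the weights sum to the trace,
    and each weighted fourth moment is at most [kap * a k ^+ 2]. The dimension never appears. *)
Lemma moment4_mulmx : \int[P]_w (enorm (v w) ^+ 4) <= kap * s ^+ 2.
Proof.
pose a k := enorm (row k M).
pose A := \tr (M^T *m M).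
have AE : A = \sum_k a k ^+ 2.
  by rewrite /A tr_sum_row; apply: eq_bigr => k _; rewrite sqr_enorm.
have A0 : 0 <= A by have := sigma_max1_tr M1; rewrite -/A; lra.
pose B w := \sum_k (a k)^-2 * dot (row k M) (U w) ^+ 4.
have aB k : all_moments P (fun w => (a k)^-2 * dot (row k M) (U w) ^+ 4).
  exact: (all_momentsZ _ (all_momentsX 4 (all_moments_dot gU _))).
have aBs : all_moments P B by exact: all_moments_sum.
have pw w : enorm (v w) ^+ 4 <= A * B w.
  have := dot_sqr_le (\row_k a k) (\row_k ((a k)^-1 * dot (row k M) (U w) ^+ 2)).
  have -> : dot (\row_k a k) (\row_k a k) = A.
    by rewrite AE; apply: eq_bigr => k _; rewrite mxE expr2.
  have -> : dot (\row_k ((a k)^-1 * dot (row k M) (U w) ^+ 2))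
     (\row_k ((a k)^-1 * dot (row k M) (U w) ^+ 2)) = B w.
    apply: eq_bigr => k _; rewrite mxE -expr2 exprMn -exprM exprVn.
    by [].
  have -> // : dot (\row_k a k) (\row_k ((a k)^-1 * dot (row k M) (U w) ^+ 2)) =
      enorm (v w) ^+ 2.
    rewrite sqr_enorm; apply: eq_bigr => k _.
    rewrite [(\row_k a k) 0 k]mxE [(\row_k (_ * _)) 0 k]mxE.
    rewrite mulmx_coordE dotC -expr2 mulrA.
    (* A zero row has inverse weight 0 by convention, and its coordinate of [v] vanishes. *)
    have [k0|k0] := eqVneq (a k) 0; last by rewrite divff// mul1r.
    by rewrite (enorm_eq0 k0) dotC dot0l expr0n mulr0.
  by rewrite -exprM.
apply: le_trans (expect_le (all_momentsX 4 amv) (all_momentsZ A aBs) pw) _.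
rewrite (expectZ A aBs) (expect_sum _ aB).
apply: (@le_trans _ _ (A * (kap * A))); last first.
  rewrite mulrCA ler_wpM2l ?kappa_ge0// expr2; apply: ler_pM => //.
rewrite ler_wpM2l// AE mulr_sumr; apply: ler_sum => k _.
rewrite (expectZ _ (all_momentsX 4 (all_moments_dot gU _))).
have [k0|k0] := eqVneq (a k) 0.
  by rewrite k0 expr0n /= invr0 mul0r mulr0.
have a0 : 0 < a k by rewrite lt0r k0 enorm_ge0.
rewrite mulrC ler_pdivrMr ?exprn_gt0// -mulrA -exprD.
rewrite -lee_fin -(all_moments_fin (all_momentsX 4 (all_moments_dot gU _))).
apply: le_trans (moment4_dot gU _) _.
by rewrite -sqr_enorm -exprM.
Qed.

Section OddProduct.
Variables (D : 'rV[R]_d -> R) (g : 'rV[R]_d -> 'rV[R]_d) (ell c0 : R).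
Hypotheses (cg : forall j, continuous (fun x => g x 0 j)).
Hypotheses (ell0 : 0 < ell) (c00 : 0 <= c0) (gl : forall x, enorm (g x) <= ell).
Hypothesis taylor : forall x h, `|D (x + h) - D x - dot (g x) h| <= c0 * enorm h ^+ 2.
Hypothesis odd : forall x, D (- x) = - D x.

Lemma taylor_continuous : continuous D.
Proof.
move=> x; apply: (@continuous_at_le _ _ _
    (fun y : 'rV[R]_d => ell * enorm (y - x) + c0 * enorm (y - x) ^+ 2)).
- move=> y; have := taylor x (y - x); rewrite [x + _]addrC subrK => H.
  rewrite -normrN opprB.
  have -> : D y - D x = (D y - D x - dot (g x) (y - x)) + dot (g x) (y - x) by ring.
  apply: le_trans (ler_normD _ _) _; rewrite addrC; apply: lerD => //.
  by apply: le_trans (ler_dot _ _) _; rewrite ler_wpM2r ?enorm_ge0.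
- have ce : continuous (fun y : 'rV[R]_d => enorm (y - x)).
    apply: (@continuous_lip _ _ _ 1) => y z; rewrite mul1r.
    apply: le_trans (ler_dist_enorm _ _) _.
    by rewrite opprB addrA subrK.
  apply: continuous_addr; apply: continuous_mulr => //; try exact: cst_continuous.
  by under eq_fun do rewrite expr2; exact: continuous_mulr.
- by rewrite subrr enorm0 expr0n !mulr0 addr0.
Qed.

Let aD : all_moments P (fun w => D (U w)).
Proof. exact: (all_moments_odd gU taylor_continuous gl taylor odd). Qed.

Local Notation C4 := (kap * pi ^+ 4 / 2).

Let m4D : \int[P]_w (D (U w) ^+ 4) <= C4 * ell ^+ 4.
Proof.
rewrite -lee_fin -(all_moments_fin (all_momentsX 4 aD)).
exact: (moment4_odd gU taylor_continuous cg ell0 c00 gl taylor odd).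
Qed.

(** Young's inequality with weights [s / ell ^+ 2] and [ell ^+ 2 / s], chosen so that both fourth
    moments contribute multiples of [ell ^+ 2 * s]. *)
Lemma expect_odd_sqr :
  \int[P]_w (D (U w) ^+ 2 * enorm (v w) ^+ 2) <= (C4 + kap) / 2 * (ell ^+ 2 * s).
Proof.
have a1 := all_momentsZ (s / ell ^+ 2 / 2) (all_momentsX 4 aD).
have a2 := all_momentsZ (ell ^+ 2 / s / 2) (all_momentsX 4 amv).
have a3 := all_momentsM (all_momentsX 2 aD) (all_momentsX 2 amv).
have s0 : 0 < s by exact: lt_le_trans ltr01 s1.
have pw w : D (U w) ^+ 2 * enorm (v w) ^+ 2 <=
    s / ell ^+ 2 / 2 * D (U w) ^+ 4 + ell ^+ 2 / s / 2 * enorm (v w) ^+ 4.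
  set x := D (U w); set y := enorm _.
  have -> : s / ell ^+ 2 / 2 * x ^+ 4 + ell ^+ 2 / s / 2 * y ^+ 4 =
    x ^+ 2 * y ^+ 2 + (s * x ^+ 2 - ell ^+ 2 * y ^+ 2) ^+ 2 / (2 * s * ell ^+ 2).
    by field; rewrite !gt_eqF.
  by rewrite lerDl divr_ge0 ?sqr_ge0// ?mulr_ge0 ?sqr_ge0// ltW.
apply: le_trans (expect_le a3 (all_momentsD a1 a2) pw) _.
rewrite (expectD a1 a2) (expectZ _ (all_momentsX 4 aD)) (expectZ _ (all_momentsX 4 amv)).
have H1 : s / ell ^+ 2 / 2 * \int[P]_w (D (U w) ^+ 4) <= s / ell ^+ 2 / 2 * (C4 * ell ^+ 4).
  by rewrite ler_wpM2l// ltW// !divr_gt0// exprn_gt0.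
have H2 : ell ^+ 2 / s / 2 * \int[P]_w (enorm (v w) ^+ 4) <= ell ^+ 2 / s / 2 * (kap * s ^+ 2).
  by rewrite ler_wpM2l ?moment4_mulmx// ltW// !divr_gt0// exprn_gt0.
apply: le_trans (lerD H1 H2) _; rewrite le_eqVlt; apply/orP; left; apply/eqP.
by field; rewrite !gt_eqF.
Qed.

(** The inequality [p * r <= 1 + (p ^+ 4 + r ^+ 4)] at [p = |D| / ell] and
    [r = enorm v / Num.sqrt s]. It may be crude, since it is used only for the additive drift and
    not for the contraction factor. *)
Lemma expect_odd_abs :
  (\int[P]_w (`|D (U w)| * enorm (v w))%:E <=
   ((1 + C4 + kap) * (ell * Num.sqrt s))%:E)%E.
Proof.
have s0 : 0 < s by exact: lt_le_trans ltr01 s1.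
have q0 : 0 < Num.sqrt s by rewrite sqrtr_gt0.
have q2 : Num.sqrt s ^+ 2 = s by rewrite sqr_sqrtr// ltW.
set t := Num.sqrt s in q0 q2 *.
pose b1 := t / ell ^+ 3; pose b2 := ell / t ^+ 3.
have a1 := all_momentsZ b1 (all_momentsX 4 aD).
have a2 := all_momentsZ b2 (all_momentsX 4 amv).
have a12 := all_momentsD a1 a2.
have a0 := all_moments_cst P (ell * t).
have a3 := all_momentsM (all_moments_norm aD) amv.
have pw w : `|D (U w)| * enorm (v w) <=
    ell * t + (b1 * D (U w) ^+ 4 + b2 * enorm (v w) ^+ 4).
  have -> : D (U w) ^+ 4 = `|D (U w)| ^+ 4 by rewrite -normrX ger0_norm// exprn_even_ge0.
  set x := `|D (U w)|; set y := enorm _.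
  have key (p r : R) : p * r <= 1 + (p ^+ 4 + r ^+ 4).
    have H (z : R) : z ^+ 2 <= z ^+ 4 + 4^-1.
      have := sqr_ge0 (z ^+ 2 - 2^-1).
      have -> : (z ^+ 2 - 2^-1) ^+ 2 = z ^+ 4 + 4^-1 - z ^+ 2 by field.
      by rewrite subr_ge0.
    have := sqr_ge0 (p - r); have := H p; have := H r.
    have := sqr_ge0 (p ^+ 2); have := sqr_ge0 (r ^+ 2); rewrite -!exprM sqrrB; lra.
  have := key (x / ell) (y / t).
  rewrite -(ler_pM2l (mulr_gt0 ell0 q0)).
  congr (_ <= _); rewrite /b1 /b2; field; rewrite !gt_eqF//.
rewrite (all_moments_fin a3) lee_fin.
apply: le_trans (expect_le a3 (all_momentsD a0 a12) pw) _.
rewrite (expectD a0 a12) (expectD a1 a2) (expectZ _ (all_momentsX 4 aD)).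
rewrite (expectZ _ (all_momentsX 4 amv)).
have -> : \int[P]_w (ell * t) = ell * t by rewrite /Rintegral integral_prob_cst.
have H1 : b1 * \int[P]_w (D (U w) ^+ 4) <= b1 * (C4 * ell ^+ 4).
  by rewrite ler_wpM2l// ltW// divr_gt0// exprn_gt0.
have H2 : b2 * \int[P]_w (enorm (v w) ^+ 4) <= b2 * (kap * s ^+ 2).
  by rewrite ler_wpM2l ?moment4_mulmx// ltW// divr_gt0// exprn_gt0.
apply: (@le_trans _ _ (ell * t + (b1 * (C4 * ell ^+ 4) + b2 * (kap * s ^+ 2)))).
  by rewrite lerD2l lerD.
rewrite -q2 le_eqVlt; apply/orP; left; apply/eqP.
by rewrite /b1 /b2; field; rewrite !gt_eqF.
Qed.

(** The norm [e] is reached through its square by [e <= A / 2 + e ^+ 2 / (2 A)], an equality at the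
    first-order prediction [A]. The cross term of the square is controlled by [stein_odd] with
    constant 1, and the moment constants multiply [a ^+ 2] only. *)
Lemma expect_odd_step (Delta : 'rV[R]_d) (a lam : R) : 0 <= a -> 0 <= lam ->
  ell = lam * enorm Delta ->
  (\int[P]_w (enorm (Delta - (a * D (U w)) *: v w))%:E <=
   (enorm Delta * (1 + a * lam + (C4 + kap) / 2 * (a ^+ 2 * lam ^+ 2 * s)))%:E)%E.
Proof.
move=> a0 lam0 ellE.
have De : 0 < enorm Delta.
  rewrite lt0r enorm_ge0 andbT; apply: contraTneq ell0 => De0.
  by rewrite ellE De0 mulr0 ltxx.
pose A := enorm Delta * (1 + a * lam).
have al : 0 <= a * lam by rewrite mulr_ge0.
have A0 : 0 < A by rewrite mulr_gt0//; lra.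
set K := (C4 + kap) / 2.
pose X w := D (U w) * dot (- (Delta *m M)) (U w).
pose Y w := D (U w) ^+ 2 * enorm (v w) ^+ 2.
have aX : all_moments P X := all_momentsM aD (all_moments_dot gU _).
have aY : all_moments P Y := all_momentsM (all_momentsX 2 aD) (all_momentsX 2 amv).
have sq w : enorm (Delta - (a * D (U w)) *: v w) ^+ 2 =
    enorm Delta ^+ 2 + (2 * a * X w + a ^+ 2 * Y w).
  rewrite !sqr_enorm !(dotBl, dotBr, dotZl, dotZr) /X /Y sqr_enorm.
  rewrite dotNl (dot_mulmx Delta) (dotC (U w *m M^T) Delta); ring.
have a1 := all_momentsZ (2 * a) aX; have a2 := all_momentsZ (a ^+ 2) aY.
have a12 := all_momentsD (all_moments_cst P (enorm Delta ^+ 2)) (all_momentsD a1 a2).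
have aE2 : all_moments P (fun w => enorm (Delta - (a * D (U w)) *: v w) ^+ 2).
  by under eq_fun do rewrite sq.
have mE : measurable_fun setT (fun w => enorm (Delta - (a * D (U w)) *: v w)).
  apply: (measurable_continuous_comp (@continuous_enorm R d)) => j.
  rewrite (_ : (fun _ => _) = fun w => Delta 0 j - a * D (U w) * dot (U w) (row j M)).
    apply: measurable_funB; first exact: measurable_cst.
    apply: measurable_funM; first by case: (all_momentsZ a aD).
    by apply: measurable_dot => [|i]; [exact: gaussian_cmeas gU|exact: measurable_cst].
  by apply/funext => w; rewrite !mxE -mulmx_coordE !mxE.
have aE : all_moments P (fun w => enorm (Delta - (a * D (U w)) *: v w)).
  apply: (all_moments_le mE _ (all_momentsD (all_moments_cst P 1) aE2)) => w.
  set e := enorm _; have e0 : 0 <= e by exact: enorm_ge0.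
  rewrite !ger0_norm ?addr_ge0 ?sqr_ge0//; have := sqr_ge0 (e - 1); rewrite sqrrB; lra.
have pw w : enorm (Delta - (a * D (U w)) *: v w) <=
    A / 2 + (2 * A)^-1 * (enorm Delta ^+ 2 + (2 * a * X w + a ^+ 2 * Y w)).
  rewrite -sq; set e := enorm _.
  have -> : A / 2 + (2 * A)^-1 * e ^+ 2 = e + (e - A) ^+ 2 / (2 * A).
    by field; rewrite gt_eqF.
  by rewrite lerDl divr_ge0 ?sqr_ge0// mulr_ge0// ltW.
rewrite (all_moments_fin aE) lee_fin.
apply: le_trans (expect_le aE
  (all_momentsD (all_moments_cst P (A / 2)) (all_momentsZ (2 * A)^-1 a12)) pw) _.
rewrite (expectD (all_moments_cst P (A / 2)) (all_momentsZ (2 * A)^-1 a12)).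
rewrite (expectZ _ a12) (expectD (all_moments_cst P _) (all_momentsD a1 a2)).
rewrite (expectD a1 a2) (expectZ _ aX) (expectZ _ aY).
have cst (r : R) : \int[P]_w r = r by rewrite /Rintegral integral_prob_cst.
rewrite !cst.
have EX : \int[P]_w X w <= lam * enorm Delta ^+ 2.
  apply: le_trans (stein_odd gU taylor_continuous cg ell0 c00 gl taylor odd _) _.
  rewrite ellE -mulrA expr2 ler_wpM2l// ler_wpM2l ?enorm_ge0// enormN.
  by rewrite -{1}MT sigma_max1_enorm.
have EY : \int[P]_w Y w <= K * (lam ^+ 2 * enorm Delta ^+ 2 * s).
  apply: le_trans expect_odd_sqr _.
  by rewrite ellE exprMn.
have A2 : 0 <= (2 * A)^-1 by rewrite invr_ge0 mulr_ge0// ltW.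
apply: (@le_trans _ _ (A / 2 + (2 * A)^-1 * (enorm Delta ^+ 2 +
   (2 * a * (lam * enorm Delta ^+ 2) + a ^+ 2 * (K * (lam ^+ 2 * enorm Delta ^+ 2 * s)))))).
  rewrite lerD2l ler_wpM2l// lerD2l; apply: lerD.
    by rewrite ler_wpM2l// mulr_ge0.
  by rewrite ler_wpM2l ?sqr_ge0.
clear pw; set b := a * lam in al A A0 A2 *.
have K0 : 0 <= K.
  by rewrite divr_ge0// addr_ge0 ?kappa_ge0// divr_ge0// mulr_ge0 ?kappa_ge0// exprn_ge0 ?pi_ge0.
set y := K * (b ^+ 2 * s).
have y0 : 0 <= y by rewrite mulr_ge0// mulr_ge0 ?sqr_ge0// (le_trans ler01 s1).
have -> : K * (a ^+ 2 * lam ^+ 2 * s) = y by rewrite /y /b; ring.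
have -> : (2 * A)^-1 * (enorm Delta ^+ 2 + (2 * a * (lam * enorm Delta ^+ 2) +
   a ^+ 2 * (K * (lam ^+ 2 * enorm Delta ^+ 2 * s)))) =
   enorm Delta * ((1 + 2 * b + y) / (2 * (1 + b))).
  have b1 : 1 + a * lam != 0 by rewrite gt_eqF//; move: al; rewrite /b; lra.
  rewrite /A /y /b; field; rewrite b1/=; by rewrite gt_eqF.
have -> : A / 2 = enorm Delta * ((1 + b) / 2) by rewrite /A; ring.
rewrite -mulrDr ler_wpM2l ?enorm_ge0//.
have : (1 + 2 * b + y) / (2 * (1 + b)) <= (1 + b) / 2 + y.
  rewrite ler_pdivrMr; last lra.
  have := sqr_ge0 b; have := mulr_ge0 y0 al.
  have -> : ((1 + b) / 2 + y) * (2 * (1 + b)) = 1 + 2 * b + b ^+ 2 + 2 * y + 2 * (y * b) by field.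
  lra.
lra.
Qed.

End OddProduct.

End Step.

(** * One step of zeroth-order descent *)

Lemma rowBE (R : realType) d (x y : 'rV[R]_d) j : (x - y) 0 j = x 0 j - y 0 j.
Proof. by rewrite !mxE. Qed.

Section Estimator.
Variables (R : realType) (d : nat).
Variables (L mu : R) (M : 'M[R]_d).
Hypotheses (L0 : 0 < L) (mu0 : 0 < mu).
Hypotheses (M1 : sigma_max M = 1).
Variable f : 'rV[R]_d -> R.
Hypotheses (Lf : Lsmooth L f) (f1 : forall x, `|f x| <= 1).
Implicit Types x h u : 'rV[R]_d.

Definition gest x u : R := (f (x + mu *: (u *m M^T)) - f (x - mu *: (u *m M^T))) / (2 * mu).

(** The gradient of [gest x] with respect to the direction [u]; differentiation cancels the division
    by [mu]. *)
Definition gest_grad x u : 'rV[R]_d :=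
  (2^-1 *: (grad f (x + mu *: (u *m M^T)) + grad f (x - mu *: (u *m M^T)))) *m M.

Lemma gest_odd x u : gest x (- u) = - gest x u.
Proof. by rewrite /gest mulNmx scalerN opprK -mulNr opprB. Qed.

(** Each of the two probes has a Taylor remainder [L * mu ^+ 2 * enorm h ^+ 2]; their sum is divided
    by [2 * mu]. *)
Lemma gest_taylor x u h :
  `|gest x (u + h) - gest x u - dot (gest_grad x u) h| <= L * mu * enorm h ^+ 2.
Proof.
set k := h *m M^T; set p := x + mu *: (u *m M^T); set m := x - mu *: (u *m M^T).
have pE : x + mu *: ((u + h) *m M^T) = p + mu *: k.
  by rewrite /p /k mulmxDl scalerDr addrA.
have mE : x - mu *: ((u + h) *m M^T) = m + mu *: (- k).
  by rewrite /m /k mulmxDl scalerDr scalerN opprD addrA.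
have T1 := Lsmooth_taylor p (mu *: k) (ltW L0) Lf.
have T2 := Lsmooth_taylor m (mu *: (- k)) (ltW L0) Lf.
have kh : enorm k <= enorm h by exact: sigma_max1_enorm.
rewrite /gest pE mE -/p -/m /gest_grad -/p -/m dot_mulmx dotZl dotDl -/k.
move: T1 T2; rewrite !dotZr dotNr !enormZ enormN (gtr0_norm mu0) => T1 T2.
set A := dot _ k in T1 T2 *; set B := dot (grad f m) k in T2 *.
have -> : (f (p + mu *: k) - f (m + mu *: - k)) / (2 * mu) - (f p - f m) / (2 * mu)
   - 2^-1 * (A + B) = ((f (p + mu *: k) - f p - mu * A) -
      (f (m + mu *: - k) - f m - mu * - B)) / (2 * mu).
  by field; rewrite gt_eqF.
have m2 : 0 < 2 * mu by rewrite mulr_gt0.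
rewrite normrM [`|(2 * mu)^-1|]gtr0_norm ?invr_gt0// ler_pdivrMr//.
apply: le_trans (ler_normB _ _) _; apply: le_trans (lerD T1 T2) _.
have kh2 : enorm k ^+ 2 <= enorm h ^+ 2 by rewrite lerXn2r ?nnegrE ?enorm_ge0.
have c0 : 0 <= 2 * L * mu ^+ 2 by rewrite mulr_ge0 ?sqr_ge0// mulr_ge0// ltW.
by have := ler_wpM2l c0 kh2; rewrite !exprMn; lra.
Qed.

Lemma enorm_mulmx_sym x : M^T = M -> enorm (x *m M) <= enorm x.
Proof. by move=> MT; rewrite -{1}MT sigma_max1_enorm. Qed.

Hypothesis MT : M^T = M.

Let enorm_half (A B : 'rV[R]_d) e : enorm A <= e -> enorm B <= e ->
  enorm (2^-1 *: (A + B)) <= e.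
Proof.
move=> Ae Be; rewrite enormZ ger0_norm ?invr_ge0//.
by have := ler_enormD A B; lra.
Qed.

(** Moving [x] shifts both probes by the same vector, so the bound is free of [mu]. It provides
    [ell] for two coupled trajectories. *)
Lemma gest_grad_lip x x' u : enorm (gest_grad x u - gest_grad x' u) <= L * enorm (x - x').
Proof.
rewrite /gest_grad -mulmxBl -scalerBr; apply: le_trans (enorm_mulmx_sym _ MT) _.
rewrite opprD addrACA; apply: enorm_half; apply: le_trans (Lf.2 _ _) _.
  by rewrite opprD addrACA subrr addr0.
by rewrite opprD addrACA subrr addr0.
Qed.

Lemma gest_grad_lipu x u u' :
  enorm (gest_grad x u - gest_grad x u') <= L * mu * enorm (u - u').
Proof.
rewrite /gest_grad -mulmxBl -scalerBr; apply: le_trans (enorm_mulmx_sym _ MT) _.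
have le : enorm (mu *: ((u - u') *m M^T)) <= mu * enorm (u - u').
  by rewrite enormZ gtr0_norm// ler_pM2l// sigma_max1_enorm.
rewrite opprD addrACA -mulrA; apply: enorm_half; apply: le_trans (Lf.2 _ _) _;
  rewrite ler_pM2l//; apply: le_trans le; rewrite mulmxBl scalerBr.
  by rewrite opprD addrACA subrr add0r.
by rewrite opprD addrACA subrr add0r -opprD enormN.
Qed.

Lemma gest_grad_bound x u : enorm (gest_grad x u) <= Num.sqrt (8 * L).
Proof.
apply: le_trans (enorm_mulmx_sym _ MT) _.
by apply: enorm_half; exact: Lsmooth_grad_bound.
Qed.

Lemma continuous_gest_grad x j : continuous (fun u => gest_grad x u 0 j).
Proof.
apply: (@continuous_lip _ _ _ (L * mu)) => u u'.
apply: le_trans (gest_grad_lipu x u u'); apply: le_trans (ler_coord_enorm _ j).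
by rewrite rowBE.
Qed.

End Estimator.

(** * Mean effect of one update on one or two iterates *)

Section StepBound.
Variables (R : realType) (d : nat) (Z : Type).
Variables (dO : measure_display) (O : measurableType dO) (P : probability O R).
Variable (U : O -> 'rV[R]_d).
Hypothesis gU : gaussian P U.
Variables (L mu a s : R) (M : 'M[R]_d).
Hypotheses (L0 : 0 < L) (mu0 : 0 < mu) (a0 : 0 <= a).
Hypotheses (MT : M^T = M) (M1 : sigma_max M = 1) (Ms : \tr (M^T *m M) <= s).
Variable loss : 'rV[R]_d -> Z -> R.
Hypotheses (Lf : forall zz, Lsmooth L (loss ^~ zz)) (f1 : forall x zz, `|loss x zz| <= 1).
Local Notation kap := (kappa R).
Local Notation C4 := (kap * pi ^+ 4 / 2).
Local Notation step zz x w := (zo_step loss zz a mu M (U w) x).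

Let zo_stepE zz x w : step zz x w = x - (a * gest mu M (loss ^~ zz) x (U w)) *: (U w *m M^T).
Proof. by rewrite /zo_step /gest mulrA. Qed.

Lemma expect_step_same zz x y :
  (\int[P]_w (enorm (step zz x w - step zz y w))%:E <=
   (enorm (x - y) * (1 + a * L + (C4 + kap) / 2 * (a ^+ 2 * L ^+ 2 * s)))%:E)%E.
Proof.
(* Equal iterates are treated apart because [expect_odd_step] needs [ell] positive. *)
have [->|xy] := eqVneq x y.
  under eq_integral do rewrite subrr enorm0.
  by rewrite integral0 subrr enorm0 mul0r.
pose D u := gest mu M (loss ^~ zz) x u - gest mu M (loss ^~ zz) y u.
under eq_integral => w _.
  rewrite !zo_stepE opprD addrACA -opprD -scalerBl -mulrBr -/(D (U w)); over.
have xy0 : 0 < enorm (x - y).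
  by rewrite lt0r enorm_ge0 andbT; apply: contra_neq xy => /enorm_eq0/subr0_eq.
have Lxy : 0 < L * enorm (x - y) by rewrite mulr_gt0.
apply: (@expect_odd_step _ _ _ _ _ _ gU _ _ MT M1 Ms D
    (fun u => gest_grad mu M (loss ^~ zz) x u - gest_grad mu M (loss ^~ zz) y u)
    (L * enorm (x - y)) (2 * (L * mu))) => //.
- move=> j.
  have -> : (fun t => (gest_grad mu M (loss ^~ zz) x t - gest_grad mu M (loss ^~ zz) y t) 0 j)
      = fun t => gest_grad mu M (loss ^~ zz) x t 0 j - gest_grad mu M (loss ^~ zz) y t 0 j.
    by apply/funext => t; rewrite rowBE.
  have cx := @continuous_gest_grad R d L mu M L0 mu0 M1 _ (Lf zz) MT x j.
  have cy := @continuous_gest_grad R d L mu M L0 mu0 M1 _ (Lf zz) MT y j.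
  by move=> u; exact: continuousB (cx u) (cy u).
- by rewrite mulr_ge0// mulr_ge0// ltW.
- by move=> u; exact: gest_grad_lip.
- move=> u h; rewrite dotBl /D.
  have T1 := gest_taylor L0 mu0 M1 (Lf zz) x u h.
  have T2 := gest_taylor L0 mu0 M1 (Lf zz) y u h.
  have := le_trans (ler_normB _ _) (lerD T1 T2).
  rewrite (_ : L * mu * _ + _ = 2 * (L * mu) * enorm h ^+ 2); last by ring.
  move: (gest _ _ _ x _) (gest _ _ _ x _) (gest _ _ _ y _) (gest _ _ _ y _) (dot _ h) (dot _ h).
  move=> p1 p2 p3 p4 p5 p6; apply: le_trans; rewrite le_eqVlt; apply/orP; left; apply/eqP.
  by congr (`|_|); ring.
- by move=> u; rewrite /D !gest_odd; ring.
- exact: ltW.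
Qed.

Lemma expect_step_move zz x :
  (\int[P]_w (enorm (step zz x w - x))%:E <=
   (a * ((1 + C4 + kap) * (Num.sqrt (8 * L) * Num.sqrt s)))%:E)%E.
Proof.
pose D u := gest mu M (loss ^~ zz) x u.
have l0 : 0 < Num.sqrt (8 * L) by rewrite sqrtr_gt0 mulr_gt0.
have cg j : continuous (fun u => gest_grad mu M (loss ^~ zz) x u 0 j).
  exact: (@continuous_gest_grad R d L mu M L0 mu0 M1 _ (Lf zz) MT x j).
have c0 : 0 <= L * mu by rewrite mulr_ge0// ltW.
have gb u : enorm (gest_grad mu M (loss ^~ zz) x u) <= Num.sqrt (8 * L).
  exact: gest_grad_bound.
have ty u h := gest_taylor L0 mu0 M1 (Lf zz) x u h.
have od u : D (- u) = - D u by exact: gest_odd.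
rewrite EFinM.
apply: le_trans (lee_wpmul2l _ (expect_odd_abs gU M1 Ms cg l0 c0 gb ty od)); last first.
  by rewrite lee_fin.
have cv : cmeas (fun w => U w *m M^T).
  move=> j; under eq_fun do rewrite mulmx_coordE.
  by apply: measurable_dot => [|i]; [exact: gaussian_cmeas gU|exact: measurable_cst].
rewrite -ge0_integralZl//=; last 2 first.
- apply/measurable_EFinP; apply: measurable_funM.
    apply: measurableT_comp => //.
    apply: measurable_continuous_comp; last exact: gaussian_cmeas gU.
    exact: (taylor_continuous gb ty).
  exact: (measurable_continuous_comp (@continuous_enorm R d)).
- by move=> w _; rewrite lee_fin mulr_ge0// enorm_ge0.
rewrite le_eqVlt; apply/orP; left; apply/eqP; apply: eq_integral => w _.
rewrite zo_stepE addrAC subrr add0r enormN enormZ normrM (ger0_norm a0).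
by rewrite -EFinM mulrA.
Qed.

(** With two samples there is no cancellation, so each iterate is charged its own displacement. *)
Lemma expect_step_diff zz zz' x y :
  (\int[P]_w (enorm (step zz x w - step zz' y w))%:E <=
   (enorm (x - y) + 2 * (a * ((1 + C4 + kap) * (Num.sqrt (8 * L) * Num.sqrt s))))%:E)%E.
Proof.
have cs zz0 x0 : cmeas (fun w => step zz0 x0 w - x0).
  move=> j.
  have cv : measurable_fun setT (fun w => (U w *m M^T) 0 j).
    under eq_fun do rewrite mulmx_coordE.
    by apply: measurable_dot => [|i]; [exact: gaussian_cmeas gU|exact: measurable_cst].
  rewrite (_ : (fun w => _) = fun w => - (a * gest mu M (loss ^~ zz0) x0 (U w) * (U w *m M^T) 0 j)).
    apply: measurableT_comp => //; apply: measurable_funM => //; apply: measurable_funM => //.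
    apply: measurable_continuous_comp; last exact: gaussian_cmeas gU.
    have ty u h := gest_taylor L0 mu0 M1 (Lf zz0) x0 u h.
    have gb := @gest_grad_bound R d L mu M L0 M1 _ (Lf zz0) (f1 ^~ zz0) MT x0.
    exact: (taylor_continuous gb ty).
  by apply/funext => w; rewrite zo_stepE addrAC subrr add0r !mxE.
have me zz0 x0 : measurable_fun setT (fun w => (enorm (step zz0 x0 w - x0))%:E).
  by apply/measurable_EFinP/(measurable_continuous_comp (@continuous_enorm R d)).
apply: (@le_trans _ _ (\int[P]_w ((enorm (x - y))%:E +
   ((enorm (step zz x w - x))%:E + (enorm (step zz' y w - y))%:E)))%E).
  apply: ge0_le_integral => //=.
  - by move=> w _; rewrite lee_fin enorm_ge0.
  - apply/measurable_EFinP/(measurable_continuous_comp (@continuous_enorm R d)) => j.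
    rewrite (_ : (fun w => _) = fun w => (x - y) 0 j +
      ((step zz x w - x) 0 j - (step zz' y w - y) 0 j)).
      by apply: measurable_funD => //; apply: measurable_funB; exact: cs.
    by apply/funext => w; rewrite !mxE; ring.
  - by apply: emeasurable_funD => //; exact: emeasurable_funD.
  - move=> w _; rewrite -!EFinD lee_fin.
    rewrite (_ : step zz x w - _ = (x - y) + ((step zz x w - x) - (step zz' y w - y))).
      apply: le_trans (ler_enormD _ _) _; rewrite lerD2l.
      by apply: le_trans (ler_enormB _ _) _.
    move: (step zz x w) (step zz' y w) => X Y.
    by apply/rowP => j; rewrite !mxE; ring.
rewrite ge0_integralD//=; last 3 first.
- by move=> w _; rewrite lee_fin enorm_ge0.
- by move=> w _; rewrite adde_ge0// lee_fin enorm_ge0.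
- exact: emeasurable_funD.
rewrite integral_prob_cst ge0_integralD//=; last 2 first.
- by move=> w _; rewrite lee_fin enorm_ge0.
- by move=> w _; rewrite lee_fin enorm_ge0.
rewrite EFinD leeD2l// mulr_natl mulr2n EFinD.
by apply: leeD; exact: expect_step_move.
Qed.

End StepBound.

(** * The sampling model *)

(** [integral_law] works on pointed carriers, and [inputs] contains functions into the index set;
    hence the sample size is written [n'.+1]. *)
HB.instance Definition _ (n : nat) := isPointed.Build 'I_n.+1 ord0.

Section Sampling.
Variables (R : realType) (dZ : measure_display) (Z : measurableType dZ).
Variables (D : probability Z R) (d n' T : nat).
Local Notation n := n'.+1.
Local Notation inputs := (('I_n -> Z) * (nat -> 'I_n) * (nat -> 'rV[R]_d))%type.
Local Notation gam := (@gam R).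
Implicit Types (A : 'I_n -> set Z) (K : nat -> {set 'I_n}) (B : nat -> 'I_d -> set R).

Definition measurable_inputs (dO : measure_display) (O : measurableType dO)
    (X : O -> inputs) : Prop :=
  [/\ forall i, measurable_fun setT (fun w => (X w).1.1 i),
      forall t, (1 <= t <= T)%N -> forall k, measurable [set w | (X w).1.2 t = k] &
      forall t j, (1 <= t <= T)%N -> measurable_fun setT (fun w => (X w).2 t 0 j)].

Definition cylinder A K B : set inputs :=
  [set x : inputs | (forall i, A i (x.1.1 i)) /\
     (forall t, (1 <= t <= T)%N -> x.1.2 t \in K t) /\
     (forall t j, (1 <= t <= T)%N -> B t j (x.2 t 0 j))].

Definition cylinders : set (set inputs) := [set S | exists A K B,
  [/\ forall i, measurable (A i), forall t j, measurable (B t j) & S = cylinder A K B]].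

(** Cylinders form a pi-system, so the product formula on them determines the law of the inputs up
    to time [T]; times outside [1..T] are left free. *)
Definition sampled (dO : measure_display) (O : measurableType dO)
    (P : probability O R) (X : O -> inputs) : Prop :=
  measurable_inputs X /\ forall A K B,
    (forall i, measurable (A i)) -> (forall t j, measurable (B t j)) ->
    P (X @^-1` cylinder A K B) = ((\prod_i D (A i)) *
        (\prod_(1 <= t < T.+1) (#|K t|%:R / n%:R)%:E) *
        (\prod_(1 <= t < T.+1) \prod_j gam (B t j)))%E.

(** Among the probes is the identity on the space generated by the cylinders
    ([measurable_inputs_id]), the case needed to transfer laws. *)
Definition borel_inputs (dY : measure_display) (Y : measurableType dY) (F : inputs -> Y) : Prop :=
  forall (dO : measure_display) (O : measurableType dO) (X : O -> inputs),
    measurable_inputs X -> measurable_fun setT (fun w => F (X w)).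

Lemma cylinders_setI : setI_closed cylinders.
Proof.
move=> _ _ [A [K [B [mA mB ->]]]] [A' [K' [B' [mA' mB' ->]]]].
exists (fun i => A i `&` A' i), (fun t => K t :&: K' t)%SET, (fun t j => B t j `&` B' t j).
split=> [i|t j|]; [exact: measurableI|exact: measurableI|].
apply/seteqP; split => x /=.
  move=> [[h1 [h2 h3]] [h1' [h2' h3']]]; split; first by move=> i; split.
  by split=> [t ht|t j ht]; [rewrite inE h2// h2'|split; [exact: h3|exact: h3']].
move=> [h1 [h2 h3]]; split; split; try by move=> i; case: (h1 i).
  split=> [t ht|t j ht]; first by have := h2 t ht; rewrite inE => /andP[].
  by case: (h3 t j ht).
split=> [t ht|t j ht]; first by have := h2 t ht; rewrite inE => /andP[].
by case: (h3 t j ht).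
Qed.

Lemma cylinders_setT : cylinders setT.
Proof.
exists (fun=> setT), (fun=> [set: 'I_n]%SET), (fun _ _ => setT); split => //.
by apply/esym/seteqP; split => // x _; split => //; split => // t _; rewrite inE.
Qed.

Lemma steps_ordP (Q : nat -> Prop) :
  (forall t, (1 <= t <= T)%N -> Q t) <-> (forall i : 'I_T, Q i.+1).
Proof.
split=> [h i|h [|t] //= ht]; first by apply: h; rewrite /= ltn_ord.
exact: (h (Ordinal ht)).
Qed.

Lemma measurable_cylinder (dO : measure_display) (O : measurableType dO)
    (X : O -> inputs) : measurable_inputs X ->
  forall S, cylinders S -> measurable (X @^-1` S).
Proof.
move=> [mz mi mu] _ [A [K [B [mA mB ->]]]].
apply: measurableI; last apply: measurableI.
- apply: measurable_forall => i.
  by rewrite -[X in measurable X]setTI; exact: mz.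
- rewrite (_ : (fun _ => _) = [set w | forall t : 'I_T, (X w).1.2 t.+1 \in K t.+1]).
    apply: measurable_forall => t.
    rewrite (_ : (fun w => _) = [set w | forall k : 'I_n,
        (if k \in K t.+1 then setT else ~` [set w | (X w).1.2 t.+1 = k]) w]).
      apply: measurable_forall => k; case: ifP => // _; apply: measurableC.
      by apply: mi; rewrite /= ltn_ord.
    apply/seteqP; split => w /= h; last first.
      have := h ((X w).1.2 t.+1); case: (_ \in _) => //.
      by move=> /(_ erefl).
    by move=> k; case: ifP => // kK; move=> /= E; move: h; rewrite E kK.
  apply/seteqP; split => w /=; first by move=> h t; apply: h; rewrite /= ltn_ord.
  by move=> h; apply/(steps_ordP (fun t => (X w).1.2 t \in K t)).
- rewrite (_ : (fun _ => _) = [set w | forall (t : 'I_T), forall j, B t.+1 j ((X w).2 t.+1 0 j)]).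
    apply: measurable_forall => t; apply: measurable_forall => j.
    rewrite -[X in measurable X]setTI; apply: mu => //.
    by rewrite /= ltn_ord.
  apply/seteqP; split => w /=.
    by move=> h t j; apply: h; rewrite /= ltn_ord.
  move=> h t j ht.
  by move: t ht; apply/(steps_ordP (fun t => B t j ((X w).2 t 0 j))).
Qed.

Lemma measurable_inputs_id :
  measurable_inputs (id : g_sigma_algebraType cylinders -> inputs).
Proof.
split.
- move=> i _ Y mY; rewrite setTI; apply: sub_sigma_algebra.
  exists (fun k => if k == i then Y else setT), (fun=> [set: 'I_n]%SET), (fun _ _ => setT).
  split=> //; first by move=> k; case: ifP.
  apply/seteqP; split => x /=; last by move=> [/(_ i)]; rewrite eqxx.
  move=> h; split; first by move=> k; case: eqP => [->|].
  by split=> // t _; rewrite inE.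
- move=> t ht k; apply: sub_sigma_algebra.
  exists (fun=> setT), (fun r => if r == t then [set k]%SET else [set: 'I_n]%SET),
    (fun _ _ => setT).
  split=> //; apply/seteqP; split => x /=.
    by move=> h; split=> //; split=> // r _; case: eqP => [->|]; rewrite inE ?h.
  by move=> [_ [/(_ t ht)]]; rewrite eqxx inE => /eqP.
- move=> t j ht _ Y mY; rewrite setTI; apply: sub_sigma_algebra.
  exists (fun=> setT), (fun=> [set: 'I_n]%SET),
    (fun r k => if (r == t) && (k == j) then Y else setT).
  split=> //; first by move=> r k; case: ifP.
  apply/seteqP; split => x /=; last by move=> [_ [_ /(_ t j ht)]]; rewrite !eqxx.
  move=> h; split=> //; split; first by move=> r _; rewrite inE.
  by move=> r k _; case: ifP => // /andP[/eqP -> /eqP ->].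
Qed.

Lemma sampled_law (d1 d2 : measure_display) (O1 : measurableType d1)
    (O2 : measurableType d2) (P1 : probability O1 R) (P2 : probability O2 R) X1 X2
    (F : inputs -> \bar R) : sampled P1 X1 -> sampled P2 X2 -> borel_inputs F ->
  (\int[P1]_w F (X1 w) = \int[P2]_w F (X2 w))%E.
Proof.
move=> [m1 e1] [m2 e2] bF.
have mF := bF _ _ _ measurable_inputs_id.
apply: (integral_law cylinders_setI cylinders_setT (measurable_cylinder m1)
  (measurable_cylinder m2) _ mF).
by move=> _ [A [K [B [mA mB ->]]]]; rewrite e1// e2.
Qed.

Section Resample.
Variables (dO : measure_display) (O : measurableType dO) (P : probability O R).
Variable X : O -> inputs.
Hypothesis sX : sampled P X.

Let uniform_setT (t : nat) : ((#|[set: 'I_n]%SET|%:R / n%:R)%:E = 1 :> \bar R)%E.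
Proof. by rewrite cardsT card_ord divff// pnatr_eq0. Qed.

Let cylP (A : 'I_n -> set Z) K B (mA : forall i, measurable (A i))
    (mB : forall t j, measurable (B t j)) :=
  sX.2 A K B mA mB.

Lemma sampled_u (t : nat) : (1 <= t <= T)%N -> gaussian P (fun w => (X w).2 t).
Proof.
move=> ht; have [[mz mi mu] _] := sX; split=> [j|B mB]; first exact: mu.
pose B' r j := if r == t then B j else setT.
have mB' r j : measurable (B' r j) by rewrite /B'; case: eqP.
transitivity (P (X @^-1` cylinder (fun=> setT) (fun=> [set: 'I_n]%SET) B')).
  congr (P _); apply/seteqP; split => w /=.
    move=> h; split=> //; split=> [r _|r j _]; first by rewrite inE.
    by rewrite /B'; case: eqP => [->|].
  by move=> [_ [_ h]] j; have := h t j ht; rewrite /B' eqxx.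
rewrite cylP// big1 ?mul1e; last by move=> i _; exact: probability_setT.
rewrite big1 ?mul1e; last by move=> r _; exact: uniform_setT.
rewrite (bigD1_seq t) ?mem_index_iota ?iota_uniq//= [X in (_ * X)%E]big1 ?mule1; last first.
  by move=> r rt; rewrite big1// => j _; rewrite /B' (negbTE rt) probability_setT.
by apply: eq_bigr => j _; rewrite /B' eqxx.
Qed.

Lemma sampled_idx (t : nat) k : (1 <= t <= T)%N ->
  P [set w | (X w).1.2 t = k] = (n%:R^-1)%:E.
Proof.
move=> ht.
pose K' r := if r == t then [set k]%SET else [set: 'I_n]%SET.
transitivity (P (X @^-1` cylinder (fun=> setT) K' (fun _ _ => setT))).
  congr (P _); apply/seteqP; split => w /=.
    move=> h; split=> //; split=> // r _.
    by rewrite /K'; case: eqP => [->|]; rewrite inE ?h.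
  by move=> [_ [/(_ t ht)]]; rewrite /K' eqxx inE => /eqP.
rewrite cylP// big1 ?mul1e; last by move=> i _; exact: probability_setT.
rewrite [X in (_ * X)%E]big1 ?mule1; last first.
  by move=> r _; rewrite big1// => j _; exact: probability_setT.
rewrite (bigD1_seq t) ?mem_index_iota ?iota_uniq//= big1 ?mule1; last first.
  by move=> r rt; rewrite /K' (negbTE rt); exact: uniform_setT.
by rewrite /K' eqxx cards1 mul1r.
Qed.

(* Freshening a coordinate: the direction at time [t] is replaced by an
   independent copy, the sample [i] by a ghost sample. *)
Definition upd_u (t : nat) (x : inputs) (v : 'rV[R]_d) : inputs :=
  (x.1, fun r => if r == t then v else x.2 r).

Definition upd_z (i : 'I_n) (x : inputs) (a : Z) : inputs :=
  ((fun k => if k == i then a else x.1.1 k, x.1.2), x.2).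

(** The independent copy is the direction at time [t] of a second outcome of the same space. *)
Lemma sampled_upd_u (t : nat) : (1 <= t <= T)%N ->
  sampled (P \x P)%E (fun p => upd_u t (X p.1) ((X p.2).2 t)).
Proof.
move=> ht; have [[mz mi mu] _] := sX; split.
  split=> [i|r hr k|r j hr].
  - exact: measurableT_comp (mz i) measurable_fst.
  - have := @measurable_fst _ _ O O measurableT _ (mi r hr k).
    by rewrite setTI.
  - rewrite /upd_u/=; case: (r == t).
      exact: measurableT_comp (mu t j ht) measurable_snd.
    exact: measurableT_comp (mu r j hr) measurable_fst.
move=> A K B mA mB.
pose B' r j := if r == t then setT else B r j.
have mB' r j : measurable (B' r j) by rewrite /B'; case: eqP.
pose E1 := X @^-1` cylinder A K B'.
pose E2 := [set w | forall j, B t j ((X w).2 t 0 j)].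
have mE1 : measurable E1 by apply: measurable_cylinder; [exact: sX.1|exists A, K, B'].
have mE2 : measurable E2.
  apply: measurable_forall => j.
  by rewrite -[X in measurable X]setTI; exact: mu.
rewrite (_ : _ @^-1` _ = E1 `*` E2); last first.
  apply/seteqP; split => -[w w'] /=.
    move=> [h1 [h2 h3]]; split; last first.
      by move=> j; have := h3 t j ht; rewrite /upd_u/= eqxx.
    split=> //; split=> // r j hr; have := h3 r j hr.
    by rewrite /upd_u/= /B'; case: eqP.
  move=> [[h1 [h2 h3]] h4]; split=> //; split=> // r j hr.
  by have := h3 r j hr; rewrite /upd_u/= /B'; case: eqP => [->|].
transitivity (P E1 * P E2)%E; first by rewrite /= product_measure1E.
rewrite cylP//.
have -> : P E2 = (\prod_j gam (B t j))%E.
  by have [_] := sampled_u ht; apply => j; exact: mB.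
rewrite -muleA; congr (_ * _)%E.
rewrite (bigD1_seq t) ?mem_index_iota ?iota_uniq//=.
rewrite [in RHS](bigD1_seq t) ?mem_index_iota ?iota_uniq//=.
rewrite big1; last by move=> j _; rewrite /B' eqxx probability_setT.
rewrite mul1e muleC; congr (_ * _)%E; apply: eq_bigr => r rt.
by apply: eq_bigr => j _; rewrite /B' (negbTE rt).
Qed.

Lemma sampled_upd_z i : sampled (P \x D)%E (fun p => upd_z i (X p.1) p.2).
Proof.
have [[mz mi mu] _] := sX; split.
  split=> [k|r hr k|r j hr].
  - rewrite /upd_z/=; case: (k == i); first exact: measurable_snd.
    exact: measurableT_comp (mz k) measurable_fst.
  - have := @measurable_fst _ _ O Z measurableT _ (mi r hr k).
    by rewrite setTI.
  - exact: measurableT_comp (mu r j hr) measurable_fst.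
move=> A K B mA mB.
pose A' k := if k == i then setT else A k.
have mA' k : measurable (A' k) by rewrite /A'; case: eqP.
pose E1 := X @^-1` cylinder A' K B.
have mE1 : measurable E1 by apply: measurable_cylinder; [exact: sX.1|exists A', K, B].
rewrite (_ : _ @^-1` _ = E1 `*` A i); last first.
  apply/seteqP; split => -[w a] /=.
    move=> [h1 h2]; split; last by have := h1 i; rewrite /upd_z/= eqxx.
    split=> // k; have := h1 k.
    by rewrite /upd_z/= /A'; case: eqP.
  move=> [[h1 h2] h4]; split=> // k.
  by have := h1 k; rewrite /upd_z/= /A'; case: eqP => [->|].
transitivity (P E1 * D (A i))%E; first by rewrite /= product_measure1E.
rewrite cylP//.
rewrite muleC !muleA; congr (_ * _ * _)%E.
rewrite (bigD1 i)//= [in RHS](bigD1 i)//= {1}/A' eqxx probability_setT mul1e.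
by congr (_ * _)%E; apply: eq_bigr => k ki; rewrite /A' (negbTE ki).
Qed.

End Resample.

End Sampling.

(** * Trajectories and the first draws of a given index *)

Section Trajectory.
Variables (R : realType) (dZ : measure_display) (Z : measurableType dZ).
Variables (D : probability Z R) (d n' T : nat).
Local Notation n := n'.+1.
Local Notation inputs := (('I_n -> Z) * (nat -> 'I_n) * (nat -> 'rV[R]_d))%type.
Variables (loss : 'rV[R]_d -> Z -> R) (alpha : nat -> R) (mu : R) (M : nat -> 'M[R]_d).
Variable theta1 : 'rV[R]_d.
Hypotheses (closs : forall zz, continuous (loss ^~ zz))
  (mloss : forall th, measurable_fun setT (loss th)).
Local Notation step t a v x := (zo_step loss a (alpha t) mu (M t) v x).
Implicit Types x y : inputs.

Definition traj x k : 'rV[R]_d := zo_iter loss alpha mu M theta1 x.1.1 x.1.2 x.2 k.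

Lemma trajS x k : traj x k.+1 = step k.+1 (x.1.1 (x.1.2 k.+1)) (x.2 k.+1) (traj x k).
Proof. by []. Qed.

Lemma traj_ext x y k :
  (forall t, (1 <= t <= k)%N -> x.1.1 (x.1.2 t) = y.1.1 (y.1.2 t) /\ x.2 t = y.2 t) ->
  traj x k = traj y k.
Proof.
elim: k => // k IH h; rewrite !trajS IH => [|t /andP[t1 tk]]; last by apply: h; rewrite t1 ltnW.
by have [|-> ->] := h k.+1; rewrite ?leqnn.
Qed.

Section Measurability.
Variables (dO : measure_display) (O : measurableType dO) (X : O -> inputs).
Hypothesis mX : measurable_inputs T X.

Lemma measurable_sample t : (1 <= t <= T)%N ->
  measurable_fun setT (fun w => (X w).1.1 ((X w).1.2 t)).
Proof.
move=> ht _ A mA; rewrite setTI; have [mz mi mu'] := mX.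
rewrite (_ : _ @^-1` A = \bigcup_(k : 'I_n)
   ([set w | (X w).1.2 t = k] `&` [set w | A ((X w).1.1 k)])).
  apply: countable_bigcupT_measurable; first exact: countableP.
  move=> k; apply: measurableI; first exact: mi.
  by rewrite -[X in measurable X]setTI; exact: mz.
by apply/seteqP; split => w /=; [exists ((X w).1.2 t)|move=> [k _ [/= <-]]].
Qed.

Lemma cmeas_traj k : (k <= T)%N -> cmeas (fun w => traj (X w) k).
Proof.
elim: k => [_ j|k IH kT]; first exact: measurable_cst.
have {}IH := IH (ltnW kT).
have [_ _ mu'] := mX.
have kT' : (1 <= k.+1 <= T)%N by [].
pose v w := (X w).2 k.+1 *m (M k.+1)^T.
have mv : cmeas v.
  move=> j; under eq_fun do rewrite mulmx_coordE.
  by apply: measurable_dot => i; [exact: mu'|exact: measurable_cst].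
have ml c : measurable_fun setT (fun w =>
    loss (1 *: traj (X w) k + c *: v w) ((X w).1.1 ((X w).1.2 k.+1))).
  apply: measurable_caratheodory => //; last exact: measurable_sample.
  exact: (cmeas_lin 1 c IH mv).
move=> j.
rewrite (_ : (fun w => _) = fun w => traj (X w) k 0 j -
    (alpha k.+1 * (loss (1 *: traj (X w) k + mu *: v w) ((X w).1.1 ((X w).1.2 k.+1))
     - loss (1 *: traj (X w) k + (- mu) *: v w) ((X w).1.1 ((X w).1.2 k.+1)))
     / (2 * mu)) * v w 0 j); last first.
  apply/funext => w.
  by rewrite trajS /zo_step -/(v w) !scale1r scaleNr mxE [X in _ + X]mxE [X in - X]mxE.
apply: measurable_funB => //; apply: measurable_funM => //.
apply: measurable_funM; last exact: measurable_cst.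
apply: measurable_funM; first exact: measurable_cst.
exact: measurable_funB.
Qed.

Lemma measurable_loss_traj k (Y : O -> Z) : (k <= T)%N -> measurable_fun setT Y ->
  measurable_fun setT (fun w => loss (traj (X w) k) (Y w)).
Proof. by move=> kT mY; apply: measurable_caratheodory => //; exact: cmeas_traj. Qed.

Lemma measurable_inputs_upd_z i (Y : O -> Z) : measurable_fun setT Y ->
  measurable_inputs T (fun w => upd_z i (X w) (Y w)).
Proof.
move=> mY; have [mz mi mu'] := mX; split=> // k.
by rewrite /upd_z/=; case: (k == i).
Qed.

End Measurability.

(** The inspected times are [1..t0], hence the shift [r.+1]. *)
Definition seen (t0 : nat) (i : 'I_n) x : bool := [exists r : 'I_t0, x.1.2 r.+1 == i].

Lemma measurable_seen (dO : measure_display) (O : measurableType dO) (X : O -> inputs)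
    t0 i : measurable_inputs T X -> (t0 <= T)%N -> measurable [set w | seen t0 i (X w)].
Proof.
move=> [_ mi _] t0T.
rewrite (_ : [set _ | _] = ~` [set w | forall r : 'I_t0, (~` [set w | (X w).1.2 r.+1 = i]) w]).
  apply/measurableC/measurable_forall => r; apply: measurableC.
  by apply: mi; rewrite /= (leq_trans (ltn_ord r)).
apply/seteqP; split => w /=.
  by move=> /existsP[r /eqP ri] h; exact: (h r ri).
have [//|sn h] := boolP (seen _ _ _).
by case: h => r ri; move: sn => /existsPn/(_ r); rewrite ri eqxx.
Qed.

Section Sampled.
Variables (dO : measure_display) (O : measurableType dO) (P : probability O R).
Variable X : O -> inputs.
Hypothesis sX : sampled D T P X.

Let mX : measurable_inputs T X := sX.1.

Lemma integral_idx t i : (1 <= t <= T)%N ->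
  (\int[P]_w ((X w).1.2 t == i)%:R%:E = (n%:R^-1)%:E)%E.
Proof.
move=> ht; rewrite -(sampled_idx sX i ht).
rewrite prob_integral_indic; last by have [_ + _] := mX; exact.
apply: eq_integral => w _; rewrite indicE; congr ((nat_of_bool _)%:R%:E).
by apply/eqP/idP; rewrite in_setE.
Qed.

Lemma integral_seen t0 i : (t0 <= T)%N ->
  (\int[P]_w (seen t0 i (X w))%:R%:E <= (t0%:R / n%:R)%:E)%E.
Proof.
move=> t0T.
have mb (b : O -> bool) : measurable [set w | b w] ->
    measurable_fun setT (fun w => (b w)%:R%:E : \bar R).
  move=> mb; apply/measurable_EFinP.
  rewrite (_ : (fun w => _) = \1_[set w | b w]); first exact: measurable_indic.
  by apply/funext => w; rewrite indicE mem_setE.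
have mi (r : 'I_t0) : measurable [set w | (X w).1.2 r.+1 == i].
  have [_ mi _] := mX.
  rewrite (_ : [set _ | _] = [set w | (X w).1.2 r.+1 = i]).
    by apply: mi; rewrite /= (leq_trans (ltn_ord r)).
  by apply/seteqP; split => w /= /eqP.
apply: (@le_trans _ _ (\int[P]_w (\sum_(r < t0) ((X w).1.2 r.+1 == i)%:R%:E))%E).
  apply: ge0_le_integral => //=.
  - by apply: mb; exact: measurable_seen.
  - by apply: emeasurable_sum => r; exact: mb.
  move=> w _; rewrite sumEFin lee_fin; have [/existsP[r ri]|_] := boolP (seen _ _ _).
    by rewrite (bigD1 r)//= ri lerDl sumr_ge0// => k _; rewrite ler0n.
  by rewrite sumr_ge0// => k _; rewrite ler0n.
rewrite ge0_integral_sum//; last by move=> r; exact: mb.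
under eq_bigr => r _ do rewrite integral_idx ?(leq_trans (ltn_ord r))//.
by rewrite sumEFin sumr_const card_ord -[X in (X <= _)%E]/((_ *+ _)%:E) mulr_natl.
Qed.

End Sampled.

End Trajectory.

(** * Stability and generalization *)

Section DiscreteGronwall.
Variable R : realType.

(** This is [ln (1 + x) <= x] at [x = - 1 / t.+1]. *)
Lemma ln_sub_ge (t : nat) : (0 < t)%N -> (t.+1%:R)^-1 <= ln t.+1%:R - ln t%:R :> R.
Proof.
move=> t0.
have p0 : 0 < t%:R :> R by rewrite ltr0n.
have p1 : 0 < t.+1%:R :> R by rewrite ltr0n.
have e : t%:R / t.+1%:R = 1 + - (t.+1%:R)^-1 :> R.
  by rewrite -[t%:R](addrK 1) natr1 mulrBl divff ?gt_eqF// mul1r.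
have := @le_ln1Dx R (- (t.+1%:R)^-1).
rewrite -e ln_div ?posrE// ltrN2 invf_lt1// ltr1n => /(_ t0).
by rewrite -lerN2 opprK opprB.
Qed.

(** A potential whose increments dominate [q / t.+1 + kp / t.+1 ^+ 2]: the logarithm pays for the
    first term, and [1 / t - 1 / t.+1 >= 1 / t.+1 ^+ 2] for the second. The second part stays
    bounded. *)
Definition growth (q kp : R) (t : nat) : R := q * ln t%:R - kp / t%:R.

Lemma growth_step (q kp : R) (t : nat) : 0 <= q -> 0 <= kp -> (0 < t)%N ->
  1 + (q / t.+1%:R + kp / t.+1%:R ^+ 2) <= expR (growth q kp t.+1 - growth q kp t).
Proof.
move=> q0 k0 t0; apply: le_trans (expR_ge1Dx _) _; rewrite ler_expR.
have p0 : 0 < t%:R :> R by rewrite ltr0n.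
have p1 : 0 < t.+1%:R :> R by rewrite ltr0n.
rewrite (_ : growth q kp t.+1 - growth q kp t =
  q * (ln t.+1%:R - ln t%:R) + kp * (t%:R^-1 - t.+1%:R^-1)); last by rewrite /growth; ring.
apply: lerD; first by rewrite ler_wpM2l// ln_sub_ge.
rewrite ler_wpM2l//.
rewrite (_ : t%:R^-1 - t.+1%:R^-1 = (t%:R * t.+1%:R)^-1); last first.
  by rewrite -natr1; field; rewrite natr1 !gt_eqF.
by rewrite lef_pV2 ?posrE ?mulr_gt0 ?exprn_gt0// expr2 ler_pM2r// ler_nat.
Qed.

(* [e + B] satisfies the homogeneous recursion. *)
Lemma discrete_gronwall (e : nat -> \bar R) (q kp B : R) (t0 T : nat) :
  0 <= q -> 0 <= kp -> 0 <= B -> (0 < t0)%N -> (e t0 <= 0)%E ->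
  (forall t, (t0 <= t < T)%N ->
     e t.+1 <= (1 + (q / t.+1%:R + kp / t.+1%:R ^+ 2))%:E * e t + (B * q / t.+1%:R)%:E)%E ->
  forall t, (t0 <= t <= T)%N ->
    (e t <= (B * (expR (growth q kp t - growth q kp t0) - 1))%:E)%E.
Proof.
move=> q0 k0 B0 t00 e0 he; elim=> [|t IH] /andP[].
  by rewrite leqn0 => /eqP t0E; rewrite t0E in t00.
rewrite leq_eqVlt => /orP[/eqP <- _|]; first by rewrite subrr expR0 subrr mulr0.
rewrite ltnS => t0t tT.
have g0 : 0 <= q / t.+1%:R + kp / t.+1%:R ^+ 2.
  by rewrite addr_ge0// divr_ge0// exprn_ge0.
apply: le_trans (he t _) _; first by rewrite t0t.
have {}IH := IH _; rewrite t0t ltnW// in IH.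
apply: le_trans (leeD (lee_wpmul2l _ (IH isT)) (lexx _)) _.
  by rewrite lee_fin addr_ge0.
rewrite -EFinM -EFinD lee_fin.
have H := growth_step q0 k0 (leq_trans t00 t0t).
rewrite (_ : growth q kp t.+1 - growth q kp t0 =
  (growth q kp t.+1 - growth q kp t) + (growth q kp t - growth q kp t0)); last by ring.
rewrite [X in _ <= B * (X - 1)]expRD.
have E0 : 0 <= expR (growth q kp t - growth q kp t0) by exact: expR_ge0.
have H1 := ler_wpM2l B0 (ler_wpM2r E0 H).
have H2 : 0 <= B * (kp / t.+1%:R ^+ 2) by rewrite mulr_ge0// divr_ge0// exprn_ge0.
rewrite -[B * q / _]mulrA; move: H1 H2.
move: (expR _) (expR _) (q / _) (kp / _) => E E1 a b; lra.
Qed.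

(** Take [t0] to be the integer part of [x = T ^ p] with [p = q / (1 + q)]. As [x >= 1], truncation
    loses at most a factor 2, whence [q * ln 2]; and [q * (1 - p) = p] makes [(T / x) ^ q] equal to
    [x]. *)
Lemma growth_bound (q kp : R) (T : nat) : 0 < q -> 0 <= kp -> (0 < T)%N ->
  exists t0 : nat, [/\ (0 < t0 <= T)%N,
    t0%:R <= T%:R `^ (1 - (1 + q)^-1) &
    expR (growth q kp T - growth q kp t0) <=
      expR (kp + q * ln 2) * T%:R `^ (1 - (1 + q)^-1)].
Proof.
move=> q0 k0 T0; set p := 1 - (1 + q)^-1; set x := T%:R `^ p.
have q1 : 0 < 1 + q by lra.
have pE : p = q / (1 + q) by rewrite /p; field; rewrite gt_eqF.
have p0 : 0 < p by rewrite pE divr_gt0.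
have p1 : p <= 1 by rewrite /p lerBlDr lerDl invr_ge0 ltW.
have T1 : 1 <= T%:R :> R by rewrite ler1n.
have Tp : 0 < T%:R :> R by rewrite ltr0n.
have x1 : 1 <= x by rewrite -(powRr0 T%:R) ler_powR// ltW.
have xT : x <= T%:R by rewrite -[leRHS]powRr1 ?ler0n// ler_powR.
have x0 : 0 <= x by exact: le_trans ler01 x1.
have /andP[tx xt] := truncn_itv x0.
set t0 := Num.truncn x in tx xt.
have t00 : (0 < t0)%N by rewrite truncn_gt0.
have t0p : 0 < t0%:R :> R by rewrite ltr0n.
have t01 : 1 <= t0%:R :> R by rewrite ler1n.
exists t0; split=> //.
  by rewrite t00 /= -(ler_nat R) (le_trans tx).
have -> : x = expR (p * ln T%:R) by rewrite /x /powR gt_eqF.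
rewrite -expRD ler_expR /growth.
have lx : p * ln T%:R = ln x by rewrite ln_powR.
have lt0 : ln x <= ln 2 + ln t0%:R.
  rewrite -lnM ?posrE// ler_ln ?posrE ?mulr_gt0//; last exact: lt_le_trans x1.
  by apply: le_trans (ltW xt) _; rewrite -natr1; move: t01; move: (t0%:R) => y; lra.
have k1 : kp / t0%:R <= kp by rewrite ler_pdivrMr// ler_peMr.
have k2 : 0 <= kp / T%:R by rewrite divr_ge0.
have H := ler_wpM2l (ltW q0) lt0; rewrite -lx in H.
have E : q * (p * ln T%:R) = q * ln T%:R - p * ln T%:R.
  by rewrite pE; field; rewrite gt_eqF.
move: H E k1 k2; rewrite mulrDr; move: (kp / _) (kp / _) (q * ln _) (q * ln _) (q * ln _).
move=> a b c e f; move: (p * _) => g; move: (q * _) => h; lra.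
Qed.

End DiscreteGronwall.

(** * Stability under replacement of one sample *)

Section Stability.
Variables (R : realType) (dZ : measure_display) (Z : measurableType dZ).
Variables (D : probability Z R) (d n' T : nat).
Local Notation n := n'.+1.
Local Notation inputs := (('I_n -> Z) * (nat -> 'I_n) * (nat -> 'rV[R]_d))%type.
Variables (loss : 'rV[R]_d -> Z -> R) (alpha : nat -> R) (mu : R) (M : nat -> 'M[R]_d).
Variable theta1 : 'rV[R]_d.
Local Notation traj := (traj loss alpha mu M theta1).
Local Notation step t a v x := (zo_step loss a (alpha t) mu (M t) v x).
Local Notation kap := (kappa R).
Local Notation C4 := (kap * pi ^+ 4 / 2).
Variables (L s q kp B : R).
Hypotheses (L0 : 0 < L) (mu0 : 0 < mu) (q0 : 0 < q) (kp0 : 0 <= kp) (B0 : 0 <= B).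
Hypotheses (Lf : forall zz, Lsmooth L (loss ^~ zz)) (f1 : forall x zz, `|loss x zz| <= 1).
Hypothesis mloss : forall th, measurable_fun setT (loss th).
Hypothesis MP : forall t, (1 <= t <= T)%N ->
  [/\ (M t)^T = M t, sigma_max (M t) = 1 & \tr ((M t)^T *m M t) <= s].
Hypothesis alpha0 : forall t, (1 <= t <= T)%N -> 0 <= alpha t.
Hypothesis contraction : forall t, (1 <= t <= T)%N ->
  alpha t * L + (C4 + kap) / 2 * (alpha t ^+ 2 * L ^+ 2 * s) <=
  q / t%:R + kp / t%:R ^+ 2.
Hypothesis drift : forall t, (1 <= t <= T)%N ->
  2 * (alpha t * ((1 + C4 + kap) * (Num.sqrt (8 * L) * Num.sqrt s))) <= B * q / t%:R.
Variables (dO : measure_display) (O : measurableType dO) (P : probability O R).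
Variable X : O -> inputs.
Hypothesis sX : sampled D T P X.
Variables (t0 : nat) (i : 'I_n) (a : Z).

Let closs zz : continuous (loss ^~ zz). Proof. exact: Lsmooth_continuous (Lf zz). Qed.

(** The distance is cut off instead of being conditioned: the factor depends on the indices only, so
    it passes through averages over directions and no conditional expectation arises. *)
Definition separation k (x : inputs) : R :=
  (~~ seen t0 i x)%:R * enorm (traj x k - traj (upd_z i x a) k).

Lemma separation_ge0 k x : 0 <= separation k x.
Proof. by rewrite mulr_ge0 ?ler0n ?enorm_ge0. Qed.

Lemma borel_separation k : (t0 <= T)%N -> (k <= T)%N ->
  borel_inputs T (fun x => (separation k x)%:E).
Proof.
move=> t0T kT d' W Y mY; apply/measurable_EFinP; apply: measurable_funM.
  rewrite (_ : (fun w => _) = \1_(~` [set w | seen t0 i (Y w)])).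
    by apply/measurable_indic/measurableC/(measurable_seen i mY).
  apply/funext => w; rewrite indicE; congr ((nat_of_bool _)%:R).
  by apply/idP/idP; rewrite in_setE /= => /negP.
have mY' := measurable_inputs_upd_z mY i (measurable_cst a).
apply: (measurable_continuous_comp (@continuous_enorm R d)) => j.
under eq_fun do rewrite rowBE.
apply: measurable_funB; first exact: (cmeas_traj alpha mu M theta1 closs mloss mY kT).
exact: (cmeas_traj alpha mu M theta1 closs mloss mY' kT).
Qed.

(** The first [t] steps do not read the direction at time [t.+1], so the new direction enters the
    last step alone. *)
Lemma separation_upd_u t x v :
  separation t.+1 (upd_u t.+1 x v) = (~~ seen t0 i x)%:R *
    enorm (step t.+1 (x.1.1 (x.1.2 t.+1)) v (traj x t) -
           step t.+1 ((upd_z i x a).1.1 (x.1.2 t.+1)) v (traj (upd_z i x a) t)).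
Proof.
have E y : traj (upd_u t.+1 y v) t.+1 = step t.+1 (y.1.1 (y.1.2 t.+1)) v (traj y t).
  rewrite trajS /upd_u/= eqxx; congr (zo_step _ _ _ _ _ _ _).
  by apply: traj_ext => r /andP[_ rt] /=; rewrite ltn_eqF.
rewrite /separation E.
by rewrite -[upd_z i (upd_u _ _ _) a]/(upd_u t.+1 (upd_z i x a) v) E.
Qed.

Lemma integral_separation_upd_u t x : (t < T)%N ->
  (\int[P]_w (separation t.+1 (upd_u t.+1 x ((X w).2 t.+1)))%:E <=
   ((1 + (q / t.+1%:R + kp / t.+1%:R ^+ 2)) * separation t x +
    B * q / t.+1%:R * (x.1.2 t.+1 == i)%:R)%:E)%E.
Proof.
move=> tT; have ht : (1 <= t.+1 <= T)%N by [].
have [MT M1 Ms] := MP ht.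
have gU := sampled_u sX ht.
have g0 : 0 <= q / t.+1%:R + kp / t.+1%:R ^+ 2.
  by rewrite addr_ge0// divr_ge0 ?exprn_ge0// ltW.
have c0 : 0 <= B * q / t.+1%:R by rewrite divr_ge0// mulr_ge0// ltW.
under eq_integral do rewrite separation_upd_u.
rewrite /separation; case: (seen t0 i x) => /=.
  under eq_integral do rewrite mul0r.
  by rewrite integral0 mul0r mulr0 add0r lee_fin mulr_ge0 ?ler0n.
under eq_integral do rewrite mul1r.
rewrite mul1r; set x1 := traj x t; set x2 := traj _ t.
have e0 : 0 <= enorm (x1 - x2) by exact: enorm_ge0.
have [ti|ti] := eqVneq (x.1.2 t.+1) i.
  apply: le_trans (expect_step_diff gU L0 mu0 (alpha0 ht) MT M1 Ms Lf f1 _ _ _ _) _.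
  rewrite lee_fin mulr1; apply: lerD; last exact: drift.
  by rewrite ler_peMl// lerDl.
rewrite /upd_z/= mulr0 addr0.
apply: le_trans (expect_step_same gU L0 mu0 (alpha0 ht) MT M1 Ms Lf _ _ _) _.
by rewrite lee_fin mulrC ler_wpM2r// -addrA lerD2l contraction.
Qed.

(** With the direction at time [t.+1] replaced by an independent copy, all other inputs are
    parameters of the one-step bound; averaging the indicator that [i] is drawn turns [B] into
    [B / n]. *)
Lemma expect_separation_step t : (t0 <= T)%N -> (t < T)%N ->
  (\int[P]_w (separation t.+1 (X w))%:E <=
   (1 + (q / t.+1%:R + kp / t.+1%:R ^+ 2))%:E * \int[P]_w (separation t (X w))%:E +
   (B / n%:R * q / t.+1%:R)%:E)%E.
Proof.
move=> t0T tT; have ht : (1 <= t.+1 <= T)%N by [].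
have g0 : 0 <= 1 + (q / t.+1%:R + kp / t.+1%:R ^+ 2).
  by rewrite addr_ge0// addr_ge0// divr_ge0 ?exprn_ge0// ltW.
have c0 : 0 <= B * q / t.+1%:R by rewrite divr_ge0// mulr_ge0// ltW.
have sU := sampled_upd_u sX ht.
rewrite (sampled_law sX sU (borel_separation t0T tT)).
have mU := borel_separation t0T tT sU.1.
rewrite (@fubini_tonelli1 _ _ _ _ R P P (fun p =>
  (separation t.+1 (upd_u t.+1 (X p.1) ((X p.2).2 t.+1)))%:E))//; last first.
  by move=> p; rewrite lee_fin separation_ge0.
have mI : measurable_fun setT (fun w => ((X w).1.2 t.+1 == i)%:R%:E : \bar R).
  apply/measurable_EFinP.
  rewrite (_ : (fun w => _) = \1_[set w | (X w).1.2 t.+1 = i]).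
    by apply: measurable_indic; have [_ + _] := sX.1; exact.
  apply/funext => w; rewrite indicE; congr ((nat_of_bool _)%:R).
  by apply/eqP/idP; rewrite in_setE.
have mS := borel_separation t0T (ltnW tT) sX.1.
apply: (@le_trans _ _ (\int[P]_w
  ((1 + (q / t.+1%:R + kp / t.+1%:R ^+ 2))%:E * (separation t (X w))%:E +
    (B * q / t.+1%:R)%:E * ((X w).1.2 t.+1 == i)%:R%:E))%E).
  apply: ge0_le_integral => //=.
  - by move=> w _; apply: integral_ge0 => w' _; rewrite lee_fin separation_ge0.
  - apply: (@measurable_fun_fubini_tonelli_F _ _ _ _ R P _ mU) => p.
    by rewrite lee_fin separation_ge0.
  - by apply: emeasurable_funD; exact: measurable_funeM.
  - by move=> w _; rewrite -EFinM -EFinM -EFinD; exact: (integral_separation_upd_u (X w) tT).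
rewrite ge0_integralD//=; last 4 first.
- by move=> w _; rewrite -EFinM lee_fin mulr_ge0// separation_ge0.
- exact: measurable_funeM.
- by move=> w _; rewrite -EFinM lee_fin mulr_ge0.
- exact: measurable_funeM.
rewrite !ge0_integralZl ?lee_fin//=; last first.
  by move=> w _; rewrite lee_fin separation_ge0.
rewrite (integral_idx sX i ht) -EFinM leeD2l// lee_fin le_eqVlt; apply/orP; left.
by apply/eqP; ring.
Qed.

Lemma separation_start (x : inputs) : separation t0 x = 0.
Proof.
rewrite /separation; have [|sn] /= := boolP (seen t0 i x); first by rewrite mul0r.
suff -> : traj (upd_z i x a) t0 = traj x t0 by rewrite subrr enorm0 mulr0.
apply: traj_ext => -[|t] //= tt0; split=> //; case: eqP => // ti.
move: sn => /existsPn/(_ (Ordinal tt0)) /=.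
by rewrite ti eqxx.
Qed.

Lemma expect_separation : (0 < t0 <= T)%N ->
  (\int[P]_w (separation T (X w))%:E <=
   (B / n%:R * (expR (growth q kp T - growth q kp t0) - 1))%:E)%E.
Proof.
move=> /andP[t00 t0T].
apply: (@discrete_gronwall R (fun t => \int[P]_w (separation t (X w))%:E)%E q kp
  (B / n%:R) t0 T (ltW q0) kp0 _ t00) => //.
- by rewrite divr_ge0.
- by under eq_integral do rewrite separation_start; rewrite integral0.
- by move=> t /andP[_ tT]; exact: expect_separation_step.
- by rewrite t0T /=.
Qed.

(** When [i] is drawn early the two losses differ by at most 2, the source of [2 * (t0 / n)];
    otherwise [Lsmooth_lip] turns separation into loss. *)
Lemma expect_loss_stability : (0 < t0 <= T)%N ->
  (\int[P]_w (`|loss (traj (X w) T) a - loss (traj (upd_z i (X w) a) T) a|)%:E <=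
   (Num.sqrt (8 * L) * (B / n%:R * (expR (growth q kp T - growth q kp t0) - 1)) +
    2 * (t0%:R / n%:R))%:E)%E.
Proof.
move=> /[dup] ht /andP[t00 t0T].
have mS := borel_separation t0T (leqnn T) sX.1.
have mI : measurable_fun setT (fun w => (seen t0 i (X w))%:R%:E : \bar R).
  apply/measurable_EFinP.
  rewrite (_ : (fun w => _) = \1_[set w | seen t0 i (X w)]).
    by apply: measurable_indic; exact: (measurable_seen i sX.1).
  by apply/funext => w; rewrite indicE mem_setE.
have mX' := measurable_inputs_upd_z sX.1 i (measurable_cst a).
have ml (Y : O -> inputs) : measurable_inputs T Y ->
    measurable_fun setT (fun w : O => loss (traj (Y w) T) a).
  move=> mY; exact: (measurable_loss_traj alpha mu M theta1 closs mloss mY (leqnn T)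
    (measurable_cst a)).
apply: (@le_trans _ _ (\int[P]_w ((Num.sqrt (8 * L))%:E * (separation T (X w))%:E +
   2%:E * (seen t0 i (X w))%:R%:E))%E).
  apply: ge0_le_integral => //=.
  - apply/measurable_EFinP; apply: measurableT_comp => //.
    exact: (measurable_funB (ml X sX.1) (ml _ mX')).
  - by apply: emeasurable_funD; exact: measurable_funeM.
  - move=> w _; rewrite -!EFinM -EFinD lee_fin /separation.
    case: (seen t0 i (X w)) => /=.
      rewrite mul0r mulr0 add0r mulr1; apply: le_trans (ler_normB _ _) _.
      by rewrite -[leRHS]/(1 + 1); exact: lerD.
    by rewrite mul1r mulr0 addr0; exact: (@Lsmooth_lip _ _ L (loss ^~ a) _ _ L0 (Lf a) (f1 ^~ a)).
rewrite ge0_integralD//=; last 3 first.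
- by move=> w _; rewrite -EFinM lee_fin mulr_ge0 ?sqrtr_ge0 ?separation_ge0.
- exact: measurable_funeM.
- exact: measurable_funeM.
rewrite !ge0_integralZl ?lee_fin ?sqrtr_ge0//=; last first.
  by move=> w _; rewrite lee_fin separation_ge0.
rewrite [leRHS]EFinD; apply: leeD; rewrite [leRHS]EFinM.
  by rewrite lee_wpmul2l ?lee_fin ?sqrtr_ge0//; exact: expect_separation.
by rewrite lee_wpmul2l ?lee_fin//; exact: (integral_seen sX i t0T).
Qed.

End Stability.

(** * Generalization through a ghost sample *)

Section GhostSample.
Variables (R : realType) (dZ : measure_display) (Z : measurableType dZ).
Variables (D : probability Z R) (d n' T : nat).
Local Notation n := n'.+1.
Local Notation inputs := (('I_n -> Z) * (nat -> 'I_n) * (nat -> 'rV[R]_d))%type.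
Variables (loss : 'rV[R]_d -> Z -> R) (alpha : nat -> R) (mu : R) (M : nat -> 'M[R]_d).
Variable theta1 : 'rV[R]_d.
Local Notation traj := (traj loss alpha mu M theta1).
Hypotheses (closs : forall zz, continuous (loss ^~ zz))
  (mloss : forall th, measurable_fun setT (loss th)) (f1 : forall x zz, `|loss x zz| <= 1).
Hypothesis cpop : continuous (pop_risk D loss).
Variables (dO : measure_display) (O : measurableType dO) (P : probability O R).
Variable X : O -> inputs.
Hypothesis sX : sampled D T P X.
Local Notation PD := (P \x D)%E.

Let mtraj : cmeas (fun w => traj (X w) T).
Proof. exact: (cmeas_traj alpha mu M theta1 closs mloss sX.1 (leqnn T)). Qed.

Let bounded_moments (d' : measure_display) (W : measurableType d') (Q : probability W R)
  (f : W -> R) : measurable_fun setT f -> (forall w, `|f w| <= 1) -> all_moments Q f.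
Proof.
move=> mf fb; apply: (all_moments_le mf _ (all_moments_cst Q 1)) => w.
by rewrite normr1.
Qed.

Let pop_risk_le1 th : `|pop_risk D loss th| <= 1.
Proof.
have a1 := bounded_moments D (mloss th) (f1 th).
have c1 (r : R) : \int[D]_z r = r by rewrite /Rintegral integral_prob_cst.
rewrite -[pop_risk D loss th]/(\int[D]_z loss th z) ler_norml; apply/andP; split.
  rewrite -{1}(c1 (-1)); apply: expect_le => //; first exact: all_moments_cst.
  by move=> z; have /andP[] : -1 <= loss th z <= 1 by rewrite -ler_norml.
rewrite -[leRHS](c1 1); apply: expect_le => //; first exact: all_moments_cst.
by move=> z; exact: le_trans (ler_norm _) (f1 _ _).
Qed.

Let pop_moments : all_moments P (fun w => pop_risk D loss (traj (X w) T)).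
Proof. exact: (bounded_moments P (measurable_continuous_comp cpop mtraj)). Qed.

Let sample_moments i : all_moments P (fun w => loss (traj (X w) T) ((X w).1.1 i)).
Proof.
apply: bounded_moments => //; apply: measurable_caratheodory => //.
by have [] := sX.1.
Qed.

(* The population risk is the expected loss on the ghost sample [a], and
   exchanging [a] with sample [i] preserves the joint law. *)
Lemma expect_ghost_gap i (b : R) :
  (forall a, \int[P]_w (`|loss (traj (X w) T) a - loss (traj (upd_z i (X w) a) T) a|)%:E
     <= b%:E)%E ->
  \int[P]_w (pop_risk D loss (traj (X w) T) - loss (traj (X w) T) ((X w).1.1 i)) <= b.
Proof.
move=> hb.
pose h1 (p : O * Z) := loss (traj (X p.1) T) p.2.
pose h2 (p : O * Z) := loss (traj (upd_z i (X p.1) p.2) T) p.2.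
have sZ := sampled_upd_z sX i.
have m1 : measurable_fun setT h1.
  apply: measurable_caratheodory => // j.
  exact: measurableT_comp (mtraj j) measurable_fst.
have m2 : measurable_fun setT h2.
  by apply: measurable_caratheodory => //;
    exact: (cmeas_traj alpha mu M theta1 closs mloss sZ.1 (leqnn T)).
have a1 : all_moments PD h1 by apply: (bounded_moments _ m1) => p; exact: f1.
have a2 : all_moments PD h2 by apply: (bounded_moments _ m2) => p; exact: f1.
have E1 : \int[P]_w pop_risk D loss (traj (X w) T) = \int[PD]_p h1 p.
  rewrite /Rintegral; congr fine.
  rewrite -(integral12_prod_meas1 (all_moments_integrable a1)).
  apply: eq_integral => w _; rewrite /fubini_F /=.
  exact: (esym (all_moments_fin (bounded_moments D (mloss (traj (X w) T)) (f1 _)))).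
have E2 : \int[P]_w loss (traj (X w) T) ((X w).1.1 i) = \int[PD]_p h2 p.
  rewrite /Rintegral; congr fine.
  rewrite (sampled_law (F := fun x => (loss (traj x T) (x.1.1 i))%:E) sX sZ).
    by apply: eq_integral => p _; rewrite /h2 /= eqxx.
  move=> d' W Y mY; apply/measurable_EFinP; apply: measurable_caratheodory => //.
    exact: (cmeas_traj alpha mu M theta1 closs mloss mY (leqnn T)).
  by have [] := mY.
have N := all_momentsN (sample_moments i).
rewrite (expectD pop_moments N).
under [X in _ + X]eq_Rintegral do rewrite -mulN1r.
rewrite (expectZ _ (sample_moments i)) E1 E2 -(expectZ _ a2) -(expectD a1 (all_momentsZ _ a2)).
have a3 := all_momentsD a1 (all_momentsZ (-1) a2).
rewrite -lee_fin -(all_moments_fin a3).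
apply: (@le_trans _ _ (\int[PD]_p (`|h1 p - h2 p|)%:E)%E).
  apply: le_integral => //.
  - exact: all_moments_integrable a3.
  - by apply: all_moments_integrable; apply: all_moments_norm;
      apply: all_momentsD a1 (all_momentsN a2).
  - by move=> p _; rewrite lee_fin mulN1r ler_norm.
have m12 : measurable_fun setT (fun p => (`|h1 p - h2 p|)%:E).
  by apply/measurable_EFinP; apply: measurableT_comp => //; exact: measurable_funB.
(* The ghost sample is integrated last, so that [hb] applies to each fixed [a]. *)
rewrite (@fubini_tonelli2 _ _ _ _ R P D _ m12)//.
rewrite -[leRHS](@integral_prob_cst R _ _ D).
apply: ge0_le_integral => //=.
- by move=> a _; apply: integral_ge0.
- exact: (@measurable_fun_fubini_tonelli_G _ _ _ _ R P _ m12).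
- by move=> a _; exact: hb.
Qed.

Lemma expect_generalization_gap (b : R) :
  (forall i a, \int[P]_w (`|loss (traj (X w) T) a - loss (traj (upd_z i (X w) a) T) a|)%:E
     <= b%:E)%E ->
  ('E_P[fun w => (pop_risk D loss (traj (X w) T) -
      emp_risk loss (X w).1.1 (traj (X w) T))%R] <= b%:E)%E.
Proof.
move=> hb.
pose gap i w := pop_risk D loss (traj (X w) T) - loss (traj (X w) T) ((X w).1.1 i).
have ag i : all_moments P (gap i) := all_momentsD pop_moments (all_momentsN (sample_moments i)).
have as_ := all_moments_sum (index_enum 'I_n) ag.
have n0 : 0 < n%:R :> R by rewrite ltr0n.
rewrite unlock (_ : (fun w => _) = fun w => (n%:R^-1 * \sum_i gap i w)%:E); last first.
  apply/funext => w; congr EFin; rewrite /gap sumrB sumr_const card_ord mulrBr.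
  by rewrite -[pop_risk _ _ _ *+ _]mulr_natl mulKf ?gt_eqF// /emp_risk mulrC.
rewrite (all_moments_fin (all_momentsZ _ as_)) (expectZ _ as_) (expect_sum _ ag) lee_fin.
rewrite ler_pdivrMl// mulr_natl -[in leRHS](card_ord n) -sumr_const.
by apply: ler_sum => i _; exact: expect_ghost_gap.
Qed.

End GhostSample.

(** * Constants of the final bound *)

Section Constants.
Variables (R : realType) (q : R).
Local Notation kap := (kappa R).
Local Notation C4 := (kap * pi ^+ 4 / 2).

Let C4_ge0 : 0 <= C4.
Proof. by rewrite divr_ge0// mulr_ge0 ?kappa_ge0// exprn_ge0 ?pi_ge0. Qed.

Definition drift_cst : R := 1 + C4 + kap.

Definition curvature_cst : R := (C4 + kap) / 2 * q ^+ 2.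

Lemma drift_cst_ge0 : 0 <= drift_cst.
Proof. by rewrite /drift_cst !addr_ge0 ?kappa_ge0. Qed.

Lemma curvature_cst_ge0 : 0 <= curvature_cst.
Proof. by rewrite mulr_ge0 ?sqr_ge0// divr_ge0// addr_ge0 ?kappa_ge0. Qed.

(** The drift enters with [2 * Num.sqrt (8 * L) / L] and the Lipschitz constant of the loss is
    [Num.sqrt (8 * L)]; their product is 16, so [L] cancels. The final 2 pays for an early draw. *)
Definition gen_cst : R := 16 * drift_cst * expR (curvature_cst + q * ln 2) + 2.

Lemma gen_cst_ge0 : 0 <= gen_cst.
Proof. by rewrite addr_ge0// mulr_ge0 ?expR_ge0// mulr_ge0 ?drift_cst_ge0. Qed.

(** The first-order coefficient [a * L] carries no [Num.sqrt s] and is enlarged to [q / t] by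
    [1 <= s]; the second-order one carries [s] and matches [q ^+ 2 / t ^+ 2]. *)
Lemma contraction_le (L C s a t : R) : 0 < L -> 0 < C -> 1 <= s -> 0 < t ->
  q = C * L * Num.sqrt s -> 0 <= a <= C / t ->
  a * L + (C4 + kap) / 2 * (a ^+ 2 * L ^+ 2 * s) <= q / t + curvature_cst / t ^+ 2.
Proof.
move=> L0 C0 s1 t0 qE /andP[a0 aC].
have s0 : 0 <= s by lra.
have rs1 : 1 <= Num.sqrt s by rewrite -(sqrtr1 R) ler_wsqrtr.
have CL : 0 <= C * L / t by rewrite divr_ge0 ?mulr_ge0 ?ltW.
have aL : a * L <= C * L / t.
  have -> : C * L / t = C / t * L by ring.
  by rewrite ler_wpM2r// ltW.
apply: lerD.
  apply: le_trans aL _; rewrite qE.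
  rewrite (_ : C * L * Num.sqrt s / t = C * L / t * Num.sqrt s); last by ring.
  by rewrite ler_peMr.
rewrite /curvature_cst -[leRHS]mulrA ler_wpM2l//.
  by rewrite divr_ge0// addr_ge0 ?kappa_ge0.
rewrite -exprMn -expr_div_n qE.
rewrite (_ : C * L * Num.sqrt s / t = C * L / t * Num.sqrt s); last by ring.
rewrite [leRHS]exprMn sqr_sqrtr// ler_wpM2r// lerXn2r ?nnegrE// mulr_ge0// ltW//.
Qed.

Lemma drift_le (L C s a t : R) : 0 < L -> 0 < t ->
  q = C * L * Num.sqrt s -> 0 <= a <= C / t ->
  2 * (a * (drift_cst * (Num.sqrt (8 * L) * Num.sqrt s))) <=
  2 * drift_cst * Num.sqrt (8 * L) / L * q / t.
Proof.
move=> L0 t0 qE /andP[a0 aC].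
have d0 := drift_cst_ge0.
have -> : 2 * drift_cst * Num.sqrt (8 * L) / L * q / t =
    C / t * (2 * (drift_cst * (Num.sqrt (8 * L) * Num.sqrt s))).
  by rewrite qE; field; rewrite !gt_eqF.
by rewrite mulrCA ler_wpM2r// mulr_ge0// mulr_ge0// mulr_ge0 ?sqrtr_ge0.
Qed.

Lemma gen_cst_le (L n x t0 E : R) : 0 < L -> 0 < n ->
  t0 <= x -> E <= expR (curvature_cst + q * ln 2) * x ->
  Num.sqrt (8 * L) * (2 * drift_cst * Num.sqrt (8 * L) / L / n * (E - 1)) + 2 * (t0 / n) <=
  gen_cst * x / n.
Proof.
move=> L0 n0 tx Ex; have d0 := drift_cst_ge0.
have -> : Num.sqrt (8 * L) * (2 * drift_cst * Num.sqrt (8 * L) / L / n * (E - 1)) +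
    2 * (t0 / n) = (Num.sqrt (8 * L) ^+ 2 / L * (2 * drift_cst * (E - 1)) + 2 * t0) / n.
  by field; rewrite !gt_eqF.
rewrite ler_pM2r ?invr_gt0// sqr_sqrtr ?(mulr_ge0 _ (ltW L0))//.
have -> : 8 * L / L = 8 by rewrite mulfK ?gt_eqF.
have := ler_wpM2l d0 Ex; rewrite /gen_cst; move: (expR _) => F; lra.
Qed.

End Constants.

(** * The generalization bound *)

Theorem theorem2 (R : realType) (L G q : R) :
  exists K : R,
  forall (C s sigma r rho_max mu : R) (d n T : nat)
    (dZ : measure_display) (Z : measurableType dZ) (D : probability Z R)
    (loss : 'rV[R]_d -> Z -> R)
    (alpha : nat -> R) (M : nat -> 'M[R]_d) (theta1 : 'rV[R]_d)
    (dO : measure_display) (Omega : measurableType dO) (P : probability Omega R)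
    (z : 'I_n -> Omega -> Z) (idx : nat -> Omega -> 'I_n)
    (u : nat -> Omega -> 'rV[R]_d),
  let theta := fun (w : Omega) (k : nat) =>
    zo_iter loss alpha mu M theta1 (fun i => z i w) (fun t => idx t w)
            (fun t => u t w) k in
  (* sampling model: S = (z_i) i.i.d. ~ D, i_t i.i.d. uniform on [n],
     u_t i.i.d. ~ N(0, I_d), all mutually independent *)
  (forall i (A : set Z), measurable A -> measurable (z i @^-1` A)) ->
  (forall t k, measurable [set w | idx t w = k]) ->
  (forall t j (B : set R), measurable B -> measurable [set w | B (u t w 0 j)]) ->
  (forall (A : 'I_n -> set Z) (Kt : nat -> {set 'I_n}) (B : nat -> 'I_d -> set R),
     (forall i, measurable (A i)) -> (forall t j, measurable (B t j)) ->
     P [set w | (forall i, A i (z i w)) /\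
                (forall t, (1 <= t <= T)%N -> idx t w \in Kt t) /\
                (forall t j, (1 <= t <= T)%N -> B t j (u t w 0 j))]
     = ((\prod_i D (A i)) *
        (\prod_(1 <= t < T.+1) (#|Kt t|%:R / n%:R)%:E) *
        (\prod_(1 <= t < T.+1) \prod_j normal_prob 0 1 (B t j)))%E) ->
  (0 < n)%N ->
  (* losses measurable in the data, bounded by 1 *)
  (forall th, measurable_fun setT (loss th)) ->
  (forall th zz, `|loss th zz| <= 1) ->
  (* (C-1) *)
  (forall zz, Lsmooth L (fun th => loss th zz)) ->
  (* (C-2) *)
  (forall th, differentiable (pop_risk D loss) th) ->
  (forall th j, (\int[D]_zz ((grad (fun x => loss x zz) th) 0 j)%:E)%E
                = ((grad (pop_risk D loss) th) 0 j)%:E) ->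
  (forall th, (\int[D]_zz
       (enorm (grad (pop_risk D loss) th - grad (fun x => loss x zz) th) ^+ 2)%:E
       <= (sigma ^+ 2)%:E)%E) ->
  (forall th, enorm (grad (pop_risk D loss) th) <= G) ->
  (* subspace matrices *)
  (forall t, (1 <= t <= T)%N ->
     [/\ psd (M t), sigma_max (M t) = 1 & srank (M t) <= s]) ->
  (* Local Intrinsic Dimension for every per-sample loss at every iterate,
     with alignments bounded by rho_max *)
  (r <= d%:R) ->
  (forall w t i, (1 <= t <= T)%N ->
     exists H : 'M[R]_d,
       LID (fun th => loss th (z i w)) (theta w t.-1) L r
           (2 * alpha t * s * G + 2 * mu * Num.sqrt d%:R) H /\
       alignment (M t) H <= rho_max) ->
  (* constants, step sizes, smoothing parameter *)
  0 < C -> q = C * L * Num.sqrt s ->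
  (forall t, (1 <= t <= T)%N -> 0 < alpha t <= C / t%:R) ->
  0 < mu <= 1 / (n%:R * L * (rho_max + s * expR (- s / 2))) ->
  ('E_P[fun w => (pop_risk D loss (theta w T)
                 - emp_risk loss (fun i => z i w) (theta w T))%R]
     <= (K * (T%:R `^ (1 - (1 + q)^-1)) / n%:R)%:E)%E.
Proof.
exists (gen_cst q) => C s sigma r rho_max mu d [//|n'] T dZ Z D loss alpha M theta1.
move=> dO Omega P z idx u theta mz midx mu_ law _ mloss f1 Lf dpop _ _ _ MP _ _ C0 qE
  alphaP /andP[mu0 mu_le].
pose X w := ((fun i => z i w, fun t => idx t w), fun t => u t w).
have sX : sampled D T P X.
  split; last by move=> A K B mA mB; exact: law.
  split=> [i|t _ k|t j _]; first by move=> _ A mA; rewrite setTI; exact: mz.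
    exact: midx.
  by move=> _ A mA; rewrite setTI; exact: mu_.
have closs zz : continuous (loss ^~ zz) by exact: Lsmooth_continuous (Lf zz).
have cpop : continuous (pop_risk D loss) by move=> x; exact: differentiable_continuous.
apply: (expect_generalization_gap closs mloss f1 cpop sX) => i a.
have x0 : 0 <= T%:R `^ (1 - (1 + q)^-1) by exact: powR_ge0.
(* Without steps there is no admissible [t0], but both trajectories are then [theta1]. *)
have [T0|T0] := posnP T.
  under eq_integral do rewrite [X in traj _ _ _ _ _ _ X]T0
    [X in traj _ _ _ _ _ (upd_z _ _ _) X]T0 subrr normr0.
  by rewrite integral0 lee_fin divr_ge0// mulr_ge0 ?gen_cst_ge0.
have MP' t : (1 <= t <= T)%N ->
    [/\ (M t)^T = M t, sigma_max (M t) = 1 & \tr ((M t)^T *m M t) <= s].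
  by move=> /MP[[MT _] M1]; rewrite /srank M1 expr1n divr1.
have [_ M1 Ms] := MP' 1%N T0.
have s1 : 1 <= s := le_trans (sigma_max1_tr M1) Ms.
have d0 : (0 < d)%N.
  have := sigma_max1_tr M1; case: (d) (M 1%N) => // A.
  by rewrite /mxtrace big_ord0 ler10.
have L0 : 0 < L.
  (* For [L = 0] the upper bound on [mu] is an inverse of 0, which is 0 by convention, against
     [0 < mu]. *)
  rewrite lt0r (Lsmooth_gt0 d0 (Lf a)) andbT; apply/eqP => L0.
  by move: mu_le; rewrite L0 mulr0 mul0r invr0 mulr0 leNgt mu0.
have q0 : 0 < q by rewrite qE !mulr_gt0// sqrtr_gt0 (lt_le_trans ltr01).
have alpha_itv t : (1 <= t <= T)%N -> 0 <= alpha t <= C / t%:R.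
  by move=> /alphaP/andP[/ltW -> ->].
have tgt0 t : (1 <= t <= T)%N -> 0 < t%:R :> R by move=> /andP[t1 _]; rewrite ltr0n.
pose B := 2 * drift_cst R * Num.sqrt (8 * L) / L.
have B0 : 0 <= B by rewrite divr_ge0 ?(ltW L0)// mulr_ge0 ?sqrtr_ge0// mulr_ge0 ?drift_cst_ge0.
have [t0 [ht t0x Ex]] := growth_bound q0 (curvature_cst_ge0 q) T0.
apply: le_trans (expect_loss_stability theta1 L0 mu0 q0 (curvature_cst_ge0 q) B0 Lf f1 mloss
  MP' (fun t ht => proj1 (andP (alpha_itv t ht))) _ _ sX i a ht) _.
- by move=> t ht'; exact: (contraction_le L0 C0 s1 (tgt0 t ht') qE (alpha_itv t ht')).
- by move=> t ht'; exact: (drift_le L0 (tgt0 t ht') qE (alpha_itv t ht')).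
- by rewrite lee_fin; apply: gen_cst_le; rewrite ?ltr0n.
Qed.
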